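(* Let $\mathfrak g$ be a finite-dimensional real semi-simple Lie algebra, let $n\ge 1$, and let $(\mu:\phi)\in\mathcal L_n(\mathfrak g)$ be a semi-simple pair, i.e. the Lie algebra $\mathfrak h_\mu=(\mathbb R^n,\mu)$ is semi-simple. Then the $GC_n(\mathfrak g)$-orbit of $(\mu:\phi)$ contains a point at which the energy functional $E:\mathcal L_n(\mathfrak g)\to\mathbb R$ attains its global minimum on $\mathcal L_n(\mathfrak g)$.
   Context: Notation. $V_n(\mathfrak g)=\mathrm{Lin}(\Lambda^2\mathbb R^n,\mathbb R^n)\oplus \mathrm{Lin}(\mathbb R^n,\mathfrak g)$. $L_n(\mathfrak g)\subseteq V_n(\mathfrak g)$ is the set of pairs $(\mu,\phi)$ such that $\mu$ is a Lie bracket on $\mathbb R^n$ and $\phi:\mathfrak h_\mu=(\mathbb R^n,\mu)\to\mathfrak g$ is a Lie algebra homomorphism. $\mathcal L_n(\mathfrak g)=(L_n(\mathfrak g)\setminus\{(0,0)\})/\mathbb R^\times\subseteq\mathbb P(V_n(\mathfrak g))$, and $(\mu:\phi)$ denotes the class of $(\mu,\phi)$. Let $\mathrm{Inn}(\mathfrak g)$ be the group of inner automorphisms of $\mathfrak g$ (the connected subgroup of $GL(\mathfrak g)$ with Lie algebra $\mathrm{ad}(\mathfrak g)$). The group $GC_n(\mathfrak g)=GL(n,\mathbb R)\times \mathrm{Inn}(\mathfrak g)$ acts by $(g,h)\cdot(\mu,\phi)=(g\,\mu(g^{-1}\cdot,g^{-1}\cdot),\,h\phi g^{-1})$, preserving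 $L_n(\mathfrak g)$, hence it acts on $\mathcal L_n(\mathfrak g)$. The Lie algebra $\mathfrak{gc}_n(\mathfrak g)=\mathfrak{gl}(n,\mathbb R)\oplus\mathfrak g$ acts by $(A,v)\cdot(\mu,\phi)=(A\cdot\mu,\ \mathrm{ad}_v\phi-\phi A)$ with $(A\cdot\mu)(X,Y)=A\mu(X,Y)-\mu(AX,Y)-\mu(X,AY)$. Fix an inner product on $\mathbb R^n$ and a Cartan involution $\theta$ of $\mathfrak g$; with $B_{\mathfrak g}$ the Killing form, put $\langle X,Y\rangle=-B_{\mathfrak g}(\theta X,Y)$ on $\mathfrak g$. The induced inner products are: on $V_n(\mathfrak g)$, $\|(\mu,\phi)\|^2=\sum_{i<j}\|\mu(e_i,e_j)\|^2+\sum_i\|\phi(e_i)\|^2$ for any orthonormal basis $(e_i)$ of $\mathbb R^n$; on $\mathfrak{gc}_n(\mathfrak g)$, $\langle (A,v),(B,w)\rangle=\mathrm{Tr}(AB^* )-B_{\mathfrak g}(\theta v,w)$. The moment map $m:\mathcal L_n(\mathfrak g)\to\mathfrak{gc}_n(\mathfrak g)$ is defined by $\langle m(\mu:\phi),(A,v)\rangle=\langle (A,v)\cdot(\mu,\phi),(\mu,\phi)\rangle/\|(\mu,\phi)\|^2$ for all $(A,v)$, and the energy functional is $E(\mu:\phi)=\|m(\mu:\phi)\|^2$. *)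

(* Defs.v *)
From HB Require Import structures.
From mathcomp Require Import all_boot all_order all_algebra.
From mathcomp Require Import boolp classical_sets functions reals.
From mathcomp Require Import topology normedtype sequences.

Set Implicit Arguments.
Unset Strict Implicit.
Unset Printing Implicit Defensive.

Import Order.TTheory GRing.Theory Num.Theory.
Import numFieldNormedType.Exports.

Local Open Scope classical_set_scope.
Local Open Scope ring_scope.

Section LieAlgebras.
Variable R : realType.

Definition lie_bracket (V : lmodType R) (b : V -> V -> V) : Prop :=
  [/\ bilinear_for *:%R *:%R b,
      forall x, b x x = 0
    & forall x y z, b x (b y z) + b y (b z x) + b z (b x y) = 0].

Definition lie_ideal (V : vectType R) (b : V -> V -> V) (I : {vspace V}) :=
  forall x y, y \in I -> b x y \in I.

(* The span of all [x, y] with x, y in I; by bilinearity it is enough to let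
   x and y range over a basis of I. *)
Definition derived_space (V : vectType R) (b : V -> V -> V) (I : {vspace V}) :=
  <<[seq b x y | x <- vbasis I, y <- vbasis I]>>%VS.

Definition lie_solvable (V : vectType R) (b : V -> V -> V) (I : {vspace V}) :=
  exists k, iter k (derived_space b) I = 0%VS.

Definition semisimple_lie (V : vectType R) (b : V -> V -> V) : Prop :=
  lie_bracket b /\
  forall I : {vspace V}, lie_ideal b I -> lie_solvable b I -> I = 0%VS.

(* Meaningful for linear f. *)
Definition lin_trace (V : vectType R) (f : V -> V) : R :=
  \sum_(i < \dim {:V}) coord (vbasis {:V}) i (f (vbasis {:V})`_i).

Definition killing (V : vectType R) (b : V -> V -> V) (x y : V) : R :=
  lin_trace (b x \o b y).

Definition cartan_involution (V : vectType R) (b : V -> V -> V)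
    (theta : V -> V) : Prop :=
  [/\ linear theta,
      forall x, theta (theta x) = x,
      forall x y, theta (b x y) = b (theta x) (theta y)
    & forall x, x != 0 -> 0 < - killing b (theta x) x].

(* The exponential series sum_k f^k x / k!, summed coordinatewise in a basis of
   V; it converges whenever f is linear, see lin_exp_cvg. *)
Definition lin_exp (V : vectType R) (f : V -> V) (x : V) : V :=
  \sum_(i < \dim {:V})
    limn (series (fun k => coord (vbasis {:V}) i (iter k f x) / k`!%:R))
      *: (vbasis {:V})`_i.

(* The connected Lie subgroup of GL(V) with Lie algebra ad(V) is the subgroup
   generated by the maps exp(ad v). The set of these generators is closed under
   inverses, so the subgroup consists of their finite products. *)
Inductive inner_aut (V : vectType R) (b : V -> V -> V) : (V -> V) -> Prop :=
| inner_aut_id : inner_aut b id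
| inner_aut_exp v h : inner_aut b h -> inner_aut b (lin_exp (b v) \o h).

Lemma linear_combE (V W : lmodType R) (f : V -> W) (m : nat)
    (c : 'I_m -> R) (v : 'I_m -> V) : linear f ->
  f (\sum_j c j *: v j) = \sum_j c j *: f (v j).
Proof.
move=> fl; pose F : {linear V -> W} :=
  HB.pack f (GRing.isLinear.Build R V W *:%R f fl).
have FE : f = F by [].
by rewrite FE linear_sum; apply: eq_bigr => j _; rewrite linearZ.
Qed.

Lemma scalar_combE (V : lmodType R) (f : V -> R) (m : nat)
    (c : 'I_m -> R) (v : 'I_m -> V) : scalar f ->
  f (\sum_j c j *: v j) = \sum_j c j * f (v j).
Proof. by move=> fl; exact: (@linear_combE V R^o). Qed.

Lemma lin_exp_cvg (V : vectType R) (f : V -> V) (x : V) i : linear f ->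
  cvgn (series (fun k => coord (vbasis {:V}) i (iter k f x) / k`!%:R)).
Proof.
move=> fl; pose b := vbasis {:V}; pose a k : R := \sum_j `|coord b j (iter k f x)|.
pose K : R := \sum_(j < \dim {:V}) \sum_l `|coord b l (f b`_j)|.
have a0 k : 0 <= a k by apply: sumr_ge0.
have K0 : 0 <= K by apply: sumr_ge0 => j _; apply: sumr_ge0.
have aS k : a k.+1 <= K * a k.
  rewrite /a /=; set y := iter k f x.
  have fyE l : coord b l (f y) = \sum_j coord b j y * coord b l (f b`_j).
    have -> : f y = \sum_j coord b j y *: f b`_j.
      by rewrite {1}(coord_vbasis (memvf y)) linear_combE.
    by rewrite linear_sum; apply: eq_bigr => j _; rewrite linearZ_LR.
  have -> : K * \sum_j `|coord b j y| =
            \sum_j `|coord b j y| * K.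
    by rewrite mulrC mulr_suml.
  apply: (@le_trans _ _ (\sum_l \sum_j `|coord b j y| * `|coord b l (f b`_j)|)).
    apply: ler_sum => l _; rewrite fyE; apply: le_trans (ler_norm_sum _ _ _) _.
    by apply: ler_sum => j _; rewrite normrM.
  rewrite exchange_big; apply: ler_sum => j _; rewrite -mulr_sumr.
  apply: ler_wpM2l => //; rewrite /K [leRHS](bigD1 j) //= lerDl.
  by apply: sumr_ge0 => j' _; apply: sumr_ge0.
have ak k : a k <= a 0%N * K ^+ k.
  elim: k => [|k IH]; first by rewrite expr0 mulr1.
  apply: le_trans (aS k) _; rewrite exprS mulrCA.
  exact: ler_wpM2l.
apply: normed_cvg.
apply: (@series_le_cvg _ _ (fun k => a 0%N * exp_coeff K k)) => [k|k|k|].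
- exact: normr_ge0.
- by rewrite mulr_ge0 // exp_coeff_ge0.
- rewrite /= normrM normfV [`|_%:R|]ger0_norm // /exp_coeff /= mulrA.
  rewrite ler_wpM2r ?invr_ge0 ?ler0n //; apply: le_trans (ak k).
  by rewrite /a [leRHS](bigD1 i) //= lerDl sumr_ge0.
- have -> : (fun k => a 0%N * exp_coeff K k) = a 0%N *: exp_coeff K by [].
  exact/is_cvg_seriesZ/is_cvg_series_exp_coeff.
Qed.

Lemma riesz (W : vectType R) (b : W -> W -> R) (l : W -> R) :
  bilinear_for *%R *%R b -> (forall x, x != 0 -> 0 < b x x) -> scalar l ->
  exists2 M, (forall X, b M X = l X)
           & forall M', (forall X, b M' X = l X) -> M' = M.
Proof.
move=> [bl br] bpos ll.
pose B := vbasis {:W}.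
pose F M : 'rV[R]_(\dim {:W}) := \row_i b M B`_i.
have Fl : linear F.
  by move=> c x y; apply/rowP => i; rewrite !mxE; exact: bl.
pose F' : {linear W -> 'rV[R]_(\dim {:W})} :=
  HB.pack F (GRing.isLinear.Build R W _ *:%R F Fl).
have eqB (f h : W -> R) : scalar f -> scalar h ->
    (forall i : 'I_(\dim {:W}), f B`_i = h B`_i) -> f =1 h.
  move=> fl hl fh x; rewrite (coord_vbasis (memvf x)) !scalar_combE //.
  by apply: eq_bigr => i _; rewrite fh.
have inj M M' : b M =1 b M' -> M = M'.
  move=> E; apply/eqP; rewrite -subr_eq0; apply/negPn/negP => /bpos.
  have -> : M - M' = (-1) *: M' + M by rewrite scaleN1r addrC.
  by have /= -> := bl (-1 *: M' + M) (-1) M' M; rewrite E mulN1r addNr ltxx.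
have ker0 : lker (linfun F') == 0%VS.
  apply/lker0P => M M' E; have FE : F M = F M' by move: E; rewrite (lfunE F' M) (lfunE F' M').
    apply: inj.
  apply: eqB => // i.
  by have := congr1 (fun r : 'rV_ _ => r 0 i) FE; rewrite !mxE.
have full : limg (linfun F') = fullv.
  apply/eqP; rewrite eqEdim subvf /= limg_dim_eq; last first.
    by apply/eqP; rewrite (eqP ker0) capv0.
  by rewrite dimvf /dim /= mul1n.
have /memv_imgP[M _ ME] : \row_i l B`_i \in limg (linfun F').
  by rewrite full memvf.
have bM : b M =1 l.
  apply: eqB => // i.
  have := congr1 (fun r : 'rV_ _ => r 0 i) ME.
  by rewrite lfunE /= !mxE => ->.
by exists M => // M' bM'; apply: inj => X; rewrite bM bM'.
Qed.

End LieAlgebras.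

Section LiePairs.
Variables (R : realType) (n : nat) (g : vectType R).
Local Notation U := 'cV[R]_n.

(* V_n(g) consists of the pairs whose first component is bilinear and
   alternating, i.e. a linear map from the exterior square, and whose second
   component is linear; lie_pair below carves L_n(g) out of it. The operations
   of the R-module pairs are pointwise. *)
Definition pairs : Type := ((U -> U -> U) * (U -> g))%type.

(* A point of the projective space is the set of nonzero multiples of a nonzero
   vector; proj_class p is the class written (mu : phi). *)
Definition proj_class (p : pairs) : set pairs :=
  [set c *: p | c in [set c : R | c != 0]].

Variables (br : g -> g -> g) (theta : g -> g).

Definition lie_pair (p : pairs) : Prop :=
  [/\ lie_bracket p.1, linear p.2
    & forall x y, p.2 (p.1 x y) = br (p.2 x) (p.2 y)].

Definition proj_L : set (set pairs) :=
  [set proj_class p | p in [set p | lie_pair p /\ p <> 0]].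

Definition gc_action (a : 'M[R]_n) (h : g -> g) (p : pairs) : pairs :=
  (fun x y => a *m p.1 (invmx a *m x) (invmx a *m y),
   fun x => h (p.2 (invmx a *m x))).

Definition gc_orbit (P : set pairs) : set (set pairs) :=
  [set Q | exists a h,
     [/\ a \in unitmx, inner_aut br h & Q = gc_action a h @` P]].

Definition lie_gc_action (X : 'M[R]_n * g) (p : pairs) : pairs :=
  (fun x y => X.1 *m p.1 x y - p.1 (X.1 *m x) y - p.1 x (X.1 *m y),
   fun x => br X.2 (p.2 x) - p.2 (X.1 *m x)).

Variables (ip : U -> U -> R) (e : 'I_n -> U).

Definition inner_product : Prop :=
  [/\ bilinear_for *%R *%R ip, forall x y, ip x y = ip y x
    & forall x, x != 0 -> 0 < ip x x].

(* Having n members, such a family is a basis. *)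
Definition orthonormal_basis : Prop := forall i j, ip (e i) (e j) = (i == j)%:R.

Definition gram : 'M[R]_n :=
  \matrix_(i, j) ip (delta_mx i 0) (delta_mx j 0).

(* The adjoint with respect to ip; see adjoint_mxP. *)
Definition adjoint_mx (B : 'M[R]_n) : 'M[R]_n := invmx gram *m B^T *m gram.

Definition g_ip (v w : g) : R := - killing br (theta v) w.

Definition gc_ip (X Y : 'M[R]_n * g) : R :=
  \tr (X.1 *m adjoint_mx Y.1) + g_ip X.2 Y.2.

Definition pair_ip (p q : pairs) : R :=
  \sum_(i < n) \sum_(j < n | (i < j)%N)
     ip (p.1 (e i) (e j)) (q.1 (e i) (e j))
  + \sum_(i < n) g_ip (p.2 (e i)) (q.2 (e i)).

Definition is_moment (P : set pairs) (M : 'M[R]_n * g) : Prop :=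
  forall p, P p -> forall X,
    gc_ip M X = pair_ip (lie_gc_action X p) p / pair_ip p p.

(* The unique M with is_moment P M; see moment_mapP and moment_map_uniq. *)
Definition moment_map (P : set pairs) : 'M[R]_n * g := xget 0 (is_moment P).

Definition energy (P : set pairs) : R :=
  gc_ip (moment_map P) (moment_map P).

Section MomentMap.
Hypotheses (hbr : lie_bracket br) (htheta : cartan_involution br theta).
Hypotheses (hip : inner_product) (he : orthonormal_basis).

Lemma ip_gram x y : ip x y = (x^T *m gram *m y) 0 0.
Proof.
have [[ipl ipr] _ _] := hip.
have colE (z : U) : z = \sum_i z i 0 *: delta_mx i 0.
  by rewrite [LHS]matrix_sum_delta; apply: eq_bigr => i _; rewrite big_ord1.
rewrite mxE {1}(colE y) scalar_combE //; apply: eq_bigr => j _.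
rewrite mulrC mxE {1}(colE x) (@scalar_combE _ _ (ip^~ _)) //; congr (_ * _).
by apply: eq_bigr => i _; rewrite !mxE.
Qed.

Lemma gram_unit : gram \in unitmx.
Proof.
rewrite -row_free_unit; apply/inj_row_free => v vG; apply/eqP/negPn/negP => v0.
have [_ _ ippos] := hip.
have : 0 < ip v^T v^T.
  by apply: ippos; apply: contra v0 => /eqP/(congr1 trmx)/eqP; rewrite trmxK trmx0.
by rewrite ip_gram trmxK vG mul0mx mxE ltxx.
Qed.

Lemma adjoint_mxP B x y : ip (B *m x) y = ip x (adjoint_mx B *m y).
Proof.
rewrite !ip_gram trmx_mul /adjoint_mx !mulmxA mulmxK ?gram_unit //.
Qed.

Lemma killing_bilinear : bilinear_for *%R *%R (killing br).
Proof.
have [[brl brr] _ _] := hbr.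
split=> [y a u v | x a u v]; rewrite /killing /lin_trace /=.
- rewrite [a * _]mulr_sumr -big_split /=; apply: eq_bigr => i _.
  by have /= -> := brl (br y (vbasis {:g})`_i) a u v; rewrite linearP.
- rewrite [a * _]mulr_sumr -big_split /=; apply: eq_bigr => i _.
  by have /= -> := brl (vbasis {:g})`_i a u v; rewrite brr linearP.
Qed.

Lemma g_ip_bilinear : bilinear_for *%R *%R g_ip.
Proof.
have [kl kr] := killing_bilinear; have [thl _ _ _] := htheta.
split=> [y a u v | x a u v]; rewrite /g_ip /=.
- by rewrite thl; have /= -> := kl y a (theta u) (theta v); rewrite opprD mulrN.
- by have /= -> := kr (theta x) a u v; rewrite opprD mulrN.
Qed.

Lemma gc_ip_bilinear : bilinear_for *%R *%R gc_ip.
Proof.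
have [gl gr] := g_ip_bilinear.
split=> [Y a X X' | X a Y Y']; rewrite /gc_ip /=.
- have /= -> := gl Y.2 a X.2 X'.2.
  by rewrite mulmxDl -scalemxAl mxtraceD mxtraceZ mulrDr addrACA.
- have /= -> := gr X.2 a Y.2 Y'.2.
  rewrite /adjoint_mx !(linearD, linearZ) /= !mulmxDl -!scalemxAl.
  by rewrite mulmxDr -scalemxAr mxtraceD mxtraceZ mulrDr addrACA.
Qed.

Lemma gc_ip_pos X : X != 0 -> 0 < gc_ip X X.
Proof.
pose E : 'M[R]_n := \matrix_(i, j) e j i 0.
have EGE : E^T *m gram *m E = 1%:M.
  apply/matrixP => i j; rewrite [RHS]mxE -he ip_gram.
  have -> : (e i)^T = row i E^T by apply/rowP => k; rewrite !mxE.
  have -> : e j = col j E by apply/colP => k; rewrite !mxE.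
  by rewrite -!row_mul colE mulmxA -colE !mxE.
have [_ Eu] := mulmx1_unit EGE.
have ETu : E^T \in unitmx by rewrite unitmx_tr.
have gramE : gram = (invmx E)^T *m invmx E.
  have := congr1 (fun M => invmx E^T *m M *m invmx E) EGE => /=.
  by rewrite -!mulmxA mulKmx // mulmxV // mulmx1 mul1mx trmx_inv.
have igramE : invmx gram = E *m E^T.
  have GEE : gram *m (E *m E^T) = 1%:M.
    by rewrite gramE -mulmxA mulKmx // trmx_inv mulVmx.
  by rewrite -[RHS](mulKmx gram_unit) GEE mulmx1.
have trE (A : 'M[R]_n) : \tr (A *m adjoint_mx A) =
    \sum_i \sum_j (invmx E *m A *m E) i j ^+ 2.
  have -> : \tr (A *m adjoint_mx A) =
      \tr ((invmx E *m A *m E) *m (invmx E *m A *m E)^T).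
    rewrite /adjoint_mx igramE gramE !trmx_mul !mulmxA mxtrace_mulC.
    by rewrite !mulmxA.
  apply: eq_bigr => i _; rewrite mxE; apply: eq_bigr => j _.
  by rewrite [in X in _ * X]mxE expr2.
have tr_ge0 (A : 'M[R]_n) : 0 <= \tr (A *m adjoint_mx A).
  by rewrite trE; apply: sumr_ge0 => i _; apply: sumr_ge0 => j _; rewrite sqr_ge0.
have tr_gt0 (A : 'M[R]_n) : A != 0 -> 0 < \tr (A *m adjoint_mx A).
  move=> A0; rewrite lt_def tr_ge0 andbT; apply: contra A0; rewrite trE.
  rewrite psumr_eq0 => [/allP /= C0|i _]; last first.
    by apply: sumr_ge0 => j _; rewrite sqr_ge0.
  have {}C0 : invmx E *m A *m E = 0.
    apply/matrixP => i j; have := C0 i (mem_index_enum i).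
    rewrite psumr_eq0 => [/allP /(_ j (mem_index_enum j))|k _]; last exact: sqr_ge0.
    by rewrite /= sqrf_eq0 [RHS]mxE => /eqP.
  by rewrite -(mulKVmx Eu A) -(mulmxK Eu (invmx E *m A)) C0 mul0mx mulmx0.
have [_ _ _ thpos] := htheta.
have g_gt0 v : v != 0 -> 0 < g_ip v v by exact: thpos.
have g0 : g_ip 0 0 = 0.
  have [gl _] := g_ip_bilinear.
  by have := gl 0 (-1) 0 0; rewrite /= scaler0 addr0 mulN1r addNr.
case: X => A v X0; rewrite /gc_ip /=.
have [v0|v0] := eqVneq v 0; last by rewrite ltr_wpDl // g_gt0.
rewrite v0 g0 addr0; apply: tr_gt0; apply: contra X0 => /eqP ->.
by rewrite v0.
Qed.

Lemma pair_ip_linearl r : scalar (pair_ip^~ r).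
Proof.
have [[ipl _] _ _] := hip; have [gl _] := g_ip_bilinear.
move=> a p q; rewrite /pair_ip mulrDr addrACA; congr (_ + _).
  rewrite mulr_sumr -big_split; apply: eq_bigr => i _ /=.
  rewrite mulr_sumr -big_split; apply: eq_bigr => j _ /=.
  exact: ipl.
rewrite mulr_sumr -big_split; apply: eq_bigr => i _ /=; exact: gl.
Qed.

Lemma pair_ip_scale c p q : pair_ip (c *: p) (c *: q) = c ^+ 2 * pair_ip p q.
Proof.
have [[ipl ipr] _ _] := hip; have [gl gr] := g_ip_bilinear.
have ipZ x y : ip (c *: x) (c *: y) = c ^+ 2 * ip x y.
  have := scalar_combE (fun _ : 'I_1 => c) (fun=> x) (ipl (c *: y)).
  have := scalar_combE (fun _ : 'I_1 => c) (fun=> y) (ipr x).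
  by rewrite !big_ord1 => -> ->; rewrite mulrA expr2.
have gZ x y : g_ip (c *: x) (c *: y) = c ^+ 2 * g_ip x y.
  have := scalar_combE (fun _ : 'I_1 => c) (fun=> x) (gl (c *: y)).
  have := scalar_combE (fun _ : 'I_1 => c) (fun=> y) (gr x).
  by rewrite !big_ord1 => -> ->; rewrite mulrA expr2.
rewrite /pair_ip mulrDr; congr (_ + _).
  rewrite mulr_sumr; apply: eq_bigr => i _ /=.
  by rewrite mulr_sumr; apply: eq_bigr => j _; rewrite -ipZ.
by rewrite mulr_sumr; apply: eq_bigr => i _; rewrite -gZ.
Qed.

Lemma lie_gc_action_scale c X p :
  lie_gc_action X (c *: p) = c *: lie_gc_action X p.
Proof.
have [[_ brr] _ _] := hbr.
congr (_, _) => /=; last first.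
  apply/funext => x /=; rewrite scalerBr.
  have := linear_combE (fun _ : 'I_1 => c) (fun=> p.2 x) (brr X.2).
  by rewrite !big_ord1 => ->.
apply/funext => x; apply/funext => y.
change (X.1 *m (c *: p.1 x y) - c *: p.1 (X.1 *m x) y - c *: p.1 x (X.1 *m y)
  = c *: (X.1 *m p.1 x y - p.1 (X.1 *m x) y - p.1 x (X.1 *m y))).
by rewrite !scalerBr scalemxAr.
Qed.

Lemma lie_gc_action_linear p : bilinear_for *:%R *:%R p.1 -> linear p.2 ->
  linear (lie_gc_action^~ p).
Proof.
move=> [mul mur] phil; have [[brl _] _ _] := hbr.
move=> a X Y; congr (_, _) => /=; last first.
  apply/funext => x /=; rewrite mulmxDl -scalemxAl phil brl /= scalerBr.
  by rewrite opprD addrACA.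
apply/funext => x; apply/funext => y /=.
have aux (Z : zmodType) (q q' r r' s s' : Z) :
    q + q' - (r + r') - (s + s') = q - r - s + (q' - r' - s').
  by rewrite !opprD (addrACA q) [LHS]addrACA.
have /= mulE := mul y a (X.1 *m x) (Y.1 *m x).
by rewrite !mulmxDl -!scalemxAl mur mulE aux -!scalerBr.
Qed.

Lemma moment_map_exists P : proj_L P ->
  exists2 M, is_moment P M & forall M', is_moment P M' -> M' = M.
Proof.
move=> [p [[[mubil _ _] phil _] _] <-].
pose l X := pair_ip (lie_gc_action X p) p / pair_ip p p.
have ll : scalar l.
  move=> a X Y; rewrite /l lie_gc_action_linear // pair_ip_linearl.
  by rewrite mulrDl mulrA.
have [M lM uniqM] := riesz gc_ip_bilinear gc_ip_pos ll.
exists M => [_ [c /= c0 <-] X|M' momM'].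
  rewrite lie_gc_action_scale !pair_ip_scale lM /l -mulf_div.
  by rewrite divff ?mul1r // expf_neq0.
by apply: uniqM => X; apply: momM'; exists 1; rewrite /= ?oner_neq0 ?scale1r.
Qed.

Lemma moment_mapP P : proj_L P -> is_moment P (moment_map P).
Proof.
by move=> /moment_map_exists[M momM _]; apply: xgetPex; exists M.
Qed.

Lemma moment_map_uniq P M : proj_L P -> is_moment P M -> M = moment_map P.
Proof.
move=> PL; have [M0 _ uniqM0] := moment_map_exists PL.
by move=> /uniqM0 ->; rewrite [RHS](uniqM0 _ (moment_mapP PL)).
Qed.

End MomentMap.
End LiePairs.

(* Main.v *)
Require Import Defs.
From HB Require Import structures.
From mathcomp Require Import all_boot all_order all_algebra.
From mathcomp Require Import mxred complex zify ring lra.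
From mathcomp Require Import boolp classical_sets functions reals.
From mathcomp Require Import topology normedtype sequences.

Set Implicit Arguments.
Unset Strict Implicit.
Unset Printing Implicit Defensive.

Import Order.TTheory GRing.Theory Num.Theory.
Import numFieldNormedType.Exports.
Local Open Scope ring_scope.

(** Pairing the moment map with (I, 0), which acts on pairs by -1 and has squared
    length n, shows E >= 1/n everywhere ([energy_ge]), with equality where the
    moment map is (- I / n, 0). So it is enough to find in the orbit of (mu, phi) a
    pair l at which the first variation of the norm under GL_n x Inn(g) only
    depends on the trace of the gl_n component ([energy_critical]).

    Such an l is found by minimising. As mu is semisimple, its Killing form is
    nondegenerate ([cartan_criterion]), and along the orbit the Gram determinant of
    this form changes by det(a)^-2 only. Minimising the norm under SL_n x Inn(g)
    thus amounts to maximising that determinant on the unit sphere of the orbit.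
    A maximum exists in the closure of the orbit ([minimal_pair]); it is again a
    Lie pair with nondegenerate Killing form, and the first variation vanishes
    there in the directions of trace zero ([critical]).

    It remains to see that l belongs to the orbit and not only to its closure,
    which follows once nearby Lie pairs all lie in the orbit of l. At l the
    stabiliser in gc_n(g) is closed under adjoints ([stabilizer_star]), because the
    moment map is a multiple of the identity. Therefore adjoints of inner
    derivations are inner, phi is compatible with the Cartan involutions
    ([compatible_star]), and the Casimir operators of the modules R^n and g are
    sums of operators rho^* rho. Their positivity gives the two Whitehead lemmas
    directly, and these say that every first-order deformation of l among Lie pairs
    is tangent to its orbit ([infinitesimal_rigidity]). The passage to actual
    deformations ([local_rigidity]) is the argument of Nijenhuis and Richardson:
    by a contraction, move a nearby Lie pair by the group until its difference with
    l has no component along the orbit; the quadratic equations of Lie pairs then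
    force the difference to vanish.

    Throughout, bilinear and linear maps are bundled as elements of the
    finite-dimensional spaces 'Hom(U, 'End(U)) and 'Hom(U, g), so that limits and
    differentials can be expressed by coordinates. *)

(** * Linear maps, traces and the Killing form *)

Section Utilities.
Variables (R : realType) (V W : vectType R).

Lemma lfun_of_linear (f : V -> W) : linear f ->
  exists F : 'Hom(V, W), forall x, F x = f x.
Proof.
move=> fl; pose F : {linear V -> W} :=
  HB.pack f (GRing.isLinear.Build R V W *:%R f fl).
by exists (linfun F) => x; rewrite lfunE.
Qed.

Lemma span_ind (P : V -> Prop) (X : seq V) :
  P 0 -> (forall c u v, P u -> P v -> P (c *: u + v)) ->
  (forall x, x \in X -> P x) -> forall x, x \in <<X>>%VS -> P x.
Proof.
move=> P0 PD PX x /(@coord_span _ _ _ (in_tuple X)) ->.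
elim/big_ind: _ => // [u v Pu Pv|i _].
  by have := PD 1 u v Pu Pv; rewrite scale1r.
rewrite -[X in P X]addr0; apply: PD => //.
by apply: PX; apply: mem_nth.
Qed.

Lemma lfD (F : 'Hom(V, W)) x y : F (x + y) = F x + F y.
Proof. exact: linearD. Qed.
Lemma lfZ (F : 'Hom(V, W)) c x : F (c *: x) = c *: F x.
Proof. exact: linearZ. Qed.
Lemma lfN (F : 'Hom(V, W)) x : F (- x) = - F x.
Proof. exact: linearN. Qed.
Lemma lf0 (F : 'Hom(V, W)) : F 0 = 0.
Proof. exact: linear0. Qed.
Definition lflin := (lfD, lfZ, lfN, lf0).

Lemma lf_sum (F : 'Hom(V, W)) I (r : seq I) (P : pred I) (x : I -> V) :
  F (\sum_(i <- r | P i) x i) = \sum_(i <- r | P i) F (x i).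
Proof. exact: linear_sum. Qed.

End Utilities.

Definition lfE := (add_lfunE, scale_lfunE, opp_lfunE, zero_lfunE, comp_lfunE).

Lemma lfun2_of_bilinear (R : realType) (V1 V2 W : vectType R)
    (f : V1 -> V2 -> W) : bilinear_for *:%R *:%R f ->
  exists F : 'Hom(V1, 'Hom(V2, W)), forall x y, F x y = f x y.
Proof.
move=> [fl fr].
have /choice[F FE] : forall x, exists Fx : 'Hom(V2, W), forall y, Fx y = f x y.
  by move=> x; apply: lfun_of_linear; exact: fr.
have Fl : linear F.
  move=> c x x'; apply/lfunP => y; rewrite add_lfunE scale_lfunE !FE.
  exact: fl.
by have [G GE] := lfun_of_linear Fl; exists G => x y; rewrite GE.
Qed.

Section Trace.
Import passmx.
Variables (R : realType) (V : vectType R).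

Definition ltr (f : 'End(V)) : R := lin_trace f.

Lemma ltr_mxof (f : 'End(V)) :
  ltr f = \tr (mxof (vbasis {:V}) (vbasis {:V}) f).
Proof. by apply: eq_bigr => i _; rewrite !mxE /= vecof_delta. Qed.

Lemma ltrC (f h : 'End(V)) : ltr (f \o h)%VF = ltr (h \o f)%VF.
Proof. by rewrite !ltr_mxof !(mxof_comp _ _ (vbasisP _)) mxtrace_mulC. Qed.

Lemma ltr_is_scalar : scalar ltr.
Proof. by move=> a f h; rewrite !ltr_mxof !linearP. Qed.

HB.instance Definition _ :=
  GRing.isLinear.Build R 'End(V) R _ ltr ltr_is_scalar.

End Trace.

Section LieAlgebra.
Variables (R : realType) (L : vectType R) (b : 'Hom(L, 'End(L))).

Definition lie_lfun : Prop := lie_bracket (fun x y => b x y).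

(** [kilE] identifies this with the Killing form of the unbundled bracket. *)
Definition kil (x y : L) : R := ltr (b x \o b y)%VF.

Lemma kilE x y : killing (fun x y => b x y) x y = kil x y.
Proof. by apply: eq_bigr => i _; rewrite comp_lfunE. Qed.

Lemma kilC x y : kil x y = kil y x.
Proof. exact: ltrC. Qed.

Hypothesis bL : lie_lfun.

Lemma bxx x : b x x = 0. Proof. by case: bL. Qed.

Lemma bC x y : b x y = - b y x.
Proof.
apply/eqP; rewrite -addr_eq0; apply/eqP.
by have := bxx (x + y); rewrite !(lflin, lfE) !bxx add0r addr0 addrC.
Qed.

Lemma bJ x y z : b (b x y) z = b x (b y z) - b y (b x z).
Proof.
have [_ _ J] := bL; move: (J x y z).
rewrite (bC z (b x y)) (bC z x) lfN => /eqP.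
by rewrite subr_eq0 => /eqP <-.
Qed.

Lemma b_comm x y : b (b x y) = ((b x \o b y) - (b y \o b x))%VF.
Proof. by apply/lfunP => z; rewrite bJ !lfE. Qed.

Lemma kil_inv x y z : kil (b x y) z = kil x (b y z).
Proof.
rewrite /kil !b_comm comp_lfunDl comp_lfunDr comp_lfunNl comp_lfunNr !linearB /=.
by rewrite -!comp_lfunA; congr (_ - _); rewrite ltrC -comp_lfunA.
Qed.

Definition nondeg := forall x, (forall y, kil x y = 0) -> x = 0.

End LieAlgebra.

(** * Engel's theorem *)

Section Engel.
Variables (R : realType) (L : vectType R) (b : 'Hom(L, 'End(L))).
Hypothesis bL : lie_lfun b.
Implicit Types T d : {vspace L}.

Definition subalgebra T := forall x y, x \in T -> y \in T -> b x y \in T.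

(** Nilpotency of the action of T, element by element: all k-fold iterated
    brackets with elements of T, starting from y, vanish. *)
Fixpoint killed T k (y : L) : Prop :=
  if k is k'.+1 then forall t, t \in T -> killed T k' (b t y) else y = 0.

Lemma killedP T k c x y :
  killed T k x -> killed T k y -> killed T k (c *: x + y).
Proof.
elim: k x y => [|k IH] x y /= => [-> ->|hx hy t tT]; first by rewrite scaler0 addr0.
by rewrite lfD lfZ; apply: IH; [exact: hx|exact: hy].
Qed.

Lemma killed0 T k : killed T k 0.
Proof. by elim: k => [|k IH] //= t _; rewrite lf0. Qed.

Lemma killedD T k x y : killed T k x -> killed T k y -> killed T k (x + y).
Proof. by move=> hx hy; have := killedP 1 hx hy; rewrite scale1r. Qed.

Lemma killedZ T k c x : killed T k x -> killed T k (c *: x).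
Proof. by move=> hx; have := killedP c hx (killed0 T k); rewrite addr0. Qed.

Lemma killedS T k y : killed T k y -> killed T k.+1 y.
Proof.
elim: k y => [|k IH] y; first by move=> /= -> t _; rewrite lf0.
by move=> hy t tT; apply: IH; apply: hy.
Qed.

(** Moving [ad x] past the elements of T costs brackets [t, x], which lie in T
    again. *)
Lemma killed_normal T x : (forall t, t \in T -> b t x \in T) ->
  forall k y, killed T k y -> killed T k (b x y).
Proof.
move=> xT; elim=> [|k IH] y; first by move=> /= ->; rewrite lf0.
move=> hy t tT.
have -> : b t (b x y) = b x (b t y) + b (b t x) y by rewrite bJ // addrC subrK.
by apply: killedD; [apply: IH; apply: hy|apply: hy; apply: xT].
Qed.

(** Among k * m brackets with x and elements of T, either m consecutive ones are with
    x, and vanish, or k are with elements of T, and [killed_normal] allows ignoring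
    the brackets with x in between. *)
Lemma killed_adjoin T x m : (forall t, t \in T -> b t x \in T) ->
  (forall y, iter m (b x) y = 0) ->
  forall k y, killed T k y -> killed (T + <[x]>) (k * m) y.
Proof.
move=> xT xm; elim=> [|j IH] y; first by [].
move=> hy; rewrite mulSn addnC.
suff H i c y' : (i <= m)%N -> killed T j y' ->
    killed (T + <[x]>) (j * m + i) (c *: iter (m - i) (b x) y + y').
  have := H m 1 0 (leqnn m) (killed0 T j).
  by rewrite subnn /= scale1r addr0.
elim: i c y' => [|i IHi] c y' im hy'.
  by rewrite subn0 xm scaler0 add0r addn0; apply: IH.
rewrite addnS => /= u /memv_addP[t tT [_ /vlineP[a ->] ->]].
set z := iter _ _ _.
have -> : b (t + a *: x) (c *: z + y') =
          (c * a) *: iter (m - i) (b x) y + (c *: b t z + b (t + a *: x) y').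
  rewrite (lfD (b _)) lfZ addrA; congr (_ + _).
  have -> : iter (m - i) (b x) y = b x z by rewrite -iterS -subSn // subSS.
  by rewrite !(lflin, lfE) scalerDr scalerA addrC.
apply: IHi; first exact: ltnW.
have xk k v i' : killed T k v -> killed T k (iter i' (b x) v).
  by move=> hv; elim: i' => [|i' IHi'] //=; apply: killed_normal.
apply: killedD; first by apply: killedZ; apply: (xk j.+1).
rewrite !(lflin, lfE) /= addrC.
apply: killedP; first exact: killed_normal.
by move: (killedS hy'); apply.
Qed.

(** Jacobson's form of Engel's theorem: a maximal subalgebra acting
    nilpotently is normalised by an element outside of it, which can then be
    adjoined, so the whole subalgebra acts nilpotently. *)
Lemma engel d m : subalgebra d -> (forall x, x \in d -> forall y, iter m (b x) y = 0) ->
  exists N, forall y, killed d N y.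
Proof.
move=> dS dm.
suff H k T : (\dim d - \dim T <= k)%N -> (T <= d)%VS -> subalgebra T ->
    (exists N, forall y, killed T N y) -> exists N, forall y, killed d N y.
  apply: (H (\dim d) 0%VS); rewrite ?leq_subr ?sub0v //.
    by move=> x y; rewrite !memv0 => /eqP -> /eqP ->; rewrite lf0.
  by exists 1%N => y t /=; rewrite memv0 => /eqP ->; rewrite !(lflin, lfE).
elim: k T => [|k IH] T dk Td TS [N TN].
  have /eqP <- : T == d by rewrite eqEdim Td -subn_eq0 -leqn0.
  by exists N.
have [dT|/subvPn[x0 x0d x0T]] := boolP (d <= T)%VS.
  have <- : T = d by apply/eqP; rewrite eqEsubv Td.
  by exists N.
have [x [xd xT xn]] : exists x, [/\ x \in d, x \notin T &
    forall t, t \in T -> b t x \in T].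
  apply: contrapT => nox.
  suff: forall j x, x \in d -> x \notin T -> ~ killed T j x by move/(_ N x0 x0d x0T).
  elim=> [|j IHj] x xd xT /= hx; first by rewrite hx mem0v in xT.
  apply: nox; exists x; split => // t tT; apply/negPn/negP => btx.
  apply: (IHj _ _ btx (hx t tT)); apply: dS => //; exact: (subvP Td).
have xTd : (T + <[x]> <= d)%VS by rewrite subv_add Td -memvE.
have Tx : (T <= T + <[x]>)%VS by exact: addvSl.
apply: (IH (T + <[x]>)%VS) => //.
- have lt : (\dim T < \dim (T + <[x]>))%N.
    rewrite ltnNge; apply/negP => le; case/negP: xT.
    have /eqP -> : T == (T + <[x]>)%VS by rewrite eqEdim Tx.
    by rewrite (subvP (addvSr _ _)) ?memv_line.
  have := dimvS xTd; move: dk lt; lia.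
- move=> y z /memv_addP[t tT [_ /vlineP[a ->] ->]] /memv_addP[s sT [_ /vlineP[c ->] ->]].
  apply: (subvP Tx); rewrite !(lflin, lfE) (bxx bL) !scaler0 addr0.
  have xs : b x s \in T by rewrite (bC bL) memvN xn.
  by rewrite !memvD ?memvZ ?xn // TS.
- by exists (N * m)%N => y; apply: killed_adjoin => // z; apply: dm.
Qed.

(** The k-th derived space sits inside the k-fold brackets with d. *)
Lemma nilpotent_solvable d N : subalgebra d -> (forall y, killed d N y) ->
  lie_solvable (fun x y => b x y) d.
Proof.
move=> dS dN; exists N.
suff H k : (k <= N)%N -> forall y,
    y \in iter k (derived_space (fun x y => b x y)) d ->
    y \in d /\ killed d (N - k) y.
  apply/eqP; rewrite -subv0; apply/subvP => y /(H N (leqnn N))[_].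
  by rewrite subnn /= => ->; exact: mem0v.
elim: k => [|k IH] kN y; first by rewrite subn0.
apply: (span_ind (P := fun y => y \in d /\ killed d (N - k.+1) y)).
- by split; [exact: mem0v|exact: killed0].
- by move=> c u v [ud uk] [vd vk]; split; [rewrite memvD ?memvZ|apply: killedP].
- move=> _ /allpairsP[[u v] [/= /vbasis_mem uk /vbasis_mem vk ->]].
  have [ud _] := IH (ltnW kN) _ uk; have [vd] := IH (ltnW kN) _ vk.
  have -> : (N - k = (N - k.+1).+1)%N by lia.
  by move=> hv; split; [exact: dS|exact: hv].
Qed.

End Engel.

(** * The conjugate part of a complex matrix *)

Section Interpolation.
Variable F : fieldType.
Implicit Types (s : seq F) (p q : {poly F}) (c : F -> F).

Lemma coprimep_prod_exp s N a : a \notin s -> forall k,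
  coprimep (('X - a%:P) ^+ k) (\prod_(z <- s) ('X - z%:P) ^+ N).
Proof.
elim: s => [|z s IH]; first by move=> _ k; rewrite big_nil coprimep1.
rewrite inE negb_or => /andP[az /IH{}IH] k; rewrite big_cons coprimepMr IH andbT.
by apply/coprimep_expl/coprimep_expr; rewrite coprimep_XsubC root_XsubC eq_sym.
Qed.

Lemma dvdp_prod_exp s N p : uniq s ->
  (forall z, z \in s -> ('X - z%:P) ^+ N %| p) ->
  \prod_(z <- s) ('X - z%:P) ^+ N %| p.
Proof.
elim: s => [|z s IH] /=; first by rewrite big_nil dvd1p.
move=> /andP[zs us] H; rewrite big_cons Gauss_dvdp ?coprimep_prod_exp //.
by rewrite H ?mem_head // IH // => y ys; rewrite H // inE ys orbT.
Qed.

(** Chinese remainder theorem for the powers ('X - z)^N. *)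
Lemma hermite_interpolation s N c : uniq s ->
  exists p, forall z, z \in s -> ('X - z%:P) ^+ N %| p - (c z)%:P.
Proof.
elim: s => [|a s IH] /=; first by exists 0.
move=> /andP[as_ /IH[p ps]].
pose q := \prod_(z <- s) ('X - z%:P) ^+ N.
have /Bezout_eq1_coprimepP[[u v] /= uv] := coprimep_prod_exp N as_ N.
exists (p + ((c a)%:P - p) * v * q) => z; rewrite inE => /predU1P[->|zs].
  have -> : p + ((c a)%:P - p) * v * q - (c a)%:P =
            (p - (c a)%:P) * u * ('X - a%:P) ^+ N.
    have E : v * q = 1 - u * ('X - a%:P) ^+ N by rewrite -uv addrC addKr.
    by rewrite -mulrA E; ring.
  exact: dvdp_mull.
rewrite addrAC; apply: dvdp_add; first exact: ps.
apply: dvdp_mull; rewrite /q (big_rem z) //=; exact: dvdp_mulr.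
Qed.

End Interpolation.

Section ConjugatePart.
Variables (C : numClosedFieldType) (n : nat) (M : 'M[C]_n.+1).

Lemma trig_mul_diag m (A B : 'M[C]_m) : is_trig_mx A -> is_trig_mx B ->
  is_trig_mx (A *m B) /\ forall i, (A *m B) i i = A i i * B i i.
Proof.
move=> /is_trig_mxP tA /is_trig_mxP tB; split.
  apply/is_trig_mxP => i j ij; rewrite mxE big1 // => k _.
  have [ik|ki] := ltnP i k; first by rewrite tA // mul0r.
  by rewrite tB ?mulr0 //; apply: leq_ltn_trans ij.
move=> i; rewrite mxE (bigD1 i) //= big1 ?addr0 // => k ki.
have [ik|ik] := ltnP i k; first by rewrite tA // mul0r.
by rewrite tB ?mulr0 // ltn_neqAle ik andbT.
Qed.

Lemma trig_horner_diag (A : 'M[C]_n.+1) p : is_trig_mx A ->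
  is_trig_mx (horner_mx A p) /\ forall i, horner_mx A p i i = p.[A i i].
Proof.
move=> tA; elim/poly_ind: p => [|p c [tp dp]].
  by rewrite rmorph0; split=> [|i]; rewrite ?mx0_is_trig // mxE horner0.
rewrite rmorphD rmorphM /= horner_mx_X horner_mx_C.
have [tm dm] := trig_mul_diag tp tA.
split=> [|i].
  apply/is_trig_mxP => i j ij; rewrite mxE (is_trig_mxP tm) // add0r mxE.
  by rewrite -val_eqE ltn_eqF.
by rewrite mxE dm dp mxE eqxx hornerMXaddC.
Qed.

(** The matrix D multiplies the generalised eigenspace of M for z by the
    conjugate of z; being a polynomial in M it is triangular together with M,
    so the trace of D M is the sum of the squared moduli of the eigenvalues. *)
Lemma conjugate_part : exists D : 'M[C]_n.+1,
  [/\ forall z k (u : 'rV_n.+1), u *m (M - z%:M) ^+ k = 0 -> u *m D = z^* *: u,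
      forall Q : 'rV[C]_n.+1 -> Prop, Q 0 -> (forall u v, Q u -> Q v -> Q (u + v)) ->
        (forall z k u, u *m (M - z%:M) ^+ k = 0 -> Q u) -> forall u, Q u
    & \tr (D *m M) = 0 -> M ^+ n.+1 = 0].
Proof.
have [P /unitarymx_unit Pu /[dup] tT] := Schur M (ltn0Sn n).
rewrite /similar_to /= conjumx // => {}tT; set T := _ *m _ in tT.
have ME : M = invmx P *m T *m P.
  by rewrite /T !mulmxA mulVmx // mul1mx -mulmxA mulVmx // mulmx1.
clearbody T.
have hM p : horner_mx M p = invmx P *m horner_mx T p *m P.
  by rewrite {1}ME horner_mx_uconjC.
pose s := undup [seq T i i | i <- enum 'I_n.+1].
have Ts i : T i i \in s by rewrite mem_undup; apply/mapP; exists i; rewrite ?mem_enum.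
pose N := n.+1; pose q := \prod_(z <- s) ('X - z%:P) ^+ N.
have qM : horner_mx M q = 0.
  rewrite hM; suff /dvdpP[r ->] : char_poly T %| q.
    by rewrite rmorphM /= Cayley_Hamilton mulr0 mulmx0 mul0mx.
  have dvd (r : seq 'I_n.+1) : (size r <= N)%N ->
     \prod_(i <- r) ('X - (T i i)%:P) %| \prod_(z <- s) ('X - z%:P) ^+ (size r).
    move=> _; elim: r => [|i r IH]; first by rewrite big_nil dvd1p.
    rewrite big_cons (eq_bigr (fun z => ('X - z%:P) * ('X - z%:P) ^+ size r)) => [|z _].
      rewrite big_split; apply: dvdp_mul => //=.
      rewrite (big_rem _ (Ts i)); exact: dvdp_mulr.
    by rewrite /= exprS.
  have := dvd (enum 'I_n.+1); rewrite size_enum_ord leqnn big_enum /= => /(_ isT).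
  by rewrite char_poly_trig.
have us : uniq s by exact: undup_uniq.
have kill p r (u : 'rV_N) : p %| r -> u *m horner_mx M p = 0 ->
    u *m horner_mx M r = 0.
  by move=> /dvdpP[t ->]; rewrite mulrC rmorphM /= mulmxA => ->; rewrite mul0mx.
have hX z k : horner_mx M (('X - z%:P) ^+ k) = (M - z%:M) ^+ k.
  by rewrite rmorphXn rmorphB /= horner_mx_X horner_mx_C.
have [p ps] := hermite_interpolation N (fun z => z^*) us.
exists (horner_mx M p); split.
- move=> z k u; rewrite -hX => uz.
  have uq : u *m horner_mx M q = 0 by rewrite qM mulmx0.
  suff : u *m horner_mx M (p - (z^*)%:P) = 0.
    rewrite rmorphB /= horner_mx_C mulmxBr mul_mx_scalar => /eqP.
    by rewrite subr_eq0 => /eqP.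
  have kill2 r1 r2 r : u *m horner_mx M r1 = 0 -> u *m horner_mx M r2 = 0 ->
     coprimep r1 r2 -> u *m horner_mx M r = 0.
    move=> k1 k2 /Bezout_eq1_coprimepP[[a b] /= ab].
    have -> : r = r * (a * r1 + b * r2) by rewrite ab mulr1.
    rewrite mulrDr rmorphD mulmxDr.
    have -> : u *m horner_mx M (r * (a * r1)) = 0.
      by apply: kill k1; rewrite mulrA; exact: dvdp_mull.
    have -> : u *m horner_mx M (r * (b * r2)) = 0.
      by apply: kill k2; rewrite mulrA; exact: dvdp_mull.
    by rewrite addr0.
  have [zs|zs] := boolP (z \in s); last first.
    by apply: (kill2 _ _ _ uz uq); exact: coprimep_prod_exp.
  apply: (kill _ _ _ (ps z zs)).
  pose q' := \prod_(y <- rem z s) ('X - y%:P) ^+ N.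
  have zs' : z \notin rem z s by rewrite mem_rem_uniqF.
  have /Bezout_eq1_coprimepP[[a b] /= ab] := coprimep_prod_exp N zs' k.
  have -> : ('X - z%:P) ^+ N = a * ('X - z%:P) ^+ N * ('X - z%:P) ^+ k + b * q.
    transitivity (('X - z%:P) ^+ N * (a * ('X - z%:P) ^+ k + b * q')).
      by rewrite ab mulr1.
    by rewrite /q (big_rem _ zs) /= -/q'; ring.
  rewrite rmorphD mulmxDr.
  have -> : u *m horner_mx M (a * ('X - z%:P) ^+ N * ('X - z%:P) ^+ k) = 0.
    by apply: kill uz; exact: dvdp_mull.
  have -> : u *m horner_mx M (b * q) = 0 by apply: kill uq; exact: dvdp_mull.
  by rewrite addr0.
- move=> Q Q0 QD QM u.
  have /choice[f fs] : forall z, exists f, forall y, y \in s ->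
      ('X - y%:P) ^+ N %| f - ((y == z)%:R)%:P.
    by move=> z; exact: (hermite_interpolation N (fun y => (y == z)%:R) us).
  have f1 : horner_mx M (\sum_(z <- s) f z) = 1.
    have : q %| \sum_(z <- s) f z - 1.
      apply: dvdp_prod_exp => // y ys.
      have -> : \sum_(z <- s) f z - 1 = \sum_(z <- s) (f z - ((y == z)%:R)%:P).
        rewrite big_split sumrN; congr (_ - _).
        rewrite (big_rem _ ys) /= eqxx big_seq big1 ?addr0 // => z.
        by case: eqP => // <-; rewrite mem_rem_uniqF.
      by elim/big_ind: _ => [|a b|z _]; [exact: dvdp0|exact: dvdp_add|exact: fs].
    move=> /dvdpP[r rE]; apply/eqP; rewrite -subr_eq0 -(rmorph1 (horner_mx M)).
    by rewrite -rmorphB /= rE rmorphM /= qM mulr0.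
  rewrite -[u]mulmx1 -[1%:M]f1 rmorph_sum mulmx_sumr big_seq.
  elim/big_ind: _ => // z zs; apply: (QM z N).
  rewrite -mulmxA -hX -[_ *m horner_mx _ _]rmorphM /=.
  suff /dvdpP[r ->] : q %| f z * ('X - z%:P) ^+ N by rewrite rmorphM /= qM mulr0 mulmx0.
  apply: dvdp_prod_exp => // y ys.
  have [->|yz] := eqVneq y z; first exact: dvdp_mull.
  by apply: dvdp_mulr; have := fs z y ys; rewrite (negPf yz) subr0.
- have [tp dp] := trig_horner_diag p tT.
  have [_ dm] := trig_mul_diag tp tT.
  have -> : \tr (horner_mx M p *m M) = \sum_i `|T i i| ^+ 2.
    rewrite hM {1}ME !mulmxA (mulmxK Pu) mxtrace_mulC !mulmxA.
    rewrite mulmxV // mul1mx.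
    apply: eq_bigr => i _; rewrite dm dp normCKC; congr (_ * _).
    have /dvdpP[r /(congr1 (fun p => p.[T i i]))] := ps _ (Ts i).
    rewrite hornerM horner_exp !hornerE subrr expr0n mulr0 => /eqP.
    by rewrite subr_eq0 => /eqP.
  move=> /eqP; rewrite psumr_eq0 => [/allP T0|i _]; last by rewrite exprn_ge0.
  have Ti i : T i i = 0.
    by have := T0 i (mem_index_enum i); rewrite /= sqrf_eq0 normr_eq0 => /eqP.
  have := Cayley_Hamilton T; rewrite char_poly_trig //.
  rewrite (eq_bigr (fun _ => 'X)) => [|i _]; last by rewrite Ti subr0.
  rewrite prodr_const card_ord => X0.
  by have := hM 'X^(n.+1); rewrite X0 mulmx0 mul0mx rmorphXn /= horner_mx_X.
Qed.

End ConjugatePart.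

Lemma iter_mulmxr (F : fieldType) n (A : 'M[F]_n.+1) k (u : 'rV_n.+1) :
  iter k (fun v => v *m A) u = u *m A ^+ k.
Proof.
elim: k => [|k IH]; first by rewrite expr0 mulmx1.
by rewrite iterS IH exprSr mulmxA.
Qed.

(** [conjugate_part] in terms of iterated maps, which also covers dimension 0. *)
Lemma conjugate_part_iter (C : numClosedFieldType) n (M : 'M[C]_n) :
  exists D : 'M[C]_n,
  [/\ forall z k (u : 'rV_n), iter k (fun v => v *m (M - z%:M)) u = 0 ->
        u *m D = z^* *: u,
      forall Q : 'rV[C]_n -> Prop, Q 0 -> (forall u v, Q u -> Q v -> Q (u + v)) ->
        (forall z k u, iter k (fun v => v *m (M - z%:M)) u = 0 -> Q u) ->
        forall u, Q u
    & \tr (D *m M) = 0 -> forall u : 'rV_n, iter n (fun v => v *m M) u = 0].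
Proof.
case: n M => [|n] M.
  have z0 (u : 'rV[C]_0) : u = 0 by apply/rowP => -[].
  exists 0; split=> [z k u _|Q Q0 _ _ u|_ u]; last exact: z0.
    by rewrite [LHS]z0 [RHS]z0.
  by rewrite [u]z0.
have [D [DE Dgen Dtr]] := conjugate_part M; exists D; split.
- by move=> z k u; rewrite iter_mulmxr; exact: DE.
- move=> Q Q0 QD QM; apply: Dgen => // z k u uz; apply: (QM z k).
  by rewrite iter_mulmxr.
- by move=> /Dtr M0 u; rewrite iter_mulmxr M0 mulmx0.
Qed.

(** * Cartan's criterion *)

Section CartanCriterion.
Import passmx.
Variables (R : realType) (L : vectType R) (b : 'Hom(L, 'End(L))).
Hypothesis bL : lie_lfun b.
Local Notation C := R[i]%C.
Local Notation m := (\dim {:L}).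
Local Notation e := (vbasis {:L}).
Local Notation rc := (real_complex R).

Let eP : basis_of {:L} e := vbasisP {:L}.
Let mx (f : 'End(L)) : 'M[R]_m := mxof e e f.
Let cplx (x : L) : 'rV[C]_m := map_mx rc (rVof e x).

(** The adjoint representation of the complexification of L, in coordinates:
    matrices act on row vectors from the right. *)
Definition cad (y : 'rV[C]_m) : 'M[C]_m := \sum_i y 0 i *: map_mx rc (mx (b e`_i)).

Lemma cad_is_linear : linear cad.
Proof.
move=> a y z; rewrite /cad scaler_sumr -big_split; apply: eq_bigr => i _ /=.
by rewrite !mxE scalerDl scalerA.
Qed.
HB.instance Definition _ := GRing.isLinear.Build C _ _ _ cad cad_is_linear.

Let cadP c y z : cad (c *: y + z) = c *: cad y + cad z := linearP cad c y z.

Lemma cad_cplx x : cad (cplx x) = map_mx rc (mx (b x)).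
Proof.
rewrite [in RHS](coord_vbasis (memvf x)) lf_sum /mx linear_sum map_mx_sum.
by apply: eq_bigr => i _; rewrite lfZ linearZ /= map_mxZ !mxE.
Qed.

Lemma cplx_mul x (f : 'End(L)) : cplx x *m map_mx rc (mx f) = cplx (f x).
Proof. by rewrite -map_mxM /cplx (rVof_app e eP). Qed.

(** Real vectors span the complexification over C, so that additive statements
    need only be checked on them. *)
Lemma cplx_ind (P : 'rV[C]_m -> Prop) : P 0 ->
  (forall c y z, P y -> P z -> P (c *: y + z)) -> (forall x, P (cplx x)) ->
  forall y, P y.
Proof.
move=> P0 PD Px y; rewrite [y]row_sum_delta.
elim/big_ind: _ => // [u v Pu Pv|i _].
  by have := PD 1 u v Pu Pv; rewrite scale1r.
rewrite -[X in P X]addr0; apply: PD => //.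
suff -> : delta_mx 0 i = cplx e`_i by [].
by rewrite /cplx (rVofE eP) map_delta_mx.
Qed.

(* Row convention: the bracket [y, z] is the row [z *m cad y]. *)
Lemma cad_bracket y z : cad (z *m cad y) = cad z *m cad y - cad y *m cad z.
Proof.
elim/cplx_ind: y z => [z|c y y' IH IH' z|x z].
- by rewrite linear0 !(mulmx0, mul0mx) linear0 subrr.
- rewrite !cadP mulmxDr -scalemxAr cadP IH IH' mulmxDl mulmxDr -scalemxAl.
  by rewrite -scalemxAr scalerBr opprD addrACA.
elim/cplx_ind: z => [|c z z' IH IH'|z].
- by rewrite !(mul0mx, linear0, mulmx0, subrr).
- rewrite mulmxDl -scalemxAl !cadP IH IH' mulmxDl mulmxDr -scalemxAl.
  by rewrite -scalemxAr scalerBr opprD addrACA.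
rewrite !cad_cplx cplx_mul cad_cplx -!map_mxM -map_mxB b_comm //.
by rewrite /mx linearB /= !(mxof_comp _ _ eP).
Qed.

Definition radical_elt z := forall y, kil b y z = 0.

Lemma tr_cad_radical z w : radical_elt z -> \tr (cad w *m cad (cplx z)) = 0.
Proof.
move=> hz; elim/cplx_ind: w => [|c w w' IH IH'|w].
- by rewrite linear0 mul0mx mxtrace0.
- by rewrite linearP /= mulmxDl -scalemxAl linearP /= IH IH' mulr0 addr0.
rewrite !cad_cplx -map_mxM trace_map_mx -(mxof_comp _ _ eP) -ltr_mxof.
by have := hz w; rewrite /kil ltrC => ->; rewrite rmorph0.
Qed.

Lemma cad_derivation (w u v : 'rV[C]_m) :
  (v *m cad u) *m cad w = v *m cad (u *m cad w) + (v *m cad w) *m cad u.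
Proof. by rewrite cad_bracket mulmxBr !mulmxA subrK. Qed.

(** Leibniz rule: ad w - x - y sends [u, v] to the sum of [(ad w - x) u, v] and
    [u, (ad w - y) v], so iterating it exhausts one of the two nilpotencies. *)
Lemma cad_generalized_eigen w x y N k l (u v : 'rV[C]_m) : (k + l <= N)%N ->
  iter k (fun v : 'rV_m => v *m (cad w - x%:M)) u = 0 ->
  iter l (fun v : 'rV_m => v *m (cad w - y%:M)) v = 0 ->
  iter N (fun v : 'rV_m => v *m (cad w - (x + y)%:M)) (v *m cad u) = 0.
Proof.
have iter0 K (A : 'M[C]_m) : iter K (fun v : 'rV_m => v *m A) (0 : 'rV_m) = 0.
  by elim: K => // K IH; rewrite iterS IH mul0mx.
have iterD K (A : 'M[C]_m) (u1 u2 : 'rV_m) :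
   iter K (fun v : 'rV_m => v *m A) (u1 + u2) =
   iter K (fun v : 'rV_m => v *m A) u1 + iter K (fun v : 'rV_m => v *m A) u2.
  by elim: K => // K IH; rewrite !iterS IH mulmxDl.
elim: N k l u v => [|N IH] k l u v kl uk vl.
  have k0 : k = 0%N by lia.
  by rewrite k0 /= in uk; rewrite uk linear0 mulmx0.
case: k => [|k] in kl uk *; first by rewrite /= in uk; rewrite uk linear0 mulmx0 iter0.
case: l => [|l] in kl vl *; first by rewrite /= in vl; rewrite vl mul0mx iter0.
rewrite iterSr.
have -> : v *m cad u *m (cad w - (x + y)%:M) =
    v *m cad (u *m (cad w - x%:M)) + (v *m (cad w - y%:M)) *m cad u.
  have -> : cad (u *m (cad w - x%:M)) = cad (u *m cad w) - x *: cad u.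
    by rewrite mulmxBr mul_mx_scalar linearB linearZ.
  have -> : v *m (cad w - y%:M) = v *m cad w - y *: v.
    by rewrite mulmxBr mul_mx_scalar.
  rewrite !mulmxBr mulmxBl mul_mx_scalar cad_derivation.
  by rewrite -scalemxAr -scalemxAl scalerDl opprD addrACA.
by rewrite iterD (IH k l.+1) ?(IH k.+1 l) ?addr0 -?iterSr //; lia.
Qed.

(** The key step of Cartan's criterion: the conjugate of the semisimple part of
    ad x is a derivation D, and pairing D with x, a sum of brackets of elements
    of the radical of the Killing form, gives a vanishing sum of squares. *)
Lemma radical_bracket_nilpotent (s : {vspace L}) x :
  (forall z, z \in s -> radical_elt z) ->
  x \in derived_space (fun x y => b x y) s ->
  forall y, iter m (b x) y = 0.
Proof.
move=> sR xs y.
have [D [DE Dgen Dtr]] := conjugate_part_iter (cad (cplx x)).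
have Dder (u v : 'rV_m) : (v *m cad u) *m D = v *m cad (u *m D) + (v *m D) *m cad u.
  elim/Dgen: u v => [v|u u' IH IH' v|a k u uk v].
  - by rewrite !(mul0mx, linear0, mulmx0, addr0).
  - rewrite (mulmxDl u) !(linearD cad) !mulmxDr mulmxDl IH IH'.
    by rewrite addrACA.
  elim/Dgen: v => [|v v' IH IH'|c l v vl].
  - by rewrite !(mul0mx, linear0, mulmx0, addr0).
  - by rewrite !mulmxDl IH IH' addrACA.
  rewrite (DE _ _ _ (cad_generalized_eigen (leqnn _) uk vl)).
  rewrite (DE _ _ _ uk) (DE _ _ _ vl) linearZ /= -scalemxAr -scalemxAl.
  by rewrite rmorphD scalerDl.
have trD z : z \in derived_space (fun x y => b x y) s ->
    \tr (D *m cad (cplx z)) = 0.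
  apply: (span_ind (P := fun z => \tr (D *m cad (cplx z)) = 0)).
  - by rewrite /cplx linear0 map_mx0 linear0 mulmx0 mxtrace0.
  - move=> c u v u0 v0; rewrite /cplx linearP /= map_mxD map_mxZ linearP /=.
    by rewrite mulmxDr -scalemxAr mxtraceD mxtraceZ u0 v0 mulr0 addr0.
  move=> _ /allpairsP[[u v] [/= us vs ->]].
  have -> : cplx (b u v) = cplx v *m cad (cplx u) by rewrite cad_cplx cplx_mul.
  rewrite cad_bracket mulmxBr linearB /= mulmxA.
  rewrite (mxtrace_mulC (D *m _)) !mulmxA -linearB -mulmxBl.
  have -> : cad (cplx u) *m D - D *m cad (cplx u) = cad (cplx u *m D).
    apply/row_matrixP => i; rewrite !rowE mulmxBr !mulmxA Dder.
    by rewrite addrK.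
  by apply: tr_cad_radical; apply: sR; apply: vbasis_mem.
apply: (can_inj (rVofK eP)); rewrite linear0.
suff H k (v : L) : cplx (iter k (b x) v) = iter k (fun u => u *m cad (cplx x)) (cplx v).
  have := H m y; rewrite Dtr ?trD // => /rowP c0; apply/rowP => i.
  by have := c0 i; rewrite !mxE => /eqP; rewrite fmorph_eq0 => /eqP.
by elim: k => // k IH; rewrite !iterS -IH cad_cplx cplx_mul.
Qed.

(** The radical s of the Killing form is an ideal, and so is its derived space d.
    By [radical_bracket_nilpotent] and [engel], d is solvable, hence zero; then s
    is abelian, hence zero. *)
Lemma cartan_criterion : semisimple_lie (fun x y => b x y) -> nondeg b.
Proof.
move=> [_ ss] z0 hz0.
have [F FE] : exists F : 'Hom(L, 'rV[R]_m), forall x, F x = \row_i kil b e`_i x.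
  apply: lfun_of_linear => c u v; apply/rowP => i.
  by rewrite !mxE /kil !lflin comp_lfunDr linearD -comp_lfunZr linearZ.
pose s := lker F.
have sP z : z \in s <-> radical_elt z.
  rewrite memv_ker FE; split=> [/eqP /rowP Fz y|rz]; last first.
    by apply/eqP/rowP => i; rewrite !mxE.
  rewrite (coord_vbasis (memvf y)) /kil lf_sum.
  elim/big_ind: _ => [|f h f0 h0|i _]; first by rewrite comp_lfun0l linear0.
    by rewrite comp_lfunDl linearD /= f0 h0 addr0.
  rewrite lflin -comp_lfunZl linearZ /=; have := Fz i; rewrite !mxE /kil => ->.
  by rewrite mulr0.
have sI x y : y \in s -> b x y \in s.
  move=> /sP sy; apply/sP => z; rewrite -kil_inv //; exact: sy.
pose d := derived_space (fun x y => b x y) s.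
have dI x y : y \in d -> b x y \in d.
  apply: (span_ind (P := fun y => b x y \in d)).
  - by rewrite lf0 mem0v.
  - by move=> c u v hu hv; rewrite !lflin memvD ?memvZ.
  move=> _ /allpairsP[[u v] [/= /vbasis_mem us /vbasis_mem vs ->]].
  have bd u' v' : u' \in s -> v' \in s -> b u' v' \in d.
    move=> u's v's; rewrite (coord_vbasis u's) (coord_vbasis v's).
    rewrite lf_sum; apply: memv_suml => j _.
    rewrite lfZ lf_sum sum_lfunE memvZ //; apply: memv_suml => i _.
    rewrite lfZ lfE memvZ // memv_span //; apply/allpairsP.
    exists ((vbasis s)`_i, (vbasis s)`_j).
    by split; rewrite //= mem_nth // size_tuple.
  have -> : b x (b u v) = b (b x u) v + b u (b x v) by rewrite bJ // subrK.
  by rewrite memvD // bd // sI.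
have d0 : d = 0%VS.
  apply: ss; first by move=> x y /dI.
  have dS : subalgebra b d by move=> x y _; exact: dI.
  have [N dN] := engel bL dS (fun x xd => radical_bracket_nilpotent (fun z => proj1 (sP z)) xd).
  exact: nilpotent_solvable dN.
have s0 : s = 0%VS by apply: ss; [exact: sI|exists 1%N].
by have /sP : radical_elt z0 by [move=> y; rewrite kilC]; rewrite s0 memv0 => /eqP.
Qed.

End CartanCriterion.

(** * Coordinate norms and strict differentials *)

Lemma coord_eq (R : realType) (V : vectType R) (x y : V) :
  (forall i, coord (vbasis {:V}) i x = coord (vbasis {:V}) i y) -> x = y.
Proof.
move=> xy; rewrite (coord_vbasis (memvf x)) (coord_vbasis (memvf y)).
by apply: eq_bigr => i _; rewrite xy.
Qed.

Section CoordLinear.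
Variables (R : realType) (V : vectType R) (i : 'I_(\dim {:V})).
Local Notation c := (coord (vbasis {:V}) i).
Lemma coordD (x y : V) : c (x + y) = c x + c y. Proof. exact: linearD. Qed.
Lemma coordN (x : V) : c (- x) = - c x. Proof. exact: linearN. Qed.
Lemma coordZ a (x : V) : c (a *: x) = a * c x. Proof. exact: linearZ. Qed.
Lemma coord00 : c 0 = 0. Proof. exact: linear0. Qed.
Definition coord_lin := (coordD, coordN, coordZ, coord00).
End CoordLinear.

(** Abstract vector spaces have no ring structure to reflect; their linear
    identities are ring identities in each coordinate. *)
Ltac vring := apply: coord_eq => ?; rewrite !coord_lin; ring.

Lemma linear_sub (R : realType) (V W : vectType R) (F : V -> W) x y :
  linear F -> F (x - y) = F x - F y.
Proof. by move=> /lfun_of_linear[G GE]; rewrite -!GE lfD lfN. Qed.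

Section CoordinateNorm.
Variables (R : realType) (V : vectType R).
Implicit Types x y : V.

(** The l1-norm in the chosen basis: an abstract finite-dimensional space carries no
    norm, and any choice gives the same topology. *)
Definition vn x : R := \sum_i `|coord (vbasis {:V}) i x|.

Lemma vn_ge0 x : 0 <= vn x. Proof. exact: sumr_ge0. Qed.

Lemma vn0 : vn 0 = 0.
Proof. by rewrite /vn big1 // => i _; rewrite linear0 normr0. Qed.

Lemma vnD x y : vn (x + y) <= vn x + vn y.
Proof.
by rewrite -big_split; apply: ler_sum => i _; rewrite linearD ler_normD.
Qed.

Lemma vnZ c x : vn (c *: x) = `|c| * vn x.
Proof. by rewrite mulr_sumr; apply: eq_bigr => i _; rewrite linearZ normrM. Qed.

Lemma vnN x : vn (- x) = vn x.
Proof. by rewrite -scaleN1r vnZ normrN1 mul1r. Qed.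

Lemma vnB x y : vn (x - y) <= vn x + vn y.
Proof. by rewrite -(vnN y) vnD. Qed.

Lemma vnBC x y : vn (x - y) = vn (y - x).
Proof. by rewrite -vnN opprB. Qed.

Lemma vn_eq0 x : vn x = 0 -> x = 0.
Proof.
move=> /eqP; rewrite psumr_eq0 // => /allP x0.
rewrite (coord_vbasis (memvf x)) big1 // => i _.
by have /= := x0 i (mem_index_enum i); rewrite normr_eq0 => /eqP ->; rewrite scale0r.
Qed.

Lemma vn_sum I (r : seq I) (P : pred I) (F : I -> V) :
  vn (\sum_(i <- r | P i) F i) <= \sum_(i <- r | P i) vn (F i).
Proof.
elim/big_rec2: _ => [|i y1 y2 _ h]; first by rewrite vn0.
by apply: le_trans (vnD _ _) _; rewrite lerD2l.
Qed.

Lemma coord_vn i x : `|coord (vbasis {:V}) i x| <= vn x.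
Proof. by rewrite /vn (bigD1 i) //= lerDl sumr_ge0. Qed.

Lemma vn_vbasis (i : 'I_(\dim {:V})) : vn (vbasis {:V})`_i = 1.
Proof.
rewrite /vn (bigD1 i) //= big1 => [|j ji]; rewrite coord_free ?(basis_free (vbasisP _)) //.
  by rewrite eqxx normr1 addr0.
by rewrite eq_sym (negPf ji) normr0.
Qed.

(** Coordinates range over a product of segments, which is compact. *)
Lemma bounded_cluster (u : nat -> V) K : (forall k, vn (u k) <= K) ->
  exists l, forall eps, 0 < eps -> forall N, exists2 k, (N <= k)%N & vn (u k - l) <= eps.
Proof.
move=> uK; pose m := \dim {:V}; pose e := vbasis {:V}.
pose v k : 'rV[R]_m := \row_i coord e i (u k).
have cK : compact [set w : 'rV[R]_m | forall i, `[- K, K]%classic (w ord0 i)].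
  by apply: (@rV_compact _ _ (fun=> `[- K, K]%classic)) => _; exact: segment_compact.
have [|w [_ wcl]] := cK (nbhs (v @ \oo)%classic) _.
  exists 0%N => // k _ /= i; rewrite mxE in_itv /= -ler_norml.
  exact: le_trans (coord_vn _ _) (uK k).
exists (\sum_i w 0 i *: e`_i) => eps eps0 N.
pose d := eps / m.+1%:R.
have d0 : 0 < d by rewrite divr_gt0 ?ltr0Sn.
have [|_ [[k Nk <-] bk]] := wcl [set v k | k in [set k | (N <= k)%N]]%classic (ball w d) _ (nbhsx_ballx w d d0).
  by exists N => // k /= Nk; exists k.
exists k => //; rewrite {1}(coord_vbasis (memvf (u k))) -sumrB.
apply: le_trans (vn_sum _ _ _) _.
apply: (@le_trans _ _ (\sum_(i < m) d)); last first.
  rewrite sumr_const card_ord -mulr_natr /d mulrAC -mulrA ger_pMr //.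
  by rewrite ler_pdivrMr ?ltr0Sn // mul1r ler_nat.
apply: ler_sum => i _; rewrite -scalerBl vnZ vn_vbasis mulr1.
have [_ /(_ ord0 i)] := bk; rewrite /ball /= mxE => /ltW.
by rewrite distrC.
Qed.

End CoordinateNorm.

Lemma vn_basis_bound (R : realType) (V W : vectType R) (f : V -> W) x : linear f ->
  vn (f x) <= \sum_(i < \dim {:V}) `|coord (vbasis {:V}) i x| * vn (f (vbasis {:V})`_i).
Proof.
move=> fl; rewrite {1}(coord_vbasis (memvf x)) linear_combE //.
by apply: le_trans (vn_sum _ _ _) _; apply: ler_sum => i _; rewrite vnZ.
Qed.

Section Bounds.
Variables (R : realType) (V W X : vectType R).

Definition lbound (F : V -> W) : R := \sum_(i < \dim {:V}) vn (F (vbasis {:V})`_i).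

Lemma lbound_ge0 F : 0 <= lbound F.
Proof. by apply: sumr_ge0 => i _; exact: vn_ge0. Qed.

Lemma lboundP (F : V -> W) x : linear F -> vn (F x) <= lbound F * vn x.
Proof.
move=> Fl; apply: le_trans (vn_basis_bound x Fl) _.
rewrite mulrC mulr_suml; apply: ler_sum => i _; apply: ler_wpM2l => //.
by rewrite /lbound (bigD1 i) //= lerDl sumr_ge0 // => j _; exact: vn_ge0.
Qed.

Definition bbound (F : V -> W -> X) : R :=
  \sum_(i < \dim {:V}) \sum_(j < \dim {:W}) vn (F (vbasis {:V})`_i (vbasis {:W})`_j).

Lemma bbound_ge0 F : 0 <= bbound F.
Proof. by apply: sumr_ge0 => i _; apply: sumr_ge0 => j _; exact: vn_ge0. Qed.

Lemma bboundP (F : V -> W -> X) x y : bilinear_for *:%R *:%R F ->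
  vn (F x y) <= bbound F * vn x * vn y.
Proof.
move=> [Fl Fr]; apply: le_trans (vn_basis_bound x (Fl y)) _.
rewrite mulrAC mulrC mulr_suml; apply: ler_sum => i _; apply: ler_wpM2l => //.
apply: le_trans (vn_basis_bound y (Fr _)) _.
rewrite mulrC mulr_suml; apply: ler_sum => j _; apply: ler_wpM2l => //.
rewrite /bbound (bigD1 i) //= (bigD1 j) //= -addrA lerDl addr_ge0 //.
  by apply: sumr_ge0 => j' _; exact: vn_ge0.
by apply: sumr_ge0 => i' _; apply: sumr_ge0 => j' _; exact: vn_ge0.
Qed.

End Bounds.

Section StrictDifferential.
Variables (R : realType) (Z : vectType R).
Implicit Types z : Z.

(** Strict differentiability at z0: unlike plain differentiability it gives
    Lipschitz estimates in both arguments, as needed for a contraction. *)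
Definition sd (W : vectType R) z0 (f d : Z -> W) : Prop :=
  linear d /\ forall eps, 0 < eps -> exists2 r, 0 < r &
    forall z z', vn (z - z0) <= r -> vn (z' - z0) <= r ->
      vn (f z - f z' - d (z - z')) <= eps * vn (z - z').

Lemma sd_shrink (W : vectType R) z0 (f d : Z -> W) r1 eps : sd z0 f d -> 0 < r1 ->
  0 < eps -> exists r, [/\ 0 < r, r <= r1 &
    forall z z', vn (z - z0) <= r -> vn (z' - z0) <= r ->
      vn (f z - f z' - d (z - z')) <= eps * vn (z - z')].
Proof.
move=> [_ H] r10 /H[r r0 hr]; exists (Num.min r r1).
rewrite lt_min r0 r10 ge_min lexx orbT; split=> // z z'.
by rewrite !le_min => /andP[h1 _] /andP[h2 _]; apply: hr.
Qed.

Lemma sd_lipschitz (W : vectType R) z0 (f d : Z -> W) : sd z0 f d ->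
  exists r K, [/\ 0 < r, 0 <= K & forall z z', vn (z - z0) <= r -> vn (z' - z0) <= r ->
      vn (f z - f z') <= K * vn (z - z')].
Proof.
move=> [dl /(_ 1 ltr01)[r r0 hr]]; exists r, (1 + lbound d).
split=> // [|z z' hz hz']; first by rewrite addr_ge0 ?lbound_ge0.
rewrite -[f z - f z'](subrK (d (z - z'))).
apply: le_trans (vnD _ _) _; rewrite mulrDl; apply: lerD; first exact: hr.
exact: lboundP.
Qed.

Lemma sd_cts (W : vectType R) z0 (f d : Z -> W) : sd z0 f d ->
  forall eps, 0 < eps -> exists2 r, 0 < r &
    forall z, vn (z - z0) <= r -> vn (f z - f z0) <= eps.
Proof.
move=> /sd_lipschitz[r [K [r0 K0 H]]] eps eps0.
exists (Num.min r (eps / (K + 1))).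
  by rewrite lt_min r0 divr_gt0 // ltr_wpDl.
move=> z; rewrite le_min => /andP[h1 h2].
apply: le_trans (H z z0 h1 _) _; first by rewrite subrr vn0 ltW.
apply: (@le_trans _ _ ((K + 1) * vn (z - z0))).
  by rewrite ler_wpM2r ?vn_ge0 // lerDl.
by rewrite mulrC -ler_pdivlMr // ltr_wpDl.
Qed.

Lemma sd_const (W : vectType R) z0 (w : W) : sd z0 (fun=> w) (fun=> 0).
Proof.
split=> [c x y|eps eps0]; first by rewrite scaler0 addr0.
by exists 1 => // z z' _ _; rewrite !subrr vn0 mulr_ge0 ?vn_ge0 ?ltW.
Qed.

Lemma sd_lin (W : vectType R) z0 (F : Z -> W) : linear F -> sd z0 F F.
Proof.
move=> Fl; split=> // eps eps0; exists 1 => // z z' _ _.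
by rewrite (linear_sub _ _ Fl) subrr vn0 mulr_ge0 ?vn_ge0 ?ltW.
Qed.

Lemma sd_ext (W : vectType R) z0 (f f' d d' : Z -> W) : f =1 f' -> d =1 d' ->
  sd z0 f d -> sd z0 f' d'.
Proof. by move=> /funext -> /funext ->. Qed.

Lemma sdD (W : vectType R) z0 (f1 d1 f2 d2 : Z -> W) : sd z0 f1 d1 -> sd z0 f2 d2 ->
  sd z0 (fun z => f1 z + f2 z) (fun z => d1 z + d2 z).
Proof.
move=> [l1 h1] [l2 h2]; split=> [c x y|eps eps0].
  by rewrite l1 l2 scalerDr addrACA.
have e20 : 0 < eps / 2 by rewrite divr_gt0.
have [r1 r10 H1] := h1 _ e20; have [r2 r20 H2] := h2 _ e20.
exists (Num.min r1 r2); first by rewrite lt_min r10.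
move=> z z'; rewrite !le_min => /andP[a1 a2] /andP[b1 b2].
have -> : f1 z + f2 z - (f1 z' + f2 z') - (d1 (z - z') + d2 (z - z')) =
  (f1 z - f1 z' - d1 (z - z')) + (f2 z - f2 z' - d2 (z - z')).
  by vring.
apply: le_trans (vnD _ _) _; rewrite [eps]splitr mulrDl.
by apply: lerD; [apply: H1|apply: H2].
Qed.

(** Split the increment of B (f z) (g z) by moving one factor at a time: each piece
    is a first-order error times a bounded factor, or a product of two increments. *)
Lemma sd_bil (W1 W2 W3 : vectType R) z0 (B : W1 -> W2 -> W3) f d1 g d2 :
  bilinear_for *:%R *:%R B -> sd z0 f d1 -> sd z0 g d2 ->
  sd z0 (fun z => B (f z) (g z)) (fun h => B (d1 h) (g z0) + B (f z0) (d2 h)).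
Proof.
move=> Bb sf sg; have [Bl Br] := Bb; have [l1 _] := sf; have [l2 _] := sg.
split=> [c x y|eps eps0].
  rewrite l1 l2 Br; have /= -> := Bl (g z0) c (d1 x) (d1 y).
  by rewrite scalerDr addrACA.
have [b bE] := lfun2_of_bilinear Bb.
have [r1 [K1 [r10 K10 H1]]] := sd_lipschitz sf.
have [r2 [K2 [r20 K20 H2]]] := sd_lipschitz sg.
have [D1 [D10 D1P]] : exists D, 0 <= D /\ forall h, vn (d1 h) <= D * vn h.
  by exists (lbound d1); split=> [|h]; [exact: lbound_ge0|exact: lboundP].
have [D2 [D20 D2P]] : exists D, 0 <= D /\ forall h, vn (d2 h) <= D * vn h.
  by exists (lbound d2); split=> [|h]; [exact: lbound_ge0|exact: lboundP].
have [C [C0 CP]] : exists C, 0 <= C /\ forall x y, vn (B x y) <= C * vn x * vn y.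
  by exists (bbound B); split=> [|x y]; [exact: bbound_ge0|exact: bboundP].
pose F0 := vn (f z0); pose G0 := vn (g z0).
have F00 : 0 <= F0 by exact: vn_ge0.
have G00 : 0 <= G0 by exact: vn_ge0.
pose S := C * ((G0 + K2) + D1 * K2 + (F0 + K1) + K1 * D2).
have S0 : 0 <= S by rewrite mulr_ge0 // !addr_ge0 // mulr_ge0.
pose c := eps / (S + 1).
have c0 : 0 < c by rewrite divr_gt0 // ltr_wpDl.
have cS : c * S <= eps.
  rewrite /c mulrAC ler_pdivrMr ?ltr_wpDl //.
  by apply: ler_wpM2l; [exact: ltW|rewrite lerDl].
pose r0 := Num.min (Num.min r1 r2) (Num.min 1 c).
have r00 : 0 < r0 by rewrite !lt_min r10 r20 ltr01.
have [ra [ra0 ra1 Ha]] := sd_shrink sf r00 c0.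
have [rb [rb0 rb1 Hb]] := sd_shrink sg ra0 c0.
exists rb => // z z' hz hz'; set h := z - z'.
have [[br1 br2] [b1 bc]] : (rb <= r1 /\ rb <= r2) /\ (rb <= 1 /\ rb <= c).
  have : rb <= r0 by exact: le_trans ra1.
  by rewrite !le_min => /andP[/andP[-> ->] /andP[-> ->]].
have z0r r : 0 < r -> vn (z0 - z0) <= r by move=> ?; rewrite subrr vn0 ltW.
have -> : B (f z) (g z) - B (f z') (g z') - (B (d1 h) (g z0) + B (f z0) (d2 h)) =
   B (f z - f z' - d1 h) (g z) + B (d1 h) (g z - g z0) +
   (B (f z') (g z - g z' - d2 h) + B (f z' - f z0) (d2 h)).
  rewrite -!bE !(lflin, lfE).
  set a1 := b (f z) (g z); set a2 := b (f z') (g z); set a3 := b (d1 h) (g z).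
  set a4 := b (d1 h) (g z0); set a5 := b (f z') (g z').
  set a6 := b (f z') (d2 h); set a7 := b (f z0) (d2 h).
  by vring.
have hn := vn_ge0 h.
have E1 : vn (f z - f z' - d1 h) <= c * vn h.
  by apply: Ha; [exact: le_trans hz rb1|exact: le_trans hz' rb1].
have E2 : vn (g z - g z' - d2 h) <= c * vn h by apply: Hb.
have gz : vn (g z - g z0) <= K2 * rb.
  apply: le_trans (H2 _ _ (le_trans hz br2) (z0r _ r20)) _.
  exact: ler_wpM2l.
have fz : vn (f z' - f z0) <= K1 * rb.
  apply: le_trans (H1 _ _ (le_trans hz' br1) (z0r _ r10)) _.
  exact: ler_wpM2l.
have gzn : vn (g z) <= G0 + K2.
  rewrite -[g z](subrK (g z0)) addrC; apply: le_trans (vnD _ _) _.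
  by rewrite lerD2l; apply: le_trans gz _; rewrite ler_piMr.
have fzn : vn (f z') <= F0 + K1.
  rewrite -[f z'](subrK (f z0)) addrC; apply: le_trans (vnD _ _) _.
  by rewrite lerD2l; apply: le_trans fz _; rewrite ler_piMr.
have CB x y X Y : vn x <= X -> vn y <= Y -> vn (B x y) <= C * (X * Y).
  move=> xX yY; apply: le_trans (CP _ _) _; rewrite -mulrA ler_wpM2l //.
  by rewrite ler_pM ?vn_ge0.
have T1 := CB _ _ _ _ E1 gzn.
have T2 := CB _ _ _ _ (D1P h) gz.
have T3 := CB _ _ _ _ fzn E2.
have T4 := CB _ _ _ _ fz (D2P h).
apply: (@le_trans _ _ (c * S * vn h)); last by rewrite ler_wpM2r.
apply: le_trans (vnD _ _) _; apply: le_trans (lerD (vnD _ _) (vnD _ _)) _.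
apply: le_trans (lerD (lerD T1 T2) (lerD T3 T4)) _.
have T2' : C * (D1 * vn h * (K2 * rb)) <= C * (D1 * vn h * (K2 * c)).
  by rewrite !ler_wpM2l // mulr_ge0.
have T4' : C * (K1 * rb * (D2 * vn h)) <= C * (K1 * c * (D2 * vn h)).
  by rewrite ler_wpM2l // ler_wpM2r ?mulr_ge0 // ler_wpM2l.
apply: le_trans (lerD (lerD (lexx _) T2') (lerD (lexx _) T4')) _.
by rewrite le_eqVlt; apply/orP; left; apply/eqP; rewrite /S; ring.
Qed.

End StrictDifferential.

Lemma sd_precomp (R : realType) (Y Z W : vectType R) (G : Y -> Z) y0 (f d : Z -> W) :
  linear G -> sd (G y0) f d -> sd y0 (fun y => f (G y)) (fun y => d (G y)).
Proof.
move=> Gl [dl H]; split=> [c x y|eps eps0]; first by rewrite Gl dl.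
have GB x y : G (x - y) = G x - G y by exact: linear_sub.
pose K := lbound G + 1; have K0 : 0 < K by rewrite ltr_wpDl ?lbound_ge0.
have GK x : vn (G x) <= K * vn x.
  apply: le_trans (lboundP _ Gl) _.
  by apply: ler_wpM2r; [exact: vn_ge0|rewrite lerDl].
have [r r0 hr] := H (eps / K) (divr_gt0 eps0 K0).
exists (r / K) => [|z z' hz hz']; first exact: divr_gt0.
have in_r x : vn (x - y0) <= r / K -> vn (G x - G y0) <= r.
  by rewrite -GB ler_pdivlMr // mulrC => h; apply: le_trans (GK _) h.
rewrite GB; apply: le_trans (hr _ _ (in_r _ hz) (in_r _ hz')) _.
rewrite -mulrA; apply: ler_wpM2l; first exact: ltW.
rewrite -GB mulrC ler_pdivrMr // mulrC; exact: GK.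
Qed.

(** * Contractions, slices and quadratic equations *)

Section Contraction.
Variables (R : realType) (V : vectType R).

Lemma half_pow_small (r eps : R) : 0 < eps -> exists N, forall k, (N <= k)%N ->
  r / 2 ^+ k <= eps.
Proof.
move=> eps0; exists (Num.trunc (`|r| / eps)).+1 => k Nk.
rewrite ler_pdivrMr ?exprn_gt0 // mulrC -ler_pdivrMr //.
apply: le_trans (ler_norm _) _; rewrite normrM normfV (gtr0_norm eps0).
apply: (@le_trans _ _ k%:R); last first.
  by rewrite -natrX ler_nat ltnW // ltn_expl.
apply: (@le_trans _ _ (Num.trunc (`|r| / eps)).+1%:R); last by rewrite ler_nat.
by rewrite ltW // truncnS_gt.
Qed.

Lemma le0_of_small (x : R) : (forall eps, 0 < eps -> x <= eps) -> x <= 0.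
Proof. by move=> h; apply/ler_addgt0Pl => eps eps0; rewrite addr0; exact: h. Qed.

(** A cluster point of the iterates of 0 is a fixed point, since consecutive
    iterates get arbitrarily close. *)
Lemma contraction_fixpoint (T : V -> V) r : 0 < r ->
  (forall y z, vn y <= r -> vn z <= r -> vn (T y - T z) <= 2^-1 * vn (y - z)) ->
  vn (T 0) <= r / 2 -> exists2 y, vn y <= r & T y = y.
Proof.
move=> r0 Tc T0; pose u k := iter k T 0.
have v0 : vn (0 : V) <= r by rewrite vn0 ltW.
have Tr y : vn y <= r -> vn (T y) <= r.
  move=> yr; rewrite -[T y](subrK (T 0)); apply: le_trans (vnD _ _) _.
  rewrite [leRHS](splitr r); apply: lerD => //.
  apply: le_trans (Tc _ _ yr v0) _; rewrite subr0.
  by move: yr; lra.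
have ur k : vn (u k) <= r by elim: k => // k IH; rewrite /u iterS; exact: Tr.
have us k : vn (u k.+1 - u k) <= r / 2 ^+ k.
  elim: k => [|k IH]; first by rewrite expr0 divr1 /= subr0; exact: (ur 1%N).
  apply: le_trans (Tc _ _ (ur k.+1) (ur k)) _.
  have -> : r / 2 ^+ k.+1 = 2^-1 * (r / 2 ^+ k) by rewrite exprS invfM mulrCA.
  by move: IH; lra.
have [l ul] := bounded_cluster ur.
have lr : vn l <= r.
  apply/ler_addgt0Pl => eps /ul /(_ 0%N)[k _ kl].
  rewrite -[l](subrK (u k)); apply: le_trans (vnD _ _) _.
  by rewrite vnBC; exact: lerD kl (ur k).
exists l => //; apply/eqP; rewrite -subr_eq0; apply/eqP/vn_eq0/le_anti.
rewrite vn_ge0 andbT; apply: le0_of_small => eps eps0.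
have e0 : 0 < eps / 3 by rewrite divr_gt0.
have [N HN] := half_pow_small r e0; have [k Nk kl] := ul _ e0 N.
have -> : T l - l = (T l - T (u k)) + (u k.+1 - u k) + (u k - l).
  by rewrite /u iterS; vring.
apply: le_trans (vnD _ _) _; apply: le_trans (lerD (vnD _ _) (lexx _)) _.
have h1 : vn (T l - T (u k)) <= eps / 3.
  apply: le_trans (Tc _ _ lr (ur k)) _; rewrite vnBC.
  apply: le_trans kl; rewrite ler_piMl ?vn_ge0 //; lra.
have h2 := le_trans (us k) (HN k Nk).
move: h1 h2 kl; lra.
Qed.

End Contraction.

Section PairNorm.
Variables (R : realType) (V W : vectType R).

Lemma pair_vn : exists2 C, 0 <= C & forall (v : V) (w : W), vn ((v, w) : V * W) <= C * (vn v + vn w).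
Proof.
have l1 : linear (fun v : V => (v, 0) : V * W).
  by move=> c x y; congr (_, _); rewrite /= scaler0 addr0.
have l2 : linear (fun w : W => (0, w) : V * W).
  by move=> c x y; congr (_, _); rewrite /= scaler0 addr0.
exists (lbound (fun v : V => (v, 0) : V * W) + lbound (fun w : W => (0, w) : V * W)).
  by rewrite addr_ge0 ?lbound_ge0.
move=> v w; have -> : (v, w) = (v, 0) + (0, w) :> V * W.
  by congr (_, _); rewrite /= ?addr0 ?add0r.
apply: le_trans (vnD _ _) _; apply: le_trans (lerD (lboundP v l1) (lboundP w l2)) _.
have := vn_ge0 v; have := vn_ge0 w.
have := lbound_ge0 (fun v : V => (v, 0) : V * W).
have := lbound_ge0 (fun w : W => (0, w) : V * W).
nra.
Qed.

Lemma vn_fst : exists2 C, 0 <= C & forall z : V * W, vn z.1 <= C * vn z.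
Proof.
exists (lbound (fun z : V * W => z.1)); first exact: lbound_ge0.
by move=> z; apply: lboundP.
Qed.

End PairNorm.

Section Slice.
Variables (R : realType) (E V : vectType R) (d : 'Hom(E, V)).

(** The projection onto the image of d provided by the partial inverse. *)
Definition rproj : 'End(V) := (d \o d^-1)%VF.

Lemma rprojK v : v \in limg d -> rproj v = v.
Proof. by move=> vd; rewrite lfE limg_lfunVK. Qed.

Lemma rproj_d x : rproj (d x) = d x.
Proof. by rewrite rprojK // memv_img ?memvf. Qed.

Lemma rproj_idem v : rproj (rproj v) = rproj v.
Proof. by rewrite [X in rproj X]lfE rproj_d [RHS]lfE. Qed.

Variables (Q : vectType R) (Th : E * Q -> V) (d2 : Q -> V).
Hypothesis Th_sd : sd 0 Th (fun h => d h.1 + d2 h.2).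
Hypothesis Th0 : Th 0 = 0.

(** The part of the implicit function theorem that survives when d is not onto: the
    component of Th along the image of d can be made zero. With H the partial
    inverse and P = d H, the solutions are X = H y for the fixed points of the
    contraction y |-> P y - P Th (H y, q). *)
Lemma slice rho : 0 < rho -> exists2 eta, 0 < eta & forall q, vn q <= eta ->
  exists2 X, vn X <= rho & rproj (Th (X, q)) = 0.
Proof.
move=> rho0; pose H : 'Hom(V, E) := (d^-1)%VF.
have [J J0 JP] := pair_vn E Q.
pose h := lbound H + 1; have h0 : 0 < h by rewrite ltr_wpDl ?lbound_ge0.
have hP y : vn (H y) <= h * vn y.
  apply: le_trans (lboundP y _) _; first exact: linearP.
  by rewrite ler_wpM2r ?vn_ge0 // lerDl.
pose p := lbound rproj + 1; have p0 : 0 < p by rewrite ltr_wpDl ?lbound_ge0.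
have pP y : vn (rproj y) <= p * vn y.
  apply: le_trans (lboundP y _) _; first exact: linearP.
  by rewrite ler_wpM2r ?vn_ge0 // lerDl.
pose J' := J + 1; have J'0 : 0 < J' by rewrite ltr_wpDl.
have J'P (x : E) (q : Q) : vn ((x, q) : E * Q) <= J' * (vn x + vn q).
  apply: le_trans (JP x q) _; rewrite ler_wpM2r ?addr_ge0 ?vn_ge0 // lerDl.
  exact: ler01.
pose c := (2 * p * J' * h)^-1.
have c0 : 0 < c by rewrite invr_gt0 !mulr_gt0.
have [_ /(_ c c0)[r0 r00 Hr0]] := Th_sd.
pose r := Num.min (rho / h) (r0 / (2 * J' * h)).
have r_gt0 : 0 < r by rewrite lt_min !divr_gt0 // !mulr_gt0.
have [r1 r10 Hr1] := sd_cts Th_sd (divr_gt0 r_gt0 (mulr_gt0 (ltr0n R 2) p0)).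
pose eta := Num.min (r0 / (2 * J')) (r1 / J').
exists eta; first by rewrite lt_min !divr_gt0 // mulr_gt0.
move=> q; rewrite le_min => /andP[q1 q2].
pose T y := rproj y - rproj (Th (H y, q)).
have in_r0 y : vn y <= r -> vn ((H y, q) - 0) <= r0.
  rewrite subr0 le_min => /andP[_ y2]; apply: le_trans (J'P _ _) _.
  have a1 := hP y; move: y2 q1; rewrite !ler_pdivlMr ?mulr_gt0 // => y2 q1.
  have : J' * vn (H y) <= J' * (h * vn y) by rewrite ler_wpM2l // ltW.
  rewrite mulrDr; lra.
have [y yr Ty] : exists2 y, vn y <= r & T y = y.
  apply: contraction_fixpoint => // [y z yr zr|].
    have -> : T y - T z = - rproj (Th (H y, q) - Th (H z, q) - (d (H (y - z)) + d2 0)).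
      have -> : d2 0 = 0.
        have [dl _] := Th_sd; have := dl 1 0 0.
        by rewrite scaler0 addr0 /= lf0 add0r scale1r => /eqP; rewrite -subr_eq0 opprD addNKr oppr_eq0 => /eqP.
      rewrite addr0 -[d (H _)]comp_lfunE -/rproj !lflin !rproj_idem.
      rewrite /T; move: (rproj y) (rproj z) (rproj (Th (H y, q))) (rproj (Th (H z, q))).
      by move=> a1 a2 a3 a4; vring.
    rewrite vnN; apply: le_trans (pP _) _.
    have /= := Hr0 _ _ (in_r0 _ yr) (in_r0 _ zr).
    have -> : (H y, q) - (H z, q) = (H (y - z), 0).
      by congr (_, _); rewrite /= ?lflin ?subrr.
    rewrite subrr -lfN -lfD => e1; have e2 := J'P (H (y - z)) 0; rewrite vn0 addr0 in e2.
    have e3 := hP (y - z).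
    apply: le_trans (ler_wpM2l (ltW p0) e1) _.
    apply: (@le_trans _ _ (p * (c * (J' * (h * vn (y - z)))))).
      apply: ler_wpM2l; first exact: ltW.
      apply: ler_wpM2l; first exact: ltW.
      by apply: le_trans e2 _; apply: ler_wpM2l => //; exact: ltW.
    rewrite /c le_eqVlt; apply/orP; left; apply/eqP; field.
    by rewrite !gt_eqF.
  rewrite /T lf0 sub0r vnN; apply: le_trans (pP _) _.
  have : vn (Th (H 0, q) - Th 0) <= r / (2 * p).
    apply: Hr1; rewrite subr0 lf0; apply: le_trans (J'P _ _) _.
    by rewrite vn0 add0r mulrC -ler_pdivlMr.
  rewrite Th0 subr0 => h1; apply: le_trans (ler_wpM2l (ltW p0) h1) _.
  rewrite le_eqVlt; apply/orP; left; apply/eqP; field.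
  by rewrite gt_eqF.
exists (H y).
  apply: le_trans (hP y) _; move: yr; rewrite le_min => /andP[y1 _].
  by rewrite mulrC -ler_pdivlMr.
have := congr1 rproj Ty; rewrite /T !lflin !rproj_idem.
by move=> /eqP; rewrite subr_eq addrC -subr_eq subrr eq_sym => /eqP.
Qed.

End Slice.

Section Rigidity.
Variables (R : realType) (E V W : vectType R) (d : 'Hom(E, V)).
Variables (B : V -> V -> W) (p0 : V) (S : {vspace V}).
Hypothesis Bb : bilinear_for *:%R *:%R B.
Hypothesis B00 : B p0 p0 = 0.
Hypothesis exact_d : forall q, q \in S -> B p0 q + B q p0 = 0 -> q \in limg d.

(** Exactness of the linearised equations makes a solution of the quadratic
    equations near p0 determined by its component along the image of d. *)
Lemma rigid : exists rho kappa, [/\ 0 < rho, 0 < kappa &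
  forall q, q \in S -> B (p0 + q) (p0 + q) = 0 -> vn q <= rho ->
    vn (rproj d q) <= kappa * vn q -> q = 0].
Proof.
have [b bE] := lfun2_of_bilinear Bb.
have [K KE] : exists K : 'Hom(V, (V * (W * V))%type), forall q,
    K q = (rproj d q, (b p0 q + b q p0, q - projv S q)).
  by apply: lfun_of_linear => c x y; congr (_, (_, _)); rewrite !(lflin, lfE) /=; vring.
have K0 : lker K == 0%VS.
  rewrite -subv0; apply/subvP => q; rewrite memv_ker KE memv0 => /eqP[h1 h2 h3].
  have qS : q \in S by rewrite -[q](subrK (projv S q)) h3 add0r memv_proj.
  have /rprojK <- : q \in limg d by apply: exact_d => //; rewrite -!bE.
  by rewrite h1.
have [C1 C10 C1P] := pair_vn V (W * V)%type.
have [C2 C20 C2P] := pair_vn W V.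
pose C := lbound (K^-1)%VF * (C1 * (1 + C2)) + 1.
have C0 : 0 < C by rewrite ltr_wpDl // !mulr_ge0 ?lbound_ge0 // addr_ge0.
have KC q : q \in S -> vn q <= C * (vn (rproj d q) + vn (b p0 q + b q p0)).
  move=> qS; rewrite -{1}(lker0_lfunK K0 q).
  apply: le_trans (lboundP _ _) _; first exact: linearP.
  rewrite KE projv_id // subrr.
  have e1 := C1P (rproj d q) (b p0 q + b q p0, 0).
  have e2 := C2P (b p0 q + b q p0) 0; rewrite vn0 addr0 in e2.
  set x := vn (rproj d q) in e1 *; set y := vn (b p0 q + b q p0) in e2 *.
  set z := vn (b p0 q + b q p0, 0) in e1 e2.
  have x0 : 0 <= x by exact: vn_ge0.
  have y0 : 0 <= y by exact: vn_ge0.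
  have L0 := lbound_ge0 (K^-1)%VF.
  apply: le_trans (ler_wpM2l L0 e1) _.
  have e3 : C1 * (x + z) <= C1 * ((1 + C2) * (x + y)).
    by rewrite ler_wpM2l // ; nra.
  apply: le_trans (ler_wpM2l L0 e3) _.
  rewrite /C !mulrA mulrDl mul1r -!mulrA lerDl; exact: addr_ge0.
pose M := bbound B + 1; have M0 : 0 < M by rewrite ltr_wpDl ?bbound_ge0.
(* Then q is bounded by C (kappa |q| + M rho |q|) = |q| / 2. *)
exists (4 * C * M)^-1, (4 * C)^-1; split; rewrite ?invr_gt0 ?mulr_gt0 //.
move=> q qS Bq qr qk.
have dq : b p0 q + b q p0 = - b q q.
  have b00 : b p0 p0 = 0 by rewrite bE.
  move: Bq; rewrite -bE !(lflin, lfE) b00 add0r => /eqP.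
  by rewrite addrA addr_eq0 => /eqP <-; rewrite addrC.
have := KC q qS; rewrite dq vnN.
have h1 : vn (b q q) <= M * vn q * vn q.
  rewrite bE; apply: le_trans (bboundP _ _ Bb) _.
  by rewrite !ler_wpM2r ?vn_ge0 // lerDl.
have q0 := vn_ge0 q.
have h2 : M * vn q * vn q <= (4 * C)^-1 * vn q.
  rewrite ler_wpM2r // mulrC -ler_pdivlMr //; apply: le_trans qr _.
  by rewrite invfM.
move=> h3; apply: vn_eq0; apply/le_anti; rewrite q0 andbT.
have h4 : C * (vn (rproj d q) + vn (b q q)) <= C * (2 * ((4 * C)^-1 * vn q)).
  apply: ler_wpM2l; first exact: ltW.
  by move: qk (le_trans h1 h2); set t := _^-1 * vn q; lra.
have h5 : C * (2 * ((4 * C)^-1 * vn q)) = vn q / 2 by field; rewrite gt_eqF.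
have := le_trans h3 h4; rewrite h5; lra.
Qed.

End Rigidity.

(** * The exponential of an endomorphism *)

Section Exponential.
Variables (R : realType) (V : vectType R).
Implicit Types (D : 'End(V)) (x y : V).

Definition pexp D n x : V := \sum_(k < n) (k`!%:R : R)^-1 *: iter k D x.

Lemma exp_lim D x eps : 0 < eps -> exists N, forall n, (N <= n)%N ->
  vn (lin_exp D x - pexp D n x) <= eps.
Proof.
move=> eps0; pose m := \dim {:V}; pose e := vbasis {:V}.
pose u i := series (fun k => coord e i (iter k D x) / k`!%:R).
pose d := eps / m.+1%:R; have d0 : 0 < d by rewrite divr_gt0 ?ltr0Sn.
have ui i : exists N, forall n, (N <= n)%N -> `|limn (u i) - u i n| <= d.
  have uc : cvgn (u i) by apply: lin_exp_cvg; exact: linearP.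
  have /cvgrPdist_le/(_ _ d0)[N _ HN] := uc.
  by exists N => n Nn; apply: HN.
have /choice[N HN] := ui.
exists (\max_(i < m) N i)%N => n Nn.
have -> : pexp D n x = \sum_(i < m) u i n *: e`_i.
  rewrite (coord_vbasis (memvf (pexp D n x))); apply: eq_bigr => i _.
  congr (_ *: _); rewrite /pexp linear_sum /u /series /= big_mkord.
  by apply: eq_bigr => k _; rewrite linearZ /= mulrC.
rewrite /lin_exp -sumrB; apply: le_trans (vn_sum _ _ _) _.
apply: (@le_trans _ _ (\sum_(i < m) d)); last first.
  rewrite sumr_const card_ord -mulr_natr /d mulrAC -mulrA ger_pMr //.
  by rewrite ler_pdivrMr ?ltr0Sn // mul1r ler_nat.
apply: ler_sum => i _; rewrite -scalerBl vnZ vn_vbasis mulr1; apply: HN.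
by apply: leq_trans Nn; rewrite (bigD1 i) //= leq_maxl.
Qed.

Lemma exp_eq D x (y : V) : (forall eps, 0 < eps -> forall N, exists2 n, (N <= n)%N &
  vn (pexp D n x - y) <= eps) -> lin_exp D x = y.
Proof.
move=> H; apply/eqP; rewrite -subr_eq0; apply/eqP/vn_eq0/le_anti.
rewrite vn_ge0 andbT; apply: le0_of_small => eps eps0.
have e2 : 0 < eps / 2 by rewrite divr_gt0.
have [N HN] := exp_lim D x e2; have [n Nn hn] := H _ e2 N.
rewrite -[lin_exp D x](subrK (pexp D n x)) -addrA; apply: le_trans (vnD _ _) _.
by rewrite [eps]splitr lerD // HN.
Qed.

Lemma pexp_linear D n : linear (pexp D n).
Proof.
move=> c x y; rewrite /pexp scaler_sumr -big_split; apply: eq_bigr => k _ /=.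
have -> : iter k D (c *: x + y) = c *: iter k D x + iter k D y.
  by elim: (val k) => // j IH; rewrite !iterS IH lfD lfZ.
by vring.
Qed.

Lemma lin_exp_linear D : linear (lin_exp D).
Proof.
move=> c x y; apply: exp_eq => eps eps0 N.
pose d := eps / (`|c| + 1); have c1 : 0 < `|c| + 1 by rewrite ltr_wpDl.
have d0 : 0 < d by rewrite divr_gt0.
have [N1 H1] := exp_lim D x d0; have [N2 H2] := exp_lim D y d0.
exists (N + N1 + N2)%N; first lia.
rewrite pexp_linear; set n := (_ + _)%N.
have -> : c *: pexp D n x + pexp D n y - (c *: lin_exp D x + lin_exp D y) =
  c *: (pexp D n x - lin_exp D x) + (pexp D n y - lin_exp D y).
  by move: (pexp D n x) (pexp D n y) (lin_exp D x) (lin_exp D y) => *; vring.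
apply: le_trans (vnD _ _) _; rewrite vnZ vnBC (vnBC (pexp _ _ y)).
have h1 : vn (lin_exp D x - pexp D n x) <= d by apply: H1; rewrite /n; clear; lia.
have h2 : vn (lin_exp D y - pexp D n y) <= d by apply: H2; rewrite /n; clear; lia.
have -> : eps = `|c| * d + d.
  by rewrite -[X in _ + X]mul1r -mulrDl /d mulrC divfK // gt_eqF.
by apply: lerD => //; rewrite ler_wpM2l.
Qed.

Lemma exp_partial_bound (t : R) : 0 <= t ->
  exists2 M, 0 <= M & forall n, \sum_(k < n) t ^+ k / k`!%:R <= M.
Proof.
move=> t0; have c := @is_cvg_series_exp_coeff R t.
have hn n : \sum_(k < n) t ^+ k / k`!%:R <= limn (series (exp_coeff t)).
  have := nondecreasing_cvgn_le _ c n; rewrite /series /= big_mkord; apply.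
  by apply/nondecreasing_seqP => k; rewrite /series /= big_nat_recr //= lerDl exp_coeff_ge0.
exists (limn (series (exp_coeff t))) => //.
by have := hn 0%N; rewrite big_ord0.
Qed.

Variable ev : R.
Hypothesis evP : forall (D : 'End(V)) x, vn (D x) <= ev * vn D * vn x.
Hypothesis ev0 : 0 <= ev.

Lemma iter_bound D x k : vn (iter k D x) <= (ev * vn D) ^+ k * vn x.
Proof.
elim: k => [|k IH]; first by rewrite expr0 mul1r.
rewrite iterS exprS -mulrA; apply: le_trans (evP _ _) _.
by apply: ler_wpM2l; rewrite ?mulr_ge0 ?vn_ge0.
Qed.

End Exponential.

Lemma evaluation_bound (R : realType) (V W : vectType R) :
  exists2 K, 0 <= K & forall (F : 'Hom(V, W)) x, vn (F x) <= K * vn F * vn x.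
Proof.
have Bb : bilinear_for *:%R *:%R (fun (F : 'Hom(V, W)) (x : V) => F x).
  by split=> [x c F G|F c x y]; rewrite /= !(lflin, lfE).
exists (bbound (fun (F : 'Hom(V, W)) (x : V) => F x)); first exact: bbound_ge0.
by move=> F x; exact: (bboundP F x Bb).
Qed.

(** F is the sum of the rank one maps x |-> x_i F(e_i). *)
Lemma vn_lfun_basis (R : realType) (V W : vectType R) :
  exists2 K, 0 <= K & forall (F : 'Hom(V, W)) M,
    (forall i : 'I_(\dim {:V}), vn (F (vbasis {:V})`_i) <= M) -> vn F <= K * M.
Proof.
have /choice[T TE] : forall i : 'I_(\dim {:V}), exists T : 'Hom(W, 'Hom(V, W)),
    forall w x, T w x = coord (vbasis {:V}) i x *: w.
  move=> i; apply: lfun2_of_bilinear.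
  split=> [x c u v|w c u v] /=; first by rewrite scalerDr !scalerA mulrC.
  by rewrite linearP /= scalerDl scalerA.
exists (\sum_i lbound (T i)); first by apply: sumr_ge0 => i _; exact: lbound_ge0.
move=> F M FM; have -> : F = \sum_i T i (F (vbasis {:V})`_i).
  apply/lfunP => x; rewrite sum_lfunE {1}(coord_vbasis (memvf x)) lf_sum.
  by apply: eq_bigr => i _; rewrite TE lfZ.
apply: le_trans (vn_sum _ _ _) _; rewrite mulr_suml; apply: ler_sum => i _.
apply: le_trans (lboundP _ _) _; first exact: linearP.
by apply: ler_wpM2l; [exact: lbound_ge0|exact: FM].
Qed.

Section ExpDerivation.
Variables (R : realType) (V : vectType R) (b : 'Hom(V, 'End(V))) (D : 'End(V)).
Hypothesis Dder : forall x y, D (b x y) = b (D x) y + b x (D y).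

Let tm k x : V := (k`!%:R : R)^-1 *: iter k D x.

Lemma tmS k x : k.+1%:R *: tm k.+1 x = D (tm k x).
Proof.
rewrite /tm iterS lfZ scalerA factS natrM invfM mulrA divff ?mul1r //.
by rewrite pnatr_eq0.
Qed.

Lemma D_tm i j x y : D (b (tm i x) (tm j y)) =
  i.+1%:R *: b (tm i.+1 x) (tm j y) + j.+1%:R *: b (tm i x) (tm j.+1 y).
Proof.
by rewrite Dder -!tmS (lfZ b i.+1%:R) scale_lfunE (lfZ (b (tm i x)) j.+1%:R).
Qed.

Lemma exp_leibniz k x y : tm k (b x y) = \sum_(i < k.+1) b (tm i x) (tm (k - i) y).
Proof.
elim: k => [|k IH].
  by rewrite big_ord1 subn0 /tm fact0 invr1 !scale1r.
have k0 : k.+1%:R != 0 :> R by rewrite pnatr_eq0.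
apply: (scalerI k0); rewrite tmS IH lf_sum.
under eq_bigr => i _ do rewrite D_tm.
rewrite big_split /=.
have -> : \sum_(i < k.+1) i.+1%:R *: b (tm i.+1 x) (tm (k - i) y) =
          \sum_(i < k.+2) i%:R *: b (tm i x) (tm (k.+1 - i) y).
  by rewrite [RHS]big_ord_recl scale0r add0r; apply: eq_bigr => i _; rewrite subSS.
have -> : \sum_(i < k.+1) (k - i).+1%:R *: b (tm i x) (tm (k - i).+1 y) =
          \sum_(i < k.+2) (k.+1 - i)%:R *: b (tm i x) (tm (k.+1 - i) y).
  rewrite [RHS]big_ord_recr /= subnn scale0r addr0; apply: eq_bigr => i _.
  by rewrite subSn // -ltnS.
rewrite -big_split scaler_sumr; apply: eq_bigr => i _ /=.
by rewrite -scalerDl -natrD subnKC // -ltnS.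
Qed.

(** By the Leibniz rule the partial sums of both sides differ by products of terms
    of total degree at least n. They are bounded using a series with argument
    2 s in place of s, which leaves a factor 2 ^- n. *)
Lemma exp_automorphism x y : lin_exp D (b x y) = b (lin_exp D x) (lin_exp D y).
Proof.
have [K K0 KP] := evaluation_bound V V.
pose s := K * vn D; have s0 : 0 <= s by rewrite mulr_ge0 ?vn_ge0.
have tmb k z : vn (tm k z) <= s ^+ k / k`!%:R * vn z.
  rewrite /tm vnZ ger0_norm ?invr_ge0 // mulrC mulrAC ler_wpM2r ?invr_ge0 //.
  exact: iter_bound.
clearbody s.
have Bb : bilinear_for *:%R *:%R (fun x y => b x y).
  by split=> [z c u v|z c u v]; rewrite /= !(lflin, lfE).
pose C := bbound (fun x y => b x y); have C0 : 0 <= C by exact: bbound_ge0.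
have CP u v : vn (b u v) <= C * vn u * vn v by exact: (bboundP u v Bb).
have [M M0 MP] := @exp_partial_bound R (2 * s) (mulr_ge0 (ler0n _ _) s0).
pose c := C * M * M * vn x * vn y.
have pexpS n z : pexp D n.+1 z = pexp D n z + tm n z.
  by rewrite /pexp big_ord_recr.
have pexpE n : pexp D n (b x y) = \sum_(i < n) b (tm i x) (pexp D (n - i) y).
  elim: n => [|n IH]; first by rewrite /pexp !big_ord0.
  rewrite pexpS IH exp_leibniz.
  have E (i : 'I_n.+1) : b (tm i x) (pexp D (n.+1 - i) y) =
      b (tm i x) (pexp D (n - i) y) + b (tm i x) (tm (n - i) y).
    have -> : (n.+1 - i)%N = (n - i).+1 by rewrite subSn // -ltnS.
    by rewrite pexpS; exact: (lfD (b (tm i x))).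
  rewrite [RHS](eq_bigr _ (fun i _ => E i)) big_split /=; congr (_ + _).
  rewrite [RHS]big_ord_recr /= subnn.
  have -> : pexp D 0 y = 0 by rewrite /pexp big_ord0.
  by rewrite (lf0 (b (tm n x))) addr0.
have tail n i : (i <= n)%N ->
    vn (pexp D n y - pexp D (n - i) y) <= M / 2 ^+ (n - i) * vn y.
  move=> ile.
  have -> : pexp D n y - pexp D (n - i) y = \sum_(n - i <= j < n) tm j y.
    rewrite /pexp -!(big_mkord xpredT (fun k => tm k y)).
    rewrite (big_cat_nat _ (n := (n - i)%N)) //= ?leq_subr //.
    by rewrite addrAC subrr add0r.
  apply: le_trans (vn_sum _ _ _) _.
  have h1 j : (n - i <= j)%N -> vn (tm j y) <=
      ((2 * s) ^+ j / j`!%:R) / 2 ^+ (n - i) * vn y.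
    move=> nij; apply: le_trans (tmb j y) _.
    apply: ler_wpM2r; first exact: vn_ge0.
    have -> : (2 * s) ^+ j / j`!%:R / 2 ^+ (n - i) =
              s ^+ j / j`!%:R * (2 ^+ j / 2 ^+ (n - i)) by rewrite exprMn; ring.
    rewrite ler_peMr ?divr_ge0 ?exprn_ge0 //.
    by rewrite ler_pdivlMr ?exprn_gt0 // mul1r ler_eXn2l // ltr1n.
  rewrite big_seq; apply: (@le_trans _ _ (\sum_(n - i <= j < n)
      ((2 * s) ^+ j / j`!%:R) / 2 ^+ (n - i) * vn y)).
    rewrite [leRHS]big_seq; apply: ler_sum => j; rewrite mem_index_iota.
    by move=> /andP[nij _]; exact: h1.
  rewrite -!mulr_suml; apply: ler_wpM2r; first exact: vn_ge0.
  apply: ler_wpM2r; first by rewrite invr_ge0 exprn_ge0.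
  apply: le_trans (MP n).
  rewrite -(big_mkord xpredT (fun k => (2 * s) ^+ k / k`!%:R)).
  rewrite [leRHS](big_cat_nat _ (n := (n - i)%N)) //= ?leq_subr // lerDr.
  apply: sumr_ge0 => j _; apply: divr_ge0; last exact: ler0n.
  by apply: exprn_ge0; exact: mulr_ge0.
have diff n : vn (pexp D n (b x y) - b (pexp D n x) (pexp D n y)) <= c / 2 ^+ n.
  have bS z : b (pexp D n x) z = \sum_(i < n) b (tm i x) z.
    by rewrite -(sum_lfunE (index_enum _)) -(lf_sum b).
  rewrite vnBC pexpE bS -sumrB.
  rewrite (eq_bigr (fun i : 'I_n => b (tm i x) (pexp D n y - pexp D (n - i) y)));
    last by move=> i _; rewrite (lfD (b (tm i x))) (lfN (b (tm i x))).
  apply: le_trans (vn_sum _ _ _) _.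
  have -> : c / 2 ^+ n = M * (C * (M / 2 ^+ n) * vn x * vn y).
    by rewrite /c; ring.
  apply: le_trans (ler_wpM2r _ (MP n)); last first.
    by rewrite !mulr_ge0 ?vn_ge0 ?invr_ge0 ?exprn_ge0.
  rewrite mulr_suml; apply: ler_sum => i _.
  apply: le_trans (CP _ _) _.
  have le1 := tmb i x; have le2 := tail n i (ltnW (ltn_ord i)).
  apply: (@le_trans _ _ (C * (s ^+ i / i`!%:R * vn x) * (M / 2 ^+ (n - i) * vn y))).
    rewrite -mulrA -[leRHS]mulrA; apply: ler_wpM2l => //.
    by apply: ler_pM => //; exact: vn_ge0.
  have E2 : 2 ^+ n = 2 ^+ i * 2 ^+ (n - i) :> R by rewrite -exprD subnKC // ltnW.
  rewrite E2 exprMn le_eqVlt; apply/orP; left; apply/eqP.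
  have i2 : 2 ^+ i != 0 :> R by rewrite expf_neq0 // pnatr_eq0.
  have n2 : 2 ^+ (n - i) != 0 :> R by rewrite expf_neq0 // pnatr_eq0.
  have f2 : i`!%:R != 0 :> R by rewrite pnatr_eq0 -lt0n fact_gt0.
  move: i2 n2 f2; move: (2 ^+ i) (2 ^+ (n - i)) (i`!%:R) (s ^+ i) => p q f t p0 q0 f0.
  by field; rewrite p0 q0 f0.
apply: exp_eq => eps eps0 N.
(* Both factors on the right are limits as well. *)
pose A := lin_exp D x; pose B := lin_exp D y.
pose d := Num.min 1 (eps / 2 / (C * (vn A + vn B + 1) + 1)).
have S0 : 0 <= C * (vn A + vn B + 1) by rewrite mulr_ge0 // !addr_ge0 ?vn_ge0.
have d0 : 0 < d by rewrite lt_min ltr01 !divr_gt0 // ltr_wpDl.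
have [N1 H1] := exp_lim D x d0; have [N2 H2] := exp_lim D y d0.
have [N3 H3] := half_pow_small c (divr_gt0 eps0 (ltr0n R 2)).
pose n := (N + N1 + N2 + N3)%N; exists n; first by rewrite /n; lia.
have h1 : vn (A - pexp D n x) <= d by apply: H1; rewrite /n; clear; lia.
have h2 : vn (B - pexp D n y) <= d by apply: H2; rewrite /n; clear; lia.
have h3 : c / 2 ^+ n <= eps / 2 by apply: H3; rewrite /n; clear; lia.
have -> : pexp D n (b x y) - b A B =
    (pexp D n (b x y) - b (pexp D n x) (pexp D n y))
  - (b (A - pexp D n x) (pexp D n y) + b A (B - pexp D n y)).
  rewrite !(lflin, lfE).
  move: (pexp D n (b x y)) (b (pexp D n x) (pexp D n y)) (b A B) (b A (pexp D n y)).
  by move=> *; vring.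
apply: le_trans (vnB _ _) _; rewrite [leRHS]splitr; apply: lerD.
  exact: le_trans (diff n) h3.
have d1 : d <= 1 by rewrite ge_min lexx.
have yn : vn (pexp D n y) <= vn B + 1.
  rewrite -[pexp D n y](subrK B) addrC; apply: le_trans (vnD _ _) _.
  by rewrite lerD2l vnBC; exact: le_trans d1.
have dS : d * (C * (vn A + vn B + 1) + 1) <= eps / 2.
  by rewrite -ler_pdivlMr ?ltr_wpDl // ge_min lexx orbT.
apply: le_trans (vnD _ _) _; apply: le_trans (lerD (CP _ _) (CP _ _)) _.
have vA := vn_ge0 A; have vB := vn_ge0 B.
have k1 : C * vn (A - pexp D n x) * vn (pexp D n y) <= C * d * (vn B + 1).
  by rewrite -!mulrA ler_wpM2l // ler_pM ?vn_ge0.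
have k2 : C * vn A * vn (B - pexp D n y) <= C * vn A * d.
  by rewrite ler_wpM2l // mulr_ge0.
apply: le_trans (lerD k1 k2) _; apply: le_trans dS.
have -> : C * d * (vn B + 1) + C * vn A * d = d * (C * (vn A + vn B + 1)) by ring.
by rewrite ler_wpM2l ?(ltW d0) // lerDl.
Qed.

End ExpDerivation.

Section ExpDifferential.
Variables (R : realType) (V : vectType R).
Implicit Types (D : 'End(V)) (x y : V).

Definition lexp D : 'End(V) := linfun (lin_exp D).

Lemma lexpE D x : lexp D x = lin_exp D x.
Proof.
pose F : {linear V -> V} :=
  HB.pack (lin_exp D) (GRing.isLinear.Build R V V *:%R (lin_exp D) (lin_exp_linear D)).
by rewrite /lexp -[lin_exp D]/(F : V -> V) lfunE.
Qed.

Lemma lexp0 : lexp 0 = \1%VF.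
Proof.
apply/lfunP => x; rewrite lexpE id_lfunE; apply: exp_eq => eps eps0 N.
exists N.+1 => //; rewrite /pexp big_ord_recl big1 => [|k _].
  by rewrite /= fact0 invr1 scale1r addr0 subrr vn0 ltW.
by rewrite /= lfE scaler0.
Qed.

(** The terms of degree k >= 2 of the exponential series are Lipschitz on the ball
    of radius s with constant of order s ^ (k - 1) / (k - 1)!, so that together they
    contribute at most a multiple of s. *)
Lemma sd_lexp : sd 0 lexp (fun D : 'End(V) => D).
Proof.
split=> // eps eps0.
have [K K0 KP] := evaluation_bound V V.
have [Kb Kb0 KbP] := vn_lfun_basis V V.
pose s := Num.min 2^-1 (eps / (4 * K * Kb + 1)).
have den0 : 0 < 4 * K * Kb + 1 by rewrite ltr_wpDl // !mulr_ge0.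
have s0 : 0 < s by rewrite lt_min invr_gt0 ltr0n divr_gt0.
have s2 : s <= 2^-1 by rewrite ge_min lexx.
have se : 4 * K * Kb * s <= eps.
  have : s <= eps / (4 * K * Kb + 1) by rewrite ge_min lexx orbT.
  by rewrite ler_pdivlMr //; move: (ltW s0); nra.
clearbody s.
exists (s / (K + 1)); first by rewrite divr_gt0 // ltr_wpDl.
move=> D D'; rewrite !subr0 !ler_pdivlMr ?ltr_wpDl // => hD hD'.
have {}hD : K * vn D <= s by have := vn_ge0 D; lra.
have {}hD' : K * vn D' <= s by have := vn_ge0 D'; lra.
set del := vn (D - D').
have del0 : 0 <= del by exact: vn_ge0.
apply: (@le_trans _ _ (Kb * (4 * K * s * del))); last first.
  have -> : Kb * (4 * K * s * del) = (4 * K * Kb * s) * del by ring.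
  exact: ler_wpM2r.
apply: KbP => i; set x := (vbasis _)`_i; have x1 : vn x = 1 by exact: vn_vbasis.
clearbody x.
have itD k : vn (iter k D' x) <= s ^+ k.
  have := iter_bound KP K0 D' x k; rewrite x1 mulr1 => h; apply: le_trans h _.
  apply: lerXn2r => //; rewrite nnegrE; last exact: ltW.
  by rewrite mulr_ge0 ?vn_ge0.
have lip k : vn (iter k.+1 D x - iter k.+1 D' x) <= k.+1%:R * s ^+ k * K * del.
  elim: k => [|k IH].
    have -> : iter 1 D x - iter 1 D' x = (D - D') x by rewrite !lfE.
    by apply: le_trans (KP _ _) _; rewrite x1 mulr1 expr0 !mul1r.
  have -> : iter k.+2 D x - iter k.+2 D' x =
      D (iter k.+1 D x - iter k.+1 D' x) + (D - D') (iter k.+1 D' x).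
    by rewrite 2!iterS !(lflin, lfE) addrA subrK.
  apply: le_trans (vnD _ _) _.
  have h1 : vn (D (iter k.+1 D x - iter k.+1 D' x)) <= s * (k.+1%:R * s ^+ k * K * del).
    apply: le_trans (KP _ _) _; apply: ler_pM => //; rewrite ?vn_ge0 //.
    by rewrite mulr_ge0 ?vn_ge0.
  have h2 : vn ((D - D') (iter k.+1 D' x)) <= K * del * s ^+ k.+1.
    apply: le_trans (KP _ _) _; apply: ler_wpM2l => //.
    by rewrite mulr_ge0.
  apply: le_trans (lerD h1 h2) _; rewrite le_eqVlt; apply/orP; left; apply/eqP.
  by rewrite exprS -(natr1 k.+1); move: (k.+1%:R : R) => c; ring.
have part n : vn (pexp D n.+2 x - pexp D' n.+2 x - (D - D') x) <=
    (4 - 2 / 2 ^+ n) * (K * s * del).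
  have Ksd : 0 <= K * s * del by rewrite !mulr_ge0 // ltW.
  elim: n => [|n IH].
    rewrite /pexp !big_ord_recr !big_ord0 /= !fact0 invr1 !scale1r !add0r.
    have -> : x + D x - (x + D' x) - (D - D') x = 0 by rewrite !lfE; vring.
    by rewrite vn0; lra.
  have -> : pexp D n.+3 x - pexp D' n.+3 x - (D - D') x =
     (pexp D n.+2 x - pexp D' n.+2 x - (D - D') x) +
     ((n.+2)`!%:R : R)^-1 *: (iter n.+2 D x - iter n.+2 D' x).
    rewrite /pexp ![\sum_(k < n.+3) _]big_ord_recr /=.
    move: (\sum_(k < _) _) (\sum_(k < _) _) ((D - D') x) (D (D (iter n D x)))
      (D' (D' (iter n D' x))) => a1 a2 a3 a4 a5.
    by vring.
  apply: le_trans (vnD _ _) _; apply: le_trans (lerD IH (lexx _)) _.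
  rewrite vnZ ger0_norm ?invr_ge0 //.
  have h := lip n.+1.
  have h1 : ((n.+2)`!%:R)^-1 * vn (iter n.+2 D x - iter n.+2 D' x) <= s ^+ n.+1 * K * del.
    rewrite mulrC ler_pdivrMr ?ltr0n ?fact_gt0 //; apply: le_trans h _.
    have -> : n.+2%:R * s ^+ n.+1 * K * del = s ^+ n.+1 * K * del * n.+2%:R by ring.
    apply: ler_wpM2l; first by rewrite !mulr_ge0 ?exprn_ge0 // ltW.
    by rewrite ler_nat factS leq_pmulr // fact_gt0.
  have h2 : s ^+ n.+1 * K * del <= (1 / 2 ^+ n) * (K * s * del).
    have -> : s ^+ n.+1 * K * del = s ^+ n * (K * s * del) by rewrite exprS; ring.
    apply: ler_wpM2r => //; rewrite div1r -exprVn; apply: lerXn2r => //;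
      by rewrite nnegrE ?invr_ge0 // ltW.
  apply: le_trans (lerD (lexx _) (le_trans h1 h2)) _.
  rewrite -mulrDl; apply: ler_wpM2r => //.
  have -> : 2 / 2 ^+ n.+1 = 1 / 2 ^+ n :> R.
    by rewrite exprS invfM mulrA divff ?pnatr_eq0.
  have -> : 2 / 2 ^+ n = 2 * (1 / 2 ^+ n) :> R by rewrite div1r.
  rewrite le_eqVlt; apply/orP; left; apply/eqP.
  by move: (1 / 2 ^+ n : R) => p; ring.
have half0 n : 0 <= 2 / 2 ^+ n :> R by rewrite divr_ge0 ?exprn_ge0.
rewrite !lfE !lexpE; apply/ler_addgt0Pl => d d0.
have d2 : 0 < d / 2 by rewrite divr_gt0.
have [N1 H1] := exp_lim D x d2; have [N2 H2] := exp_lim D' x d2.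
pose n := (N1 + N2)%N.
have h1 : vn (lin_exp D x - pexp D n.+2 x) <= d / 2 by apply: H1; rewrite /n; clear; lia.
have h2 : vn (lin_exp D' x - pexp D' n.+2 x) <= d / 2 by apply: H2; rewrite /n; clear; lia.
have -> : lin_exp D x - lin_exp D' x - (D x - D' x) =
  (lin_exp D x - pexp D n.+2 x) - (lin_exp D' x - pexp D' n.+2 x)
   + (pexp D n.+2 x - pexp D' n.+2 x - (D - D') x).
  rewrite !lfE; move: (lin_exp D x) (lin_exp D' x) (pexp D n.+2 x) (pexp D' n.+2 x).
  by move: (D x) (D' x) => *; vring.
apply: le_trans (vnD _ _) _; apply: lerD.
  by apply: le_trans (vnB _ _) _; rewrite [d]splitr lerD.
apply: le_trans (part n) _.
have -> : 4 * K * s * del = 4 * (K * s * del) by ring.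
apply: ler_wpM2r; first by rewrite !mulr_ge0 // ltW.
by have := half0 n; lra.
Qed.

End ExpDifferential.

(** * The space of pairs and its actions *)

Section BilinearMaps.
Variables (R : realType).

Lemma mulmx_bilinear n : bilinear_for *:%R *:%R
  (fun (A : 'M[R]_n) (x : 'cV[R]_n) => A *m x).
Proof.
by split=> [x c A B|A c x y] /=; rewrite ?mulmxDl ?mulmxDr -?scalemxAl -?scalemxAr.
Qed.

Lemma comp_bilinear (V1 V2 V3 : vectType R) : bilinear_for *:%R *:%R
  (fun (a : 'Hom(V2, V3)) (f : 'Hom(V1, V2)) => (a \o f)%VF).
Proof.
by split=> [f c a a'|a c f f'] /=;
  rewrite ?comp_lfunDl ?comp_lfunDr -?comp_lfunZl -?comp_lfunZr.
Qed.

Lemma precomp_bilinear (V1 V2 V3 : vectType R) : bilinear_for *:%R *:%R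
  (fun (a : 'Hom(V1, V2)) (f : 'Hom(V2, V3)) => (f \o a)%VF).
Proof. by have [l r] := comp_bilinear V1 V2 V3; split=> x c y z; [exact: r|exact: l]. Qed.

Definition mlf n : 'Hom('M[R]_n, 'End('cV[R]_n)) :=
  sval (cid (lfun2_of_bilinear (mulmx_bilinear n))).
Arguments mlf {n}.
Lemma mlfE n (A : 'M[R]_n) x : mlf A x = A *m x.
Proof. exact: (svalP (cid (lfun2_of_bilinear (mulmx_bilinear n)))). Qed.

Variables V1 V2 V3 : vectType R.
Definition post : 'Hom('Hom(V2, V3), 'Hom('Hom(V1, V2), 'Hom(V1, V3))) :=
  sval (cid (lfun2_of_bilinear (comp_bilinear V1 V2 V3))).
Lemma postE a f : post a f = (a \o f)%VF.
Proof. exact: (svalP (cid (lfun2_of_bilinear (comp_bilinear V1 V2 V3)))). Qed.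

Definition pre : 'Hom('Hom(V1, V2), 'Hom('Hom(V2, V3), 'Hom(V1, V3))) :=
  sval (cid (lfun2_of_bilinear (precomp_bilinear V1 V2 V3))).
Lemma preE a f : pre a f = (f \o a)%VF.
Proof. exact: (svalP (cid (lfun2_of_bilinear (precomp_bilinear V1 V2 V3)))). Qed.

Definition lfmx n (f : 'End('cV[R]_n)) : 'M[R]_n :=
  \matrix_(i, j) f (delta_mx j 0) i 0.
Lemma lfmxE n (f : 'End('cV[R]_n)) x : lfmx f *m x = f x.
Proof.
have colE : x = \sum_i x i 0 *: delta_mx i 0.
  by rewrite [LHS]matrix_sum_delta; apply: eq_bigr => i _; rewrite big_ord1.
rewrite [in RHS]colE lf_sum; apply/colP => i; rewrite mxE summxE.
by apply: eq_bigr => j _; rewrite lfZ !mxE mulrC.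
Qed.

End BilinearMaps.
Arguments mlf {R n}.
Arguments post {R V1 V2 V3}.
Arguments pre {R V1 V2 V3}.

Section PairSpace.
Variables (R : realType) (n : nat) (g : vectType R) (b : 'Hom(g, 'End(g))).
Local Notation U := 'cV[R]_n.
Local Notation Vp := ('Hom(U, 'End(U)) * 'Hom(U, g))%type.
Local Notation br := (fun x y => b x y).

(** Pairs of bundled linear maps form a finite-dimensional vector space [Vp]; this
    forgets the bundling. *)
Definition unp (q : Vp) : pairs n g := (fun x y => q.1 x y, fun x => q.2 x).

(** The inverse of A enters as a separate argument B, which keeps the formula
    polynomial. *)
Definition actV (A B : 'M[R]_n) (u : 'End(g)) (q : Vp) : Vp :=
  ((post (mlf A) \o (pre (mlf B) \o (q.1 \o mlf B)))%VF,
   (u \o (q.2 \o mlf B))%VF).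

Lemma actV1 A B u q x y : (actV A B u q).1 x y = A *m q.1 (B *m x) (B *m y).
Proof. by rewrite /actV /= !lfE postE preE !lfE !mlfE. Qed.

Lemma actV2 A B u q x : (actV A B u q).2 x = u (q.2 (B *m x)).
Proof. by rewrite /actV /= !lfE mlfE. Qed.

Definition laV (X : 'M[R]_n * g) (q : Vp) : Vp :=
  ((post (mlf X.1) \o q.1)%VF - (q.1 \o mlf X.1)%VF -
     (pre (mlf X.1) \o q.1)%VF,
   (b X.2 \o q.2)%VF - (q.2 \o mlf X.1)%VF).

Lemma laV1 X q x y : (laV X q).1 x y =
  X.1 *m q.1 x y - q.1 (X.1 *m x) y - q.1 x (X.1 *m y).
Proof. by rewrite /laV /= !lfE postE preE !lfE !mlfE. Qed.

Lemma laV2 X q x : (laV X q).2 x = b X.2 (q.2 x) - q.2 (X.1 *m x).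
Proof. by rewrite /laV /= !lfE mlfE. Qed.

Lemma Vp_eq (p q : Vp) : (forall x y, p.1 x y = q.1 x y) ->
  (forall x, p.2 x = q.2 x) -> p = q.
Proof.
case: p q => [p1 p2] [q1 q2] /= h1 h2; congr (_, _); apply/lfunP => x //.
by apply/lfunP => y.
Qed.

Lemma VpB1 (p q : Vp) x y : (p - q).1 x y = p.1 x y - q.1 x y.
Proof. by rewrite !lfE. Qed.
Lemma VpB2 (p q : Vp) x : (p - q).2 x = p.2 x - q.2 x.
Proof. by rewrite !lfE. Qed.
Lemma VpD1 (p q : Vp) x y : (p + q).1 x y = p.1 x y + q.1 x y.
Proof. by rewrite !lfE. Qed.
Lemma VpD2 (p q : Vp) x : (p + q).2 x = p.2 x + q.2 x.
Proof. by rewrite !lfE. Qed.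
Lemma VpZ1 c (q : Vp) x y : (c *: q).1 x y = c *: q.1 x y.
Proof. by rewrite !scale_lfunE. Qed.
Lemma VpZ2 c (q : Vp) x : (c *: q).2 x = c *: q.2 x.
Proof. by rewrite scale_lfunE. Qed.
Lemma Vp_lin1 c (p q : Vp) x y : (c *: p + q).1 x y = c *: p.1 x y + q.1 x y.
Proof. by rewrite VpD1 !scale_lfunE. Qed.
Lemma Vp_lin2 c (p q : Vp) x : (c *: p + q).2 x = c *: p.2 x + q.2 x.
Proof. by rewrite VpD2 scale_lfunE. Qed.

Lemma unp_act A (u : 'End(g)) q : gc_action A (fun x => u x) (unp q) = unp (actV A (invmx A) u q).
Proof.
congr (_, _); first by apply/funext => x; apply/funext => y; rewrite actV1.
by apply/funext => x; rewrite actV2.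
Qed.

Lemma unp_la X q : lie_gc_action br X (unp q) = unp (laV X q).
Proof.
congr (_, _); first by apply/funext => x; apply/funext => y; rewrite laV1.
by apply/funext => x; rewrite laV2.
Qed.

Lemma unp_surj p : lie_pair br p -> exists q, unp q = p.
Proof.
case: p => [p1 p2] [/= [p1b _ _] p2l _].
have [q1 q1E] := lfun2_of_bilinear p1b; have [q2 q2E] := lfun_of_linear p2l.
exists (q1, q2); congr (_, _); last by apply/funext.
by apply/funext => x; apply/funext => y; exact: q1E.
Qed.

Lemma unpZ c q : unp (c *: q) = c *: unp q.
Proof.
congr (_, _); first by apply/funext => x; apply/funext => y; rewrite /= !lfE.
by apply/funext => x; rewrite /= !lfE.
Qed.

Lemma unpD p q : unp (p + q) = unp p + unp q.
Proof.
congr (_, _); first by apply/funext => x; apply/funext => y; rewrite /= !lfE.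
by apply/funext => x; rewrite /= !lfE.
Qed.

Definition alt (q : Vp) := forall x, q.1 x x = 0.
Definition lieV (q : Vp) := lie_pair br (unp q).

Lemma lieVP q : lieV q <-> lie_lfun q.1 /\
  forall x y, q.2 (q.1 x y) = b (q.2 x) (q.2 y).
Proof.
split=> [[]|[h1 h2]] //; split=> //; exact: linearP.
Qed.

Lemma lieV_alt q : lieV q -> alt q.
Proof. by move=> /lieVP[/bxx]. Qed.

Lemma laV_comm X Y q : lie_lfun b ->
  laV X (laV Y q) - laV Y (laV X q) =
  laV (X.1 *m Y.1 - Y.1 *m X.1, b X.2 Y.2) q.
Proof.
move=> bL; apply: Vp_eq => [x y|x].
  rewrite VpB1 !laV1 [fst (_, _)]/= !mulmxBr !mulmxBl !mulmxA !(lflin, lfE).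
  set a1 := X.1 *m Y.1 *m q.1 x y; set a2 := Y.1 *m X.1 *m q.1 x y.
  set c1 := X.1 *m q.1 (Y.1 *m x) y; set c2 := X.1 *m q.1 x (Y.1 *m y).
  set c3 := Y.1 *m q.1 (X.1 *m x) y; set c4 := Y.1 *m q.1 x (X.1 *m y).
  set d1 := q.1 (X.1 *m Y.1 *m x) y; set d2 := q.1 (Y.1 *m X.1 *m x) y.
  set d3 := q.1 x (X.1 *m Y.1 *m y); set d4 := q.1 x (Y.1 *m X.1 *m y).
  set d5 := q.1 (X.1 *m x) (Y.1 *m y); set d6 := q.1 (Y.1 *m x) (X.1 *m y).
  by clearbody a1 a2 c1 c2 c3 c4 d1 d2 d3 d4 d5 d6; vring.
rewrite VpB2 !laV2 [fst (_, _)]/= [snd (_, _)]/= (bJ bL) !mulmxBl !mulmxA !(lflin, lfE).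
set a1 := b X.2 (b Y.2 _); set a2 := b Y.2 (b X.2 _).
set c1 := b X.2 (q.2 _); set c2 := b Y.2 (q.2 _).
set d1 := q.2 (X.1 *m Y.1 *m x); set d2 := q.2 (Y.1 *m X.1 *m x).
by clearbody a1 a2 c1 c2 d1 d2; vring.
Qed.

End PairSpace.

(** * Inner products and adjoints *)

Section InnerProducts.
Variables (R : realType) (n : nat) (g : vectType R) (b : 'Hom(g, 'End(g))).
Local Notation U := 'cV[R]_n.
Local Notation Vp := ('Hom(U, 'End(U)) * 'Hom(U, g))%type.
Local Notation VpT := (Vp : vectType R).
Local Notation br := (fun x y => b x y).
Variables (th : 'End(g)) (ip : U -> U -> R) (e : 'I_n -> U).
Hypothesis bL : lie_lfun b.
Hypothesis hth : cartan_involution br (fun x => th x).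
Hypothesis hip : inner_product ip.
Hypothesis he : orthonormal_basis ip e.

Definition gip x y : R := g_ip br (fun x => th x) x y.

Lemma gipE x y : gip x y = - kil b (th x) y.
Proof. by rewrite /gip /g_ip kilE. Qed.

Lemma thK x : th (th x) = x. Proof. by have [_ ->] := hth. Qed.
Lemma thM x y : th (b x y) = b (th x) (th y). Proof. by have [_ _ ->] := hth. Qed.

Lemma kil_th x y : kil b (th x) (th y) = kil b x y.
Proof.
have bth z : b (th z) = (th \o b z \o th)%VF.
  by apply/lfunP => w; rewrite !lfE thM thK.
have thh : (th \o th)%VF = \1%VF by apply/lfunP => w; rewrite !lfE id_lfunE thK.
rewrite /kil !bth -!comp_lfunA (comp_lfunA th th) thh comp_lfun1l.
by rewrite ltrC -!comp_lfunA thh comp_lfun1r.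
Qed.

Lemma gip_sym x y : gip x y = gip y x.
Proof. by rewrite !gipE -kil_th thK kilC. Qed.

Lemma kilNl x y : kil b (- x) y = - kil b x y.
Proof. by rewrite /kil lfN comp_lfunNl linearN. Qed.
Lemma kilNr x y : kil b x (- y) = - kil b x y.
Proof. by rewrite /kil lfN comp_lfunNr linearN. Qed.

Lemma gip_adj v x y : gip (b v x) y = gip x (b (- th v) y).
Proof.
by rewrite !gipE thM (bC bL) kilNl (kil_inv bL) opprK lfN opp_lfunE kilNr opprK.
Qed.

Lemma gip_bil : exists G : 'Hom(g, 'Hom(g, R^o)), forall x y, G x y = gip x y.
Proof. exact: (@lfun2_of_bilinear _ _ _ R^o _ (g_ip_bilinear bL hth)). Qed.

Lemma ip_bil : exists I : 'Hom(U, 'Hom(U, R^o)), forall x y, I x y = ip x y.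
Proof. by have [h _ _] := hip; exact: (@lfun2_of_bilinear _ _ _ R^o _ h). Qed.

Lemma gip_gt0 x : x != 0 -> 0 < gip x x.
Proof. by have [_ _ _] := hth; apply. Qed.

Lemma gip_eq0 x : gip x x = 0 -> x = 0.
Proof. by move=> h; apply/eqP/negPn/negP => /gip_gt0; rewrite h ltxx. Qed.

Lemma gip_ge0 x : 0 <= gip x x.
Proof.
have [->|/gip_gt0/ltW //] := eqVneq x 0.
by have [G GE] := gip_bil; rewrite -GE lf0.
Qed.

Lemma ip_eq0 x : ip x x = 0 -> x = 0.
Proof.
move=> h; apply/eqP/negPn/negP => x0.
by have [_ _ /(_ x x0)] := hip; rewrite h ltxx.
Qed.

Lemma ip_ge0 x : 0 <= ip x x.
Proof.
have [->|x0] := eqVneq x 0; first by have [I IE] := ip_bil; rewrite -IE lf0.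
by have [_ _ /(_ x x0)/ltW] := hip.
Qed.

Lemma ip_sym x y : ip x y = ip y x. Proof. by have [_ ->] := hip. Qed.

Lemma on_expand x : x = \sum_i ip x (e i) *: e i.
Proof.
pose E : 'M[R]_n := \matrix_(i, j) e j i 0.
have EGE : E^T *m (gram ip *m E) = 1%:M.
  apply/matrixP => i j; rewrite [RHS]mxE -he (ip_gram hip).
  have -> : (e i)^T = row i E^T by apply/rowP => k; rewrite !mxE.
  have -> : e j = col j E by apply/colP => k; rewrite !mxE.
  by rewrite -!row_mul colE !mulmxA -colE !mxE.
rewrite mulmxA in EGE; have EEG := mulmx1C EGE.
rewrite -[LHS]mul1mx -EEG; apply/colP => k.
rewrite -!mulmxA mxE summxE; apply: eq_bigr => i _.
rewrite [RHS]mxE [in LHS]mxE mulrC; congr (_ * _).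
rewrite ip_sym (ip_gram hip).
have -> : (e i)^T = row i E^T by apply/rowP => j; rewrite !mxE.
by rewrite -!row_mul [RHS]mxE -mulmxA.
Qed.

(** The trace of a bilinear form over an orthonormal basis does not see on
    which side an operator is applied, up to passing to the adjoint. *)
Lemma trace_transfer (W : vectType R) (f : 'Hom(U, 'Hom(U, W))) (A : 'M[R]_n) :
  \sum_i f (A *m e i) (e i) = \sum_i f (e i) (adjoint_mx ip A *m e i).
Proof.
have l i : f (A *m e i) (e i) = \sum_k ip (A *m e i) (e k) *: f (e k) (e i).
  rewrite {1}(on_expand (A *m e i)) lf_sum sum_lfunE.
  by apply: eq_bigr => k _; rewrite !(lflin, lfE).
have r i : f (e i) (adjoint_mx ip A *m e i) =
    \sum_k ip (A *m e k) (e i) *: f (e i) (e k).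
  rewrite {1}(on_expand (adjoint_mx ip A *m e i)) lf_sum.
  apply: eq_bigr => k _; rewrite lfZ; congr (_ *: _).
  by rewrite ip_sym (adjoint_mxP hip).
rewrite (eq_bigr _ (fun i _ => l i)) (eq_bigr _ (fun i _ => r i)).
by rewrite exchange_big.
Qed.

(** The inner product on pairs; its value at (q, q) is the squared norm. *)
Definition nrm (p q : Vp) : R := pair_ip br (fun x => th x) ip e (unp p) (unp q).

(** For alternating maps the sum over i < j is half the sum over all i, j, which
    unlike the former can be manipulated without ordering the indices. *)
Lemma nrmE p q : alt p -> alt q -> nrm p q =
  2^-1 * (\sum_i \sum_j ip (p.1 (e i) (e j)) (q.1 (e i) (e j)))
  + \sum_i gip (p.2 (e i)) (q.2 (e i)).
Proof.
move=> ap aq; congr (_ + _).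
pose F i j := ip (p.1 (e i) (e j)) (q.1 (e i) (e j)).
have [I IE] := ip_bil.
have altC (r : Vp) x y : alt r -> r.1 x y = - r.1 y x.
  move=> ar; apply/eqP; rewrite -addr_eq0; apply/eqP.
  by have := ar (x + y); rewrite !(lflin, lfE) !ar add0r addr0 addrC.
have FC i j : F i j = F j i.
  by rewrite /F (altC p) // (altC q) // -!IE !(lflin, lfE) opprK.
have Fii i : F i i = 0 by rewrite /F ap -IE lf0 lfE.
have S2 : \sum_(i < n) \sum_j F i j = 2 * \sum_(i < n) \sum_(j < n | (i < j)%N) F i j.
  have -> : \sum_(i < n) \sum_j F i j =
     \sum_(i < n) \sum_(j < n | (i < j)%N) F i j + \sum_(i < n) \sum_(j < n | (j < i)%N) F i j.
    rewrite -big_split; apply: eq_bigr => i _ /=.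
    rewrite (bigID (fun j : 'I_n => (i < j)%N)) /=; congr (_ + _).
    rewrite (bigD1 i) ?ltnn //= Fii add0r; apply: eq_bigl => j.
    by rewrite -leqNgt [RHS]ltn_neqAle andbC.
  rewrite [X in _ + X](exchange_big_dep predT) //= mulr_natl mulr2n; congr (_ + _).
  by apply: eq_bigr => i _; apply: eq_bigr => j _; rewrite FC.
by rewrite S2 mulrA mulVf ?mul1r // pnatr_eq0.
Qed.

Lemma nrm_bil : exists N : 'Hom(VpT, 'Hom(VpT, R^o)), forall p q, N p q = nrm p q.
Proof.
have nl r : scalar (nrm^~ r).
  move=> c p q; rewrite /nrm unpD unpZ.
  exact: (pair_ip_linearl e bL hth hip (unp r)).
have nC p q : nrm p q = nrm q p.
  congr (_ + _); first by apply: eq_bigr => i _; apply: eq_bigr => j _; exact: ip_sym.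
  by apply: eq_bigr => i _; exact: gip_sym.
have nb : bilinear_for *:%R *:%R (nrm : Vp -> Vp -> R^o).
  split=> [q c p p'|p c q q']; first exact: nl.
  by rewrite (nC _ (_ + _)) (nC p q) (nC p q'); exact: nl.
exact: lfun2_of_bilinear nb.
Qed.

Lemma nrm_eq0 p : alt p -> nrm p p = 0 -> p = 0.
Proof.
move=> ap; rewrite nrmE // => /eqP.
have h1 : 0 <= \sum_i \sum_j ip (p.1 (e i) (e j)) (p.1 (e i) (e j)).
  by apply: sumr_ge0 => i _; apply: sumr_ge0 => j _; exact: ip_ge0.
have h2 : 0 <= \sum_i gip (p.2 (e i)) (p.2 (e i)).
  by apply: sumr_ge0 => i _; exact: gip_ge0.
rewrite paddr_eq0 ?mulr_ge0 ?invr_ge0 // mulf_eq0 invr_eq0 pnatr_eq0 /=.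
move=> /andP[s1 s2].
have p1 i j : p.1 (e i) (e j) = 0.
  apply: ip_eq0; move: s1; rewrite psumr_eq0 => [/allP/(_ i (mem_index_enum i))|k _].
    rewrite /= psumr_eq0 => [/allP/(_ j (mem_index_enum j))/eqP //|k _]; exact: ip_ge0.
  by apply: sumr_ge0 => l _; exact: ip_ge0.
have p2 i : p.2 (e i) = 0.
  apply: gip_eq0; move: s2; rewrite psumr_eq0 => [/allP/(_ i (mem_index_enum i))/eqP //|k _].
  exact: gip_ge0.
apply: Vp_eq => [x y|x].
  have -> : (0 : Vp).1 x y = 0 by rewrite !lfE.
  rewrite (on_expand x) (on_expand y) lf_sum.
  apply: big1 => i _; rewrite lfZ lf_sum sum_lfunE big1 ?scaler0 // => j _.
  by rewrite lfZ lfE p1 scaler0.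
have -> : (0 : Vp).2 x = 0 by rewrite lfE.
rewrite (on_expand x) lf_sum; apply: big1 => i _.
by rewrite lfZ p2 scaler0.
Qed.

Definition star (X : 'M[R]_n * g) : 'M[R]_n * g := (adjoint_mx ip X.1, - th X.2).

Lemma laV_alt X (p : Vp) : alt p -> alt (laV b X p).
Proof.
move=> ap x; rewrite laV1 ap mulmx0 sub0r.
have := ap (X.1 *m x + x); rewrite !(lflin, lfE) !ap add0r addr0 => /eqP.
by rewrite addr_eq0 => /eqP ->; rewrite opprK addNr.
Qed.

(** The operators by which gc acts are closed under adjoints; this is what makes
    critical points of the norm so special. *)
Lemma laV_adj X p q : alt p -> alt q -> nrm (laV b X p) q = nrm p (laV b (star X) q).
Proof.
move=> ap aq; rewrite !nrmE //; try exact: laV_alt.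
have [I IE] := ip_bil; have [G GE] := gip_bil; case: X => A v.
congr (_ * _ + _).
  under eq_bigr => i _ do under eq_bigr => j _ do
    rewrite laV1 -IE !(lflin, lfE) !IE (adjoint_mxP hip).
  under [RHS]eq_bigr => i _ do under eq_bigr => j _ do
    rewrite laV1 -IE !(lflin, lfE) !IE.
  have sum3 (F1 F2 F3 : 'I_n -> 'I_n -> R) :
    \sum_i \sum_j (F1 i j - F2 i j - F3 i j) = \sum_i \sum_j F1 i j -
      \sum_j \sum_i F2 i j - \sum_i \sum_j F3 i j.
    rewrite (exchange_big_dep predT (F := fun j i => F2 i j)) //= -!sumrB.
    by apply: eq_bigr => i _; rewrite -!sumrB.
  rewrite !sum3; congr (_ - _ - _); apply: eq_bigr => j _.
    have [f fE] : exists f : 'Hom(U, 'Hom(U, R^o)), forall x y,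
        f x y = ip (p.1 x (e j)) (q.1 y (e j)).
      apply: lfun2_of_bilinear.
      by split=> [x c u w|u c x y]; rewrite /= -!IE !(lflin, lfE).
    by have := trace_transfer f A; under eq_bigr => i _ do rewrite fE;
      under [in RHS]eq_bigr => i _ do rewrite fE.
  have [f fE] : exists f : 'Hom(U, 'Hom(U, R^o)), forall x y,
      f x y = ip (p.1 (e j) x) (q.1 (e j) y).
    apply: lfun2_of_bilinear.
    by split=> [x c u w|u c x y]; rewrite /= -!IE !(lflin, lfE).
  by have := trace_transfer f A; under eq_bigr => i _ do rewrite fE;
    under [in RHS]eq_bigr => i _ do rewrite fE.
under eq_bigr => i _ do rewrite laV2 -GE !(lflin, lfE) !GE gip_adj.
under [RHS]eq_bigr => i _ do rewrite laV2 -GE !(lflin, lfE) !GE.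
rewrite !sumrB; congr (_ - _).
  by apply: eq_bigr => i _; rewrite -!GE !(lflin, lfE).
have [f fE] : exists f : 'Hom(U, 'Hom(U, R^o)), forall x y,
    f x y = gip (p.2 x) (q.2 y).
  apply: lfun2_of_bilinear.
  by split=> [x c u w|u c x y]; rewrite /= -!GE !(lflin, lfE).
transitivity (\sum_i f (A *m e i) (e i)); first by apply: eq_bigr => i _; rewrite fE.
by rewrite trace_transfer; apply: eq_bigr => i _; rewrite fE.
Qed.

End InnerProducts.

(** * Lie algebras with nondegenerate Killing form *)

Section NondegenerateKilling.
Variables (R : realType) (L : vectType R) (b : 'Hom(L, 'End(L))).
Hypothesis bL : lie_lfun b.
Hypothesis bN : nondeg b.

Lemma kil_bil : exists K : 'Hom(L, 'Hom(L, R^o)), forall x y, K x y = kil b x y.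
Proof.
have h : bilinear_for *:%R *:%R (kil b : L -> L -> R^o).
  split=> [y c x x'|x c y y']; rewrite /kil !lflin.
    by rewrite comp_lfunDl -comp_lfunZl linearP.
  by rewrite comp_lfunDr -comp_lfunZr linearP.
exact: lfun2_of_bilinear h.
Qed.

Lemma kil_riesz (l : 'Hom(L, R^o)) : exists z, forall y, kil b z y = l y.
Proof.
have [K KE] := kil_bil.
have K0 : lker K == 0%VS.
  rewrite -subv0; apply/subvP => z; rewrite memv_ker memv0 => /eqP Kz.
  by apply/eqP/bN => y; rewrite -KE Kz lfE.
have full : limg K = fullv.
  apply/eqP; rewrite eqEdim subvf /= limg_dim_eq; last by rewrite (eqP K0) capv0.
  by rewrite !dimvf /dim /= muln1.
have /memv_imgP[z _ lz] : l \in limg K by rewrite full memvf.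
by exists z => y; rewrite -KE -lz.
Qed.

Lemma center0 z : (forall x, b z x = 0) -> z = 0.
Proof.
move=> bz; apply: bN => y; rewrite /kil.
have -> : b z = 0 by apply/lfunP => x; rewrite bz lfE.
by rewrite comp_lfun0l linear0.
Qed.

(** This says that the Lie algebra is perfect. If a functional vanishes on all
    brackets, the element representing it for the Killing form is central, by
    invariance, and the centre lies in the radical of the form. *)
Lemma perfect (W : vectType R) (F : 'Hom(L, W)) :
  (forall x y, F (b x y) = 0) -> forall x, F x = 0.
Proof.
move=> F0 x; apply: coord_eq => i; rewrite coord00.
have [l lE] : exists l : 'Hom(L, R^o), forall x, l x = coord (vbasis {:W}) i (F x).
  by apply: lfun_of_linear => c u v; rewrite !lflin coordD coordZ.
have [z hz] := kil_riesz l; rewrite -lE -hz.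
have -> : z = 0.
  apply: center0 => u; apply: bN => v.
  by rewrite (kil_inv bL) hz lE F0 coord00.
by have [K KE] := kil_bil; rewrite -KE lf0 lfE.
Qed.

(** Let z represent the functional y |-> tr (D ad y). Then E = D - ad z is a derivation
    with tr (E ad w) = 0 for all w, and ad (E y) = [E, ad y] gives
    kil (E y) w = tr (E ad [y, w]) = 0. *)
Lemma derivation_inner (D : 'End(L)) :
  (forall x y, D (b x y) = b (D x) y + b x (D y)) -> exists z, forall y, D y = b z y.
Proof.
move=> Dd.
have [l lE] : exists l : 'Hom(L, R^o), forall y, l y = ltr (D \o b y)%VF.
  apply: lfun_of_linear => c u v.
  by rewrite !lflin comp_lfunDr -comp_lfunZr linearP.
have [z hz] := kil_riesz l; exists z => y.
have [E EE] : exists E, E = D - b z by exists (D - b z).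
have Ed x w : E (b x w) = b (E x) w + b x (E w).
  rewrite EE !lfE Dd (bC bL z (b x w)) (bJ bL) !(lflin, lfE).
  rewrite (bC bL (b z x) w) (bC bL z w) (bC bL z x) !(lflin, lfE).
  move: (b (D x) w) (b x (D w)) (b x (b w z)) (b w (b x z)) => a1 a2 a3 a4.
  by vring.
have Ecomm w : b (E w) = ((E \o b w) - (b w \o E))%VF.
  by apply/lfunP => u; rewrite !lfE Ed addrK.
have Etr w : ltr (E \o b w)%VF = 0.
  rewrite EE comp_lfunDl comp_lfunNl linearB /= -lE -hz.
  by rewrite /kil subrr.
have : E y = 0.
  apply: bN => w; rewrite /kil Ecomm.
  have -> : ltr (((E \o b y) - (b y \o E)) \o b w)%VF = ltr (E \o b (b y w))%VF.
    rewrite (b_comm bL) comp_lfunDl comp_lfunNl comp_lfunDr comp_lfunNr !linearB /=.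
    by rewrite -!comp_lfunA; congr (_ - _); rewrite ltrC -comp_lfunA.
  exact: Etr.
by rewrite EE !lfE => /eqP; rewrite subr_eq0 => /eqP.
Qed.

End NondegenerateKilling.

(** * The Whitehead lemmas *)

Section Whitehead.
Variables (R : realType) (n : nat).
Local Notation U := 'cV[R]_n.
Variables (ip : U -> U -> R) (e : 'I_n -> U) (mu : 'Hom(U, 'End(U))) (s : 'End(U)).
Hypothesis hip : inner_product ip.
Hypothesis he : orthonormal_basis ip e.
Hypothesis muL : lie_lfun mu.
Hypothesis muN : nondeg mu.
Hypothesis s_adj : forall x y z, ip (mu x y) z = ip y (mu (s x) z).

Lemma ip_inj x y : (forall z, ip z x = ip z y) -> x = y.
Proof.
move=> h; have [I IE] := ip_bil hip.
apply/eqP; rewrite -subr_eq0; apply/eqP/(ip_eq0 hip).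
by rewrite -IE lfD lfN !IE h subrr.
Qed.

(** The adjoint of a commutator of inner derivations is the opposite commutator of
    the adjoints, and inner derivations determine their elements. *)
Lemma s_bracket x y : s (mu (s x) y) = - mu x (s y).
Proof.
have [I IE] := ip_bil hip.
have s_adj2 u v w : ip (mu (s u) v) w = ip v (mu u w).
  by rewrite (ip_sym hip) -s_adj (ip_sym hip).
apply/eqP; rewrite -subr_eq0 opprK; apply/eqP/(center0 muN) => z.
have key w : ip (mu (s (mu (s x) y)) z) w = - ip (mu (mu x (s y)) z) w.
  rewrite s_adj2 !(bJ muL) -!IE !(lflin, lfE) !IE.
  by rewrite -(s_adj x) -(s_adj2 y) -(s_adj2 y z) s_adj2 -(s_adj x); lra.
apply: ip_inj => w; rewrite !(ip_sym hip w) -IE !(lflin, lfE) !IE key.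
by rewrite addNr -IE lf0 lfE.
Qed.

Lemma adjoint_ad x z : adjoint_mx ip (lfmx (mu x)) *m z = mu (s x) z.
Proof.
apply: ip_inj => y; rewrite -(adjoint_mxP hip) lfmxE; exact: s_adj.
Qed.

(** Invariance of the tensor sum_i e_i (x) s(e_i), the Casimir tensor. *)
Lemma casimir_invariant (W : vectType R) (f : 'Hom(U, 'Hom(U, W))) x :
  \sum_i f (mu x (e i)) (s (e i)) = - \sum_i f (e i) (mu x (s (e i))).
Proof.
pose h := (pre s \o f)%VF.
have hE y z : h y z = f y (s z) by rewrite lfE preE lfE.
have := trace_transfer hip he h (lfmx (mu x)).
rewrite -sumrN => E.
transitivity (\sum_i h (lfmx (mu x) *m e i) (e i)).
  by apply: eq_bigr => i _; rewrite hE lfmxE.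
rewrite E; apply: eq_bigr => i _.
by rewrite hE adjoint_ad s_bracket lfN.
Qed.

Variables (W : vectType R) (G : 'Hom(W, 'Hom(W, R^o))) (rho : 'Hom(U, 'End(W))).
Hypothesis Gsym : forall x y, G x y = G y x.
Hypothesis Gge0 : forall x, 0 <= (G x x : R).
Hypothesis Geq0 : forall x, G x x = 0 -> x = 0.
Hypothesis rhoM : forall x y w, rho (mu x y) w = rho x (rho y w) - rho y (rho x w).
Hypothesis rho_adj : forall x v w, G (rho x v) w = G v (rho (s x) w).

(** By [rho_adj] this is the sum of the [rho (e i)^* rho (e i)], a nonnegative operator;
    its positivity stands in for complete reducibility. *)
Definition casimir : 'End(W) := \sum_i (rho (s (e i)) \o rho (e i))%VF.

Lemma casimirE w : casimir w = \sum_i rho (s (e i)) (rho (e i) w).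
Proof. by rewrite sum_lfunE; apply: eq_bigr => i _; rewrite lfE. Qed.

Lemma casimir_form v w : G (casimir v) w = \sum_i G (rho (e i) v) (rho (e i) w).
Proof.
rewrite casimirE lf_sum sum_lfunE; apply: eq_bigr => i _.
by rewrite [LHS]Gsym -rho_adj [LHS]Gsym.
Qed.

(** If the nonnegative operator kills w, so does each [rho (e i)]. *)
Lemma casimir_ker w : casimir w = 0 -> forall x, rho x w = 0.
Proof.
move=> Cw x.
have : \sum_i (G (rho (e i) w) (rho (e i) w) : R) = 0.
  by rewrite -casimir_form Cw lf0 lfE.
move=> /eqP; rewrite psumr_eq0 => [/allP h|i _]; last exact: Gge0.
rewrite (on_expand hip he x) lf_sum sum_lfunE big1 // => i _.
rewrite lfZ lfE; have /= /eqP/Geq0 -> := h i (mem_index_enum i).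
by rewrite scaler0.
Qed.

(** A self-adjoint operator has for image the orthogonal complement of its kernel. *)
Lemma casimir_img w : (forall k, casimir k = 0 -> G w k = 0) -> w \in limg casimir.
Proof.
move=> h.
have cap0 : (limg casimir :&: lker casimir)%VS = 0%VS.
  apply/eqP; rewrite -subv0; apply/subvP => k.
  rewrite memv_cap memv_ker memv0 => /andP[/memv_imgP[v _ kE] /eqP Ck].
  apply/eqP/Geq0; rewrite {1}kE casimir_form big1 // => i _.
  by rewrite (casimir_ker Ck) lf0.
have sum_full : (limg casimir + lker casimir)%VS = fullv.
  apply/eqP; rewrite eqEdim subvf /=; have := dimv_add_leqif (limg casimir) (lker casimir).
  have := limg_ker_dim casimir fullv; rewrite capfv.
  have := dimv_disjoint_sum cap0; lia.
have : w \in (limg casimir + lker casimir)%VS by rewrite sum_full memvf.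
move=> /memv_addP[u ui [k]]; rewrite memv_ker => /eqP Ck wE.
have -> : w = u; last by [].
have uk : G u k = 0.
  have /memv_imgP[v _ ->] := ui; rewrite casimir_form big1 // => i _.
  by rewrite (casimir_ker Ck) lf0.
suff k0 : k = 0 by rewrite wE k0 addr0.
by apply: Geq0; have := h k Ck; rewrite wE lfD lfE uk add0r.
Qed.

(** First Whitehead lemma. The obvious candidate for w solves C w = w0, where C is the
    Casimir operator and w0 the contraction of f with the Casimir tensor. What remains
    of f after subtracting this coboundary has w0 = 0; then C kills it, by invariance of
    the tensor, so it takes invariant values and vanishes because the algebra is
    perfect. *)
Lemma whitehead1 (f : 'Hom(U, W)) :
  (forall x y, f (mu x y) = rho x (f y) - rho y (f x)) ->
  exists w, forall x, f x = rho x w.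
Proof.
move=> fc; pose w0 := \sum_i rho (s (e i)) (f (e i)).
have [w1 w1E] : exists w1, casimir w1 = w0.
  have /memv_imgP[w1 _ ->] : w0 \in limg casimir; last by exists w1.
  apply: casimir_img => k Ck; rewrite lf_sum sum_lfunE big1 // => i _.
  by rewrite Gsym -rho_adj (casimir_ker Ck) lf0 lfE.
have [f' f'E] : exists f' : 'Hom(U, W), forall x, f' x = f x - rho x w1.
  apply: lfun_of_linear => c x y; rewrite !(lflin, lfE).
  by move: (f x) (f y) (rho x w1) (rho y w1) => *; vring.
have f'c x y : f' (mu x y) = rho x (f' y) - rho y (f' x).
  rewrite !f'E fc rhoM !lflin.
  by move: (rho x (f y)) (rho y (f x)) (rho x (rho y w1)) (rho y (rho x w1)) => *; vring.
have w0' : \sum_i rho (s (e i)) (f' (e i)) = 0.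
  transitivity (w0 - casimir w1); last by rewrite w1E subrr.
  by rewrite casimirE /w0 -sumrB; apply: eq_bigr => i _; rewrite f'E lfD lfN.
have Cf' x : casimir (f' x) = 0.
  have [B BE] : exists B : 'Hom(U, 'Hom(U, W)), forall y z, B y z = rho z (f' y).
    by apply: lfun2_of_bilinear; split=> [z c y y'|y c z z']; rewrite /= !(lflin, lfE).
  have inv := casimir_invariant B x.
  have : rho x (\sum_i rho (s (e i)) (f' (e i))) = 0 by rewrite w0' lf0.
  rewrite lf_sum (eq_bigr (fun i => B (e i) (mu x (s (e i))) + B (mu x (e i)) (s (e i))
     + rho (s (e i)) (rho (e i) (f' x)))) => [|i _].
    by rewrite !big_split /= inv subrr add0r -casimirE.
  rewrite !BE rhoM f'c !(lflin, lfE).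
  move: (rho x (rho (s (e i)) (f' (e i)))) (rho (s (e i)) (rho x (f' (e i))))
    (rho (s (e i)) (rho (e i) (f' x))) => a1 a2 a3.
  by vring.
have f'0 x : f' x = 0.
  apply: (perfect muL muN) => {}x y; rewrite f'c.
  by rewrite !(casimir_ker (Cf' _)) subrr.
by exists w1 => x; apply/eqP; rewrite -subr_eq0 -f'E f'0.
Qed.

(** Second Whitehead lemma, for a module without invariants. The Casimir operator C is
    then invertible and commutes with the action, and contracting the cocycle f with
    the Casimir tensor gives w whose coboundary is C f. *)
Lemma whitehead2 (f : 'Hom(U, 'Hom(U, W))) :
  (forall w, (forall x, rho x w = 0) -> w = 0) ->
  (forall x, f x x = 0) ->
  (forall x y z, rho x (f y z) - rho y (f x z) + rho z (f x y)
     - f (mu x y) z + f (mu x z) y - f (mu y z) x = 0) ->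
  exists A : 'Hom(U, W), forall x y, f x y = rho x (A y) - rho y (A x) - A (mu x y).
Proof.
move=> inv0 fxx fc.
have C0 : lker casimir == 0%VS.
  rewrite -subv0; apply/subvP => w; rewrite memv_ker memv0 => /eqP Cw.
  by apply/eqP/inv0 => x; exact: casimir_ker.
have fC x y : f x y = - f y x.
  apply/eqP; rewrite -addr_eq0; apply/eqP.
  by have := fxx (x + y); rewrite !(lflin, lfE) !fxx add0r addr0 addrC.
have Crho x w : casimir (rho x w) = rho x (casimir w).
  have [B BE] : exists B : 'Hom(U, 'Hom(U, W)), forall y z, B y z = rho z (rho y w).
    by apply: lfun2_of_bilinear; split=> [z c y y'|y c z z']; rewrite /= !(lflin, lfE).
  have inv := casimir_invariant B x.
  rewrite !casimirE lf_sum; apply/eqP; rewrite eq_sym -subr_eq0 -sumrB; apply/eqP.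
  rewrite (eq_bigr (fun i => B (e i) (mu x (s (e i))) + B (mu x (e i)) (s (e i)))) => [|i _].
    by rewrite big_split /= inv subrr.
  rewrite !BE !rhoM !(lflin, lfE).
  move: (rho x (rho (s (e i)) (rho (e i) w))) (rho (s (e i)) (rho x (rho (e i) w)))
    (rho (s (e i)) (rho (e i) (rho x w))) => a1 a2 a3.
  by vring.
have [w wE] : exists w : 'Hom(U, W), forall y, w y = \sum_i rho (s (e i)) (f (e i) y).
  apply: lfun_of_linear => c y y'; rewrite scaler_sumr -big_split; apply: eq_bigr => i _.
  by rewrite !lflin.
have Cf x y : casimir (f x y) = rho x (w y) - rho y (w x) - w (mu x y).
  have [B1 B1E] : exists B : 'Hom(U, 'Hom(U, W)), forall u v, B u v = rho v (f u y).
    by apply: lfun2_of_bilinear; split=> [z c u u'|u c z z']; rewrite /= !(lflin, lfE).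
  have [B2 B2E] : exists B : 'Hom(U, 'Hom(U, W)), forall u v, B u v = rho v (f u x).
    by apply: lfun2_of_bilinear; split=> [z c u u'|u c z z']; rewrite /= !(lflin, lfE).
  have inv1 := casimir_invariant B1 x; have inv2 := casimir_invariant B2 y.
  rewrite casimirE !wE !lf_sum -sumrB -sumrB.
  rewrite [RHS](eq_bigr (fun i => rho (s (e i)) (rho (e i) (f x y)) +
     ((B1 (e i) (mu x (s (e i))) + B1 (mu x (e i)) (s (e i))) -
      (B2 (e i) (mu y (s (e i))) + B2 (mu y (e i)) (s (e i)))))) => [|i _].
    by rewrite big_split sumrB !big_split /= inv1 inv2 !subrr addr0.
  rewrite !B1E !B2E !rhoM.
  have := congr1 (rho (s (e i))) (fc (e i) x y).
  rewrite (bC muL (e i) x) (bC muL (e i) y) (fC (mu x y) (e i)) !(lflin, lfE).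
  move=> h; apply: subr0_eq; rewrite -[RHS]oppr0 -h.
  move: (rho x (rho (s (e i)) (f (e i) y))) (rho (s (e i)) (rho x (f (e i) y)))
    (rho y (rho (s (e i)) (f (e i) x))) (rho (s (e i)) (rho y (f (e i) x)))
    (rho (s (e i)) (rho (e i) (f x y))) (rho (s (e i)) (f (e i) (mu x y)))
    (rho (s (e i)) (f (mu x (e i)) y)) (rho (s (e i)) (f (mu y (e i)) x)) => *.
  by vring.
exists (casimir^-1 \o w)%VF => x y; have K := lker0_lfunVK C0.
have /lker0P inj := C0; apply: inj.
by rewrite Cf !(lfD, lfN) !Crho !(lfE, K).
Qed.

End Whitehead.

(** * Infinitesimal rigidity at a critical pair *)

Section CriticalPair.
Variables (R : realType) (n : nat) (g : vectType R) (b : 'Hom(g, 'End(g))).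
Local Notation U := 'cV[R]_n.
Local Notation Vp := ('Hom(U, 'End(U)) * 'Hom(U, g))%type.
Local Notation br := (fun x y => b x y).
Variables (th : 'End(g)) (ip : U -> U -> R) (e : 'I_n -> U).
Hypothesis bL : lie_lfun b.
Hypothesis hth : cartan_involution br (fun x => th x).
Hypothesis hip : inner_product ip.
Hypothesis he : orthonormal_basis ip e.
Variables (p : Vp) (c : R).
Hypothesis pL : lieV b p.
Hypothesis pN : nondeg p.1.
Hypothesis crit : forall X, nrm b th ip e (laV b X p) p = c * \tr X.1.

Let muL : lie_lfun p.1. Proof. by have /lieVP[] := pL. Qed.
Let phiM x y : p.2 (p.1 x y) = b (p.2 x) (p.2 y).
Proof. by have /lieVP[_ ->] := pL. Qed.
Let ap : alt p. Proof. exact: lieV_alt pL. Qed.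

(** Where the moment map is a multiple of the identity, the stabiliser is closed
    under adjoints: the squared norm of X^* p is the pairing of [X, X^*] p with
    p, and a commutator has trace zero. *)
Lemma stabilizer_star X : laV b X p = 0 -> laV b (star th ip X) p = 0.
Proof.
move=> Xp; set Y := star th ip X.
apply: (nrm_eq0 bL hth hip he (laV_alt b Y ap)).
rewrite -(laV_adj bL hth hip he) //; last exact: laV_alt.
have l0 Z : laV b Z (0 : Vp) = 0.
  by apply: Vp_eq => [x y|x]; rewrite ?laV1 ?laV2 /= !lfE ?lf0 ?mulmx0 !subr0.
have := laV_comm X Y p bL; rewrite Xp l0 subr0 => ->.
by rewrite crit /= linearB /= mxtrace_mulC subrr mulr0.
Qed.

(** Inner derivations of the source act trivially on a Lie pair, being matched by
    inner derivations of the target. *)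
Lemma inner_stabilizer x : laV b (lfmx (p.1 x), p.2 x) p = 0.
Proof.
apply: Vp_eq => [y z|y]; rewrite ?laV1 ?laV2 /= !lfE !lfmxE.
  rewrite (bJ muL x y z).
  by move: (p.1 x (p.1 y z)) (p.1 y (p.1 x z)) => *; vring.
by rewrite phiM subrr.
Qed.

(** The source is perfect, and invariance turns kil w (phi [u, v]) into
    kil [w, phi u] (phi v). *)
Lemma centralizer_orth w x : (forall y, b w (p.2 y) = 0) -> kil b w (p.2 x) = 0.
Proof.
move=> hw; have [K KE] := kil_bil b.
rewrite -KE -comp_lfunE; apply: (perfect muL pN) => u v.
by rewrite lfE KE phiM -(kil_inv bL) hw /kil lf0 comp_lfun0l linear0.
Qed.

(** The adjoint of an inner derivation stabilises the bracket, so it is a derivation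
    and hence inner: this yields s, a Cartan involution of the source up to sign. The
    defect z = th (phi x) + phi (s x) and its image by th centralise the range of phi,
    and the norm of z is a Killing pairing of such elements with the range of phi. *)
Lemma compatible_star : exists s : 'End(U),
  (forall x y z, ip (p.1 x y) z = ip y (p.1 (s x) z)) /\
  (forall x, th (p.2 x) = - p.2 (s x)).
Proof.
have st x : exists x', forall y, adjoint_mx ip (lfmx (p.1 x)) *m y = p.1 x' y.
  have := stabilizer_star (inner_stabilizer x); rewrite /star /=.
  set D := adjoint_mx _ _ => Dp.
  have [x' hx'] : exists x', forall y, mlf D y = p.1 x' y.
    apply: (derivation_inner muL pN) => y z; rewrite !mlfE.
    have := congr1 (fun q : Vp => q.1 y z) Dp; rewrite laV1 /= !lfE => /eqP.
    by rewrite -addrA -opprD subr_eq0 => /eqP.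
  by exists x' => y; rewrite -hx' mlfE.
have [s0 s0E] := choice st.
have sl : linear s0.
  move=> a x y; apply/eqP; rewrite -subr_eq0; apply/eqP/(center0 pN) => z.
  have [I IE] := ip_bil hip.
  have h u v w : ip (p.1 (s0 u) v) w = ip v (p.1 u w).
    by rewrite -s0E (ip_sym hip) -(adjoint_mxP hip) lfmxE (ip_sym hip).
  apply: (ip_inj hip) => w; rewrite !(ip_sym hip w) -!IE !(lflin, lfE) !IE !h.
  by rewrite -!IE !(lflin, lfE); lra.
have [s sE] := lfun_of_linear sl; exists s.
have sadj x y z : ip (p.1 x y) z = ip y (p.1 (s x) z).
  by rewrite sE -s0E -(adjoint_mxP hip) lfmxE.
split=> // x; apply/eqP; rewrite -addr_eq0; apply/eqP.
pose z := th (p.2 x) + p.2 (s x); rewrite -/z.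
have zc y : b z (p.2 y) = 0.
  have := congr1 (fun q : Vp => q.2 y) (stabilizer_star (inner_stabilizer x)).
  rewrite laV2 /= lfE s0E -sE phiM /z !(lflin, lfE) => /eqP.
  by rewrite -opprD oppr_eq0 => /eqP.
have thzc y : b (th z) (p.2 y) = 0.
  have z0 : laV b (0, z) p = 0.
    apply: Vp_eq => [u v|u]; rewrite ?laV1 ?laV2 /= !lfE ?zc !mul0mx !lf0 ?lfE.
      by rewrite !subr0.
    by rewrite subr0.
  have := congr1 (fun q : Vp => q.2 y) (stabilizer_star z0).
  rewrite laV2 /= lfE /adjoint_mx trmx0 mulmx0 !mul0mx !(lflin, lfE) subr0 => /eqP.
  by rewrite oppr_eq0 => /eqP.
apply: (gip_eq0 hth); have [G GE] := gip_bil bL hth.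
rewrite -GE {2}/z lfD !GE !gipE (kil_th hth) !centralizer_orth //.
by rewrite oppr0 addr0.
Qed.

(** The hypotheses are the linearised equations of Lie pairs. The deformation of the
    bracket is a 2-cocycle with values in the adjoint module, hence the coboundary of
    some A; correcting the deformation of phi by phi A leaves a 1-cocycle with values
    in g, hence the coboundary of some w. So q is tangent to the orbit. *)
Lemma infinitesimal_rigidity (q : Vp) : alt q ->
  (forall x y z, p.1 x (q.1 y z) + p.1 y (q.1 z x) + p.1 z (q.1 x y) +
     (q.1 x (p.1 y z) + q.1 y (p.1 z x) + q.1 z (p.1 x y)) = 0) ->
  (forall x y, p.2 (q.1 x y) + q.2 (p.1 x y) =
     b (p.2 x) (q.2 y) + b (q.2 x) (p.2 y)) ->
  exists X, q = laV b X p.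
Proof.
move=> aq jac hom; have [s [s_adj s_th]] := compatible_star.
have [I IE] := ip_bil hip; have [G GE] := gip_bil bL hth.
have qC x y : q.1 x y = - q.1 y x.
  apply/eqP; rewrite -addr_eq0; apply/eqP.
  by have := aq (x + y); rewrite !(lflin, lfE) !aq add0r addr0 addrC.
have [A AE] : exists A : 'End(U), forall x y,
    q.1 x y = p.1 x (A y) - p.1 y (A x) - A (p.1 x y).
  apply: (whitehead2 hip he muL pN s_adj (G := I) (rho := p.1)) => //.
  - by move=> x y; rewrite !IE (ip_sym hip).
  - by move=> x; rewrite IE; exact: (ip_ge0 hip).
  - by move=> x; rewrite IE; exact: (ip_eq0 hip).
  - by move=> x y w; rewrite (bJ muL).
  - by move=> x v w; rewrite !IE.
  - by move=> w hw; apply: (center0 pN) => x; rewrite (bC muL) hw oppr0.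
  move=> x y z; rewrite -[RHS](jac x y z) (qC z x) (qC (p.1 x y)) (qC (p.1 y z)).
  rewrite (bC muL z x) !lflin (qC (p.1 x z)).
  by vring.
have [f fE] : exists f : 'Hom(U, g), forall x, f x = q.2 x - p.2 (A x).
  by exists (q.2 - (p.2 \o A)%VF) => x; rewrite !lfE.
have [w hw] : exists w, forall x, f x = (b \o p.2)%VF x w.
  apply: (whitehead1 hip he muL pN s_adj (G := G)).
  - by move=> x y; rewrite !GE (gip_sym hth).
  - by move=> x; rewrite GE; exact: (gip_ge0 bL hth).
  - by move=> x; rewrite GE; exact: (gip_eq0 hth).
  - by move=> x y v; rewrite !lfE phiM (bJ bL).
  - by move=> x v u; rewrite !GE !lfE (gip_adj bL hth) s_th opprK.
  move=> x y; rewrite !fE !lfE.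
  have -> : q.2 (p.1 x y) =
      b (p.2 x) (q.2 y) + b (q.2 x) (p.2 y) - p.2 (q.1 x y).
    by rewrite -hom addrAC subrr add0r.
  rewrite AE !lflin !phiM.
  rewrite (bC bL (q.2 x)).
  by vring.
exists (lfmx (- A), - w); apply: Vp_eq => [x y|x].
  rewrite laV1 /= !lfmxE AE !(lflin, lfE) (bC muL (A x)).
  by move: (A (p.1 x y)) (p.1 x (A y)) (p.1 y (A x)) => *; vring.
rewrite laV2 /= lfmxE !(lflin, lfE) -(bC bL).
by have := hw x; rewrite fE !lfE => <-; rewrite opprK subrK.
Qed.

End CriticalPair.

(** * From infinitesimal to local rigidity *)

Lemma sd_postcomp (R : realType) (Z W W' : vectType R) (F : 'Hom(W, W')) z0 (f d : Z -> W) :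
  sd z0 f d -> sd z0 (fun z => F (f z)) (fun z => F (d z)).
Proof.
move=> [dl H]; split=> [c x y|eps eps0]; first by rewrite dl !lflin.
pose K := lbound F + 1; have K0 : 0 < K by rewrite ltr_wpDl ?lbound_ge0.
have [r r0 hr] := H (eps / K) (divr_gt0 eps0 K0); exists r => // z z' hz hz'.
rewrite -!lfN -!lfD; apply: le_trans (lboundP _ _) _; first exact: linearP.
apply: (@le_trans _ _ (K * vn (f z - f z' - d (z - z')))).
  by rewrite ler_wpM2r ?vn_ge0 // lerDl.
by rewrite mulrC -ler_pdivlMr // mulrAC; apply: hr.
Qed.

Lemma sd_pair (R : realType) (Z W W' : vectType R) z0 (f d : Z -> W) (f' d' : Z -> W') :
  sd z0 f d -> sd z0 f' d' ->
  @sd R Z (W * W')%type z0 (fun z => (f z, f' z)) (fun z => (d z, d' z)).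
Proof.
move=> sf sf'.
have [F FE] : exists F : 'Hom(W, (W * W')%type), forall w, F w = (w, 0).
  by apply: lfun_of_linear => c x y; congr (_, _); rewrite /= scaler0 addr0.
have [F' F'E] : exists F : 'Hom(W', (W * W')%type), forall w, F w = (0, w).
  by apply: lfun_of_linear => c x y; congr (_, _); rewrite /= scaler0 addr0.
apply: (sd_ext _ _ (sdD (sd_postcomp F sf) (sd_postcomp F' sf'))) => z;
  by rewrite FE F'E; congr (_, _); rewrite /= ?addr0 ?add0r.
Qed.

Lemma lfun3_of_trilinear (R : realType) (V1 V2 V3 W : vectType R)
    (J : V1 -> V2 -> V3 -> W) :
  (forall x, bilinear_for *:%R *:%R (J x)) ->
  (forall y z, linear (fun x => J x y z)) ->
  exists T : 'Hom(V1, 'Hom(V2, 'Hom(V3, W))), forall x y z, T x y z = J x y z.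
Proof.
move=> J2 J1; have /choice[F FE] : forall x, exists F : 'Hom(V2, 'Hom(V3, W)),
    forall y z, F y z = J x y z by move=> x; exact: lfun2_of_bilinear.
have Fl : linear F.
  move=> c x x'; apply/lfunP => y; apply/lfunP => z.
  by rewrite !lfE !FE; exact: J1.
by have [T TE] := lfun_of_linear Fl; exists T => x y z; rewrite TE.
Qed.

(** If (1 + A) v = 0 then v = - A v, which is shorter than v. *)
Lemma near1_unit (R : realType) n : exists2 r : R, 0 < r &
  forall A : 'M[R]_n, vn A <= r -> 1%:M + A \in unitmx.
Proof.
have K0 := bbound_ge0 (fun (A : 'M[R]_n) (x : 'cV[R]_n) => A *m x).
set K := bbound _ in K0; pose r := (2 * (K + 1))^-1.
have r0 : 0 < r by rewrite invr_gt0 mulr_gt0 // ltr_wpDl.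
exists r => // A Ar; rewrite -unitmx_tr -row_free_unit.
apply/inj_row_free => v vA; apply: trmx_inj; rewrite trmx0.
have : (1%:M + A) *m v^T = 0 by rewrite -[_ + A]trmxK -trmx_mul vA trmx0.
rewrite mulmxDl mul1mx => /eqP; rewrite addr_eq0 => /eqP h.
have := bboundP A v^T (mulmx_bilinear R n); rewrite -/K -vnN -h => h2.
apply: vn_eq0; apply/le_anti; rewrite vn_ge0 andbT.
have v0 := vn_ge0 v^T.
have Kr : K * r <= 2^-1.
  rewrite /r ler_pdivrMr ?mulr_gt0 ?ltr_wpDl //.
  by clear -K0; lra.
have : K * vn A * vn v^T <= 2^-1 * vn v^T.
  by rewrite ler_wpM2r //; apply: le_trans Kr; rewrite ler_wpM2l.
by move: h2; lra.
Qed.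

Section LocalRigidity.
Variables (R : realType) (n : nat) (g : vectType R) (b : 'Hom(g, 'End(g))).
Local Notation U := 'cV[R]_n.
Local Notation Vp := ('Hom(U, 'End(U)) * 'Hom(U, g))%type.
Local Notation VpT := (Vp : vectType R).
Local Notation E := ('M[R]_n * g)%type.
Hypothesis bL : lie_lfun b.

Lemma lieV_act A (u : 'End(g)) (q : Vp) : A \in unitmx ->
  (forall x y, u (b x y) = b (u x) (u y)) -> lieV b q ->
  lieV b (actV A (invmx A) u q).
Proof.
move=> Au uM /lieVP[qL qM]; apply/lieVP; split; last first.
  by move=> x y; rewrite !actV2 actV1 mulKmx // qM uM.
split; first by split=> [x c y z|x c y z] /=; rewrite !lfD !lfZ ?add_lfunE ?scale_lfunE.
  by move=> x; rewrite actV1 (bxx qL) mulmx0.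
move=> x y z; rewrite !actV1 !mulKmx // -!mulmxDr.
by have [_ _ J] := qL; rewrite J mulmx0.
Qed.

Lemma lexp_automorphism v x y : lexp (b v) (b x y) = b (lexp (b v) x) (lexp (b v) y).
Proof.
rewrite !lexpE; apply: exp_automorphism => z w.
by rewrite (bJ bL) subrK.
Qed.

(** Lie pairs are cut out by homogeneous quadratic equations; the polar form B of
    their quadratic map gives the linearised equations. *)
Lemma lie_equations : exists (W : vectType R) (B : Vp -> Vp -> W),
  [/\ bilinear_for *:%R *:%R B,
      forall q, lieV b q <-> alt q /\ B q q = 0
    & forall p q, B p q + B q p = 0 ->
      (forall x y z, p.1 x (q.1 y z) + p.1 y (q.1 z x) + p.1 z (q.1 x y) +
         (q.1 x (p.1 y z) + q.1 y (p.1 z x) + q.1 z (p.1 x y)) = 0) /\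
      (forall x y, p.2 (q.1 x y) + q.2 (p.1 x y) =
         b (p.2 x) (q.2 y) + b (q.2 x) (p.2 y))].
Proof.
have J_ex (p q : Vp) : exists T : 'Hom(U, 'Hom(U, 'Hom(U, U))), forall x y z,
    T x y z = p.1 x (q.1 y z) + p.1 y (q.1 z x) + p.1 z (q.1 x y).
  apply: lfun3_of_trilinear => [x|y z c x x'].
    by split=> [z c y y'|y c z z'] /=; rewrite !lfD !lfZ ?add_lfunE ?scale_lfunE ?lfD ?lfZ; vring.
  by rewrite !lfD !lfZ ?add_lfunE ?scale_lfunE ?lfD ?lfZ; vring.
have H_ex (p q : Vp) : exists T : 'Hom(U, 'Hom(U, g)), forall x y,
    T x y = p.2 (q.1 x y) - b (p.2 x) (q.2 y).
  apply: lfun2_of_bilinear.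
  by split=> [z c y y'|y c z z'] /=; rewrite !lfD !lfZ ?add_lfunE ?scale_lfunE ?lfD ?lfZ; vring.
have /choice[J JP] : forall pq : Vp * Vp, exists T : 'Hom(U, 'Hom(U, 'Hom(U, U))),
    forall x y z, T x y z = pq.1.1 x (pq.2.1 y z) + pq.1.1 y (pq.2.1 z x)
      + pq.1.1 z (pq.2.1 x y) by move=> pq; exact: J_ex.
have /choice[H HP] : forall pq : Vp * Vp, exists T : 'Hom(U, 'Hom(U, g)),
    forall x y, T x y = pq.1.2 (pq.2.1 x y) - b (pq.1.2 x) (pq.2.2 y)
  by move=> pq; exact: H_ex.
have JE p q x y z : J (p, q) x y z = p.1 x (q.1 y z) + p.1 y (q.1 z x) + p.1 z (q.1 x y).
  exact: (JP (p, q)).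
have HE p q x y : H (p, q) x y = p.2 (q.1 x y) - b (p.2 x) (q.2 y) by exact: (HP (p, q)).
exists ('Hom(U, 'Hom(U, 'Hom(U, U))) * 'Hom(U, 'Hom(U, g)))%type.
exists (fun p q => (J (p, q), H (p, q))); split.
- split=> [q c p p'|p c q q']; (congr (_, _); apply/lfunP => x; apply/lfunP => y).
  + apply/lfunP => z; rewrite !(add_lfunE, scale_lfunE) !JE !Vp_lin1; by vring.
  + rewrite !(add_lfunE, scale_lfunE) !HE !Vp_lin2 lfD lfZ add_lfunE scale_lfunE; by vring.
  + apply/lfunP => z; rewrite !(add_lfunE, scale_lfunE) !JE !Vp_lin1 !lfD !lfZ; by vring.
  + rewrite !(add_lfunE, scale_lfunE) !HE !Vp_lin1 !Vp_lin2 !lfD !lfZ; by vring.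
- move=> q; split=> [qL|[qA [hJ hH]]].
    split; first exact: lieV_alt qL.
    have {qL}/lieVP[qL qM] := qL.
    congr (_, _); apply/lfunP => x; apply/lfunP => y.
      by apply/lfunP => z; rewrite JE !lfE /=; have [_ _ ->] := qL.
    by rewrite HE !lfE /= qM subrr.
  apply/lieVP; split=> [|x y].
    split=> [|//|x y z].
      by split=> [x c y z|x c y z] /=; rewrite !lfD !lfZ ?add_lfunE ?scale_lfunE.
    have := congr1 (fun T : 'Hom(U, 'Hom(U, 'Hom(U, U))) => T x y z) hJ.
    by rewrite /= JE !lfE.
  have := congr1 (fun T : 'Hom(U, 'Hom(U, g)) => T x y) hH.
  by rewrite /= HE !lfE /= => /subr0_eq.
move=> p q [hJ hH]; split=> [x y z|x y].
  by have := congr1 (fun T : 'Hom(U, 'Hom(U, 'Hom(U, U))) => T x y z) hJ; rewrite /= !lfE !JE.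
have := congr1 (fun T : 'Hom(U, 'Hom(U, g)) => T x y) hH; rewrite /= !lfE !HE /= => h.
apply: subr0_eq; rewrite -[RHS]h; by vring.
Qed.

End LocalRigidity.

Lemma sdB (R : realType) (Z W : vectType R) z0 (f1 d1 f2 d2 : Z -> W) :
  sd z0 f1 d1 -> sd z0 f2 d2 -> sd z0 (fun z => f1 z - f2 z) (fun z => d1 z - d2 z).
Proof.
move=> h1 h2; have h3 := sd_postcomp (- \1%VF) h2.
by apply: (sd_ext _ _ (sdD h1 h3)) => z; rewrite opp_lfunE id_lfunE.
Qed.

Section RigidityTheorem.
Variables (R : realType) (n : nat) (g : vectType R) (b : 'Hom(g, 'End(g))).
Local Notation U := 'cV[R]_n.
Local Notation Vp := ('Hom(U, 'End(U)) * 'Hom(U, g))%type.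
Local Notation VpT := (Vp : vectType R).
Local Notation E := ('M[R]_n * g)%type.
Local Notation ET := (E : vectType R).
Variable p : Vp.

(** Its zeros are the ((A, v), q) such that acting by (1 + A)^-1 and exp v carries
    p + q to p; the first component has been multiplied by 1 + A, which clears the
    inverse. *)
Definition orbit_eq (z : E * Vp) : Vp :=
  ((pre (mlf (1%:M + z.1.1)) \o ((p.1 + z.2.1) \o mlf (1%:M + z.1.1)))%VF
     - (post (mlf (1%:M + z.1.1)) \o p.1)%VF,
   (lexp (b z.1.2) \o ((p.2 + z.2.2) \o mlf (1%:M + z.1.1)))%VF - p.2).

Lemma orbit_eq1 z x y : (orbit_eq z).1 x y =
  (p.1 + z.2.1) ((1%:M + z.1.1) *m x) ((1%:M + z.1.1) *m y)
    - (1%:M + z.1.1) *m p.1 x y.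
Proof. by rewrite /orbit_eq /= !(add_lfunE, opp_lfunE, comp_lfunE, preE, postE, mlfE). Qed.

Lemma orbit_eq2 z x : (orbit_eq z).2 x =
  lexp (b z.1.2) ((p.2 + z.2.2) ((1%:M + z.1.1) *m x)) - p.2 x.
Proof. by rewrite /orbit_eq /= !(add_lfunE, opp_lfunE, comp_lfunE, mlfE). Qed.

Lemma laV_linear : linear (fun X : ET => laV b X p : VpT).
Proof.
move=> c X Y.
have e1 : (c *: X + Y).1 = c *: X.1 + Y.1 by [].
have e2 : (c *: X + Y).2 = c *: X.2 + Y.2 by [].
apply: Vp_eq => [x y|x].
  have -> : (c *: laV b X p + laV b Y p).1 x y =
      c *: (laV b X p).1 x y + (laV b Y p).1 x y by exact: Vp_lin1.
  rewrite !laV1 e1 !mulmxDl -!scalemxAl !lfD !lfZ add_lfunE scale_lfunE.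
  move: (X.1 *m p.1 x y) (Y.1 *m p.1 x y) (p.1 (X.1 *m x) y) (p.1 (Y.1 *m x) y)
    (p.1 x (X.1 *m y)) (p.1 x (Y.1 *m y)) => *; vring.
have -> : (c *: laV b X p + laV b Y p).2 x =
    c *: (laV b X p).2 x + (laV b Y p).2 x by exact: Vp_lin2.
rewrite !laV2 e1 e2 !mulmxDl -!scalemxAl !lfD !lfZ add_lfunE scale_lfunE.
move: (b X.2 (p.2 x)) (b Y.2 (p.2 x)) (p.2 (X.1 *m x)) (p.2 (Y.1 *m x)) => *; vring.
Qed.

Lemma orbit_eq_sd : exists (d : 'Hom(ET, VpT)),
  (forall X, d X = laV b (- X.1, X.2) p) /\
  @sd R (ET * VpT)%type VpT 0 orbit_eq (fun h => d h.1 + h.2).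
Proof.
have [d dE] : exists d : 'Hom(ET, VpT), forall X, d X = laV b (- X.1, X.2) p.
  apply: lfun_of_linear => c X Y.
  rewrite -laV_linear; congr (laV b _ p); congr (_, _).
  by rewrite /= opprD scalerN.
exists d; split=> //.
pose Z : vectType R := (ET * VpT)%type.
have lA : linear (fun z : Z => mlf z.1.1) by move=> c x y; rewrite /= linearP.
have sA : sd (0 : Z) (fun z : Z => mlf (1%:M + z.1.1)) (fun h : Z => mlf h.1.1).
  apply: (sd_ext _ _ (sdD (sd_const 0 (mlf 1%:M)) (sd_lin 0 lA))) => z.
    by rewrite lfD.
  by rewrite add0r.
have l1 : linear (fun z : Z => z.2.1) by [].
have s1 : sd (0 : Z) (fun z : Z => p.1 + z.2.1) (fun h : Z => h.2.1).
  apply: (sd_ext _ _ (sdD (sd_const 0 p.1) (sd_lin 0 l1))) => // z.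
  by rewrite add0r.
have l2 : linear (fun z : Z => z.2.2) by [].
have s2 : sd (0 : Z) (fun z : Z => p.2 + z.2.2) (fun h : Z => h.2.2).
  apply: (sd_ext _ _ (sdD (sd_const 0 p.2) (sd_lin 0 l2))) => // z.
  by rewrite add0r.
have lv : linear (fun z : Z => b z.1.2) by move=> c x y; rewrite /= linearP.
have sv : sd (0 : Z) (fun z : Z => lexp (b z.1.2)) (fun h : Z => b h.1.2).
  apply: (sd_precomp (f := @lexp R g) (d := fun D => D) lv).
  by rewrite /= lf0; exact: sd_lexp.
have t1 := sd_bil (@comp_bilinear R _ _ _) s1 sA.
have t2 := sd_bil (@comp_bilinear R _ _ _) (sd_postcomp pre sA) t1.
have t3 := sd_bil (@comp_bilinear R _ _ _) (sd_postcomp (post (V1 := U)) sA) (sd_const 0 p.1).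
have u1 := sd_bil (@comp_bilinear R _ _ _) s2 sA.
have u2 := sd_bil (@comp_bilinear R _ _ _) sv u1.
have T := sd_pair (sdB t2 t3) (sdB u2 (sd_const 0 p.2)).
apply: (sd_ext _ _ T) => [z|h] //.
rewrite dE /= !addr0 lf0 lexp0.
apply: Vp_eq => [x y|x].
  have -> : (laV b (- h.1.1, h.1.2) p + h.2).1 x y =
      (laV b (- h.1.1, h.1.2) p).1 x y + h.2.1 x y by exact: VpD1.
  rewrite laV1 /=.
  rewrite !(add_lfunE, opp_lfunE, comp_lfunE, preE, postE, mlfE, zero_lfunE).
  rewrite !mul1mx !mulNmx lfN lfN opp_lfunE ?lf0 addr0.
  move: (p.1 (h.1.1 *m x) y) (p.1 x (h.1.1 *m y)) (h.1.1 *m p.1 x y) (h.2.1 x y).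
  by move=> *; vring.
rewrite VpD2 laV2 /= !(add_lfunE, opp_lfunE, comp_lfunE, mlfE, zero_lfunE) !id_lfunE.
rewrite !mul1mx mulNmx lfN.
move: (b h.1.2 (p.2 x)) (h.2.2 x) (p.2 (h.1.1 *m x)) => *.
by vring.
Qed.

End RigidityTheorem.

Lemma half_absorb (R : realFieldType) (x y z : R) :
  y <= 2^-1 * x -> x <= z + y -> x <= 2 * z.
Proof. lra. Qed.

Lemma half_add (R : realFieldType) (x y d r : R) :
  x * (2 * d) <= r -> y * (2 * d) <= r -> d * x + d * y <= r.
Proof. lra. Qed.

Section LocalOrbit.
Variables (R : realType) (n : nat) (g : vectType R) (b : 'Hom(g, 'End(g))).
Local Notation U := 'cV[R]_n.
Local Notation Vp := ('Hom(U, 'End(U)) * 'Hom(U, g))%type.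
Local Notation VpT := (Vp : vectType R).
Local Notation ET := ((('M[R]_n * g)%type) : vectType R).
Hypothesis bL : lie_lfun b.
Variable p : Vp.
Hypothesis pL : lieV b p.
Hypothesis p_rigid : forall q : Vp, alt q ->
  (forall x y z, p.1 x (q.1 y z) + p.1 y (q.1 z x) + p.1 z (q.1 x y) +
     (q.1 x (p.1 y z) + q.1 y (p.1 z x) + q.1 z (p.1 x y)) = 0) ->
  (forall x y, p.2 (q.1 x y) + q.2 (p.1 x y) =
     b (p.2 x) (q.2 y) + b (q.2 x) (p.2 y)) ->
  exists X, q = laV b X p.

Lemma alt_space : exists S : {vspace VpT}, forall q : Vp, q \in S <-> alt q.
Proof.
have [F FE] : exists F : 'Hom(VpT, 'Hom(U, 'End(U))), forall q x y,
    F q x y = q.1 x y + q.1 y x.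
  apply: lfun3_of_trilinear => [q|x y c q q'].
    by split=> [z c y y'|y c z z']; rewrite /= !(lflin, lfE); vring.
  by rewrite VpD1 VpD1 !VpZ1; vring.
exists (lker F) => q; rewrite memv_ker; split=> [/eqP Fq x|aq].
  have := FE q x x; rewrite Fq !zero_lfunE => /esym/eqP.
  by rewrite -mulr2n -scaler_nat scaler_eq0 pnatr_eq0 => /eqP.
apply/eqP/lfunP => x; apply/lfunP => y; rewrite FE !zero_lfunE.
by have := aq (x + y); rewrite !(lflin, lfE) !aq add0r addr0 addrC.
Qed.

(** [slice] moves q by the group to a Lie pair p' whose error p' - p has, up to higher
    order, no component along the tangent space of the orbit. Since p' solves the
    quadratic equations of Lie pairs, [rigid] shows that the error vanishes. *)
Lemma local_rigidity : exists2 eta, 0 < eta & forall q : Vp, lieV b q ->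
  vn (q - p : VpT) <= eta -> exists a v, a \in unitmx /\
    p = actV (invmx a) a (lexp (b v)) q.
Proof.
have [d [dE dsd]] := orbit_eq_sd b p.
have [W [B [Bb Blie Blin]]] := lie_equations n b.
have [S SE] := alt_space.
have exact_d (q : VpT) : q \in S -> B p q + B q p = 0 -> q \in limg d.
  move=> /SE aq /Blin[jac hom]; have [[A v] ->] := p_rigid aq jac hom.
  have -> : laV b (A, v) p = d (- A, v) by rewrite dE /= opprK.
  by rewrite memv_img ?memvf.
have [rho [kappa [rho0 kappa0 rig]]] := rigid (V := VpT) Bb ((Blie p).1 pL).2 exact_d.
have [T TE] : exists T : 'Hom('M[R]_n, 'Hom(VpT, VpT)), forall A (q : Vp),
    T A q = ((post (mlf A) \o q.1)%VF, 0) :> Vp.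
  apply: lfun2_of_bilinear; split=> [q c A A'|A c q q']; apply: Vp_eq => [x y|x].
  - by rewrite VpD1 VpZ1 /= !(comp_lfunE, lflin, postE, lfE).
  - by rewrite VpD2 VpZ2 /= !zero_lfunE scaler0 addr0.
  - by rewrite VpD1 VpZ1 /= !(comp_lfunE, add_lfunE, scale_lfunE, lfD, lfZ).
  - by rewrite VpD2 VpZ2 /= !zero_lfunE scaler0 addr0.
have [K K0 KP] : exists2 K, 0 <= K & forall A (q : VpT), vn (T A q) <= K * vn A * vn q.
  have h : bilinear_for *:%R *:%R (fun A (q : VpT) => T A q).
    by split=> [q c A A'|A c q q']; rewrite /= !(lflin, lfE).
  exists (bbound (fun A (q : VpT) => T A q)); first exact: bbound_ge0.
  by move=> A q; exact: (bboundP A q h).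
have [C C0 CP] : exists2 C, 0 < C & forall q : VpT, vn (rproj d q) <= C * vn q.
  exists (lbound (rproj d) + 1); first by rewrite ltr_wpDl ?lbound_ge0.
  move=> q; apply: le_trans (lboundP q _) _; first exact: linearP.
  by rewrite ler_wpM2r ?vn_ge0 // lerDl.
have [F F0 FP] := vn_fst (('M[R]_n : vectType R)) g.
have [D D0 DP] := pair_vn ET VpT.
have [r1 r10 unit1] := near1_unit R n.
have orbit_eq0 : orbit_eq b p 0 = 0.
  apply: Vp_eq => [x y|x].
    have -> : (0 : Vp).1 x y = 0 by rewrite !zero_lfunE.
    have -> : (orbit_eq b p 0).1 x y = (p.1 + 0) ((1%:M + 0) *m x) ((1%:M + 0) *m y)
      - (1%:M + 0) *m p.1 x y by exact: orbit_eq1.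
    by rewrite !addr0 !mul1mx subrr.
  have -> : (0 : Vp).2 x = 0 by rewrite zero_lfunE.
  have -> : (orbit_eq b p 0).2 x = lexp (b 0) ((p.2 + 0) ((1%:M + 0) *m x)) - p.2 x
    by exact: orbit_eq2.
  by rewrite !addr0 mul1mx lf0 lexp0 id_lfunE subrr.
have [r2 r20 small] := sd_cts dsd (divr_gt0 rho0 (ltr0n R 2)).
(* On A of size s, 1 + A is invertible and the error q' and the value of orbit_eq,
   which is (1 + A) q' in the first component, are comparable. *)
pose s := Num.min r1 (Num.min (2 * (K + 1))^-1 (kappa / (C * (K + 1)))).
have K1 : 0 < K + 1 by rewrite ltr_wpDl.
have s0 : 0 < s by rewrite !lt_min r10 invr_gt0 divr_gt0 ?mulr_gt0.
pose rX := Num.min (s / (F + 1)) (r2 / (2 * (D + 1))).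
have F1 : 0 < F + 1 by rewrite ltr_wpDl.
have D1 : 0 < D + 1 by rewrite ltr_wpDl.
have rX0 : 0 < rX by rewrite lt_min !divr_gt0 // mulr_gt0.
have [eta eta0 sl] := slice (d2 := fun q : VpT => q) dsd orbit_eq0 rX0.
exists (Num.min eta (r2 / (2 * (D + 1)))).
  by rewrite lt_min eta0 divr_gt0 // mulr_gt0.
move=> q qL; rewrite le_min => /andP[q_eta q_r2].
have [[A v] Xr Pz] := sl (q - p) q_eta.
move: Xr; rewrite le_min => /andP[X1 X2].
have As : vn A <= s.
  apply: le_trans (FP (A, v)) _; apply: (@le_trans _ _ ((F + 1) * vn ((A, v) : ET))).
    by rewrite ler_wpM2r ?vn_ge0 // lerDl.
  by rewrite mulrC -ler_pdivlMr.
move: (As); rewrite !le_min => /andP[A1 /andP[A2 A3]].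
have au := unit1 A A1; set a := 1%:M + A in au.
exists a, v; split=> //.
pose p' := actV (invmx a) a (lexp (b v)) q.
have p'L : lieV b p'.
  rewrite /p' -{2}[a]invmxK; apply: lieV_act => //; first by rewrite unitmx_inv.
  exact: lexp_automorphism.
pose q' : VpT := p' - p.
have q'alt : q' \in S.
  by apply/SE => x; rewrite VpB1 (lieV_alt p'L) (lieV_alt pL) subrr.
have zE : orbit_eq b p ((A, v), q - p) = q' + T A q'.
  have T1 x y : (T A q').1 x y = A *m q'.1 x y.
    by rewrite TE /= !(comp_lfunE, postE, mlfE).
  have T2 x : (T A q').2 x = 0 by rewrite TE /= zero_lfunE.
  apply: Vp_eq => [x y|x].
    have E1 : (q' + T A q').1 x y = q'.1 x y + A *m q'.1 x y.
      by rewrite -T1; exact: VpD1.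
    have E2 : q'.1 x y = invmx a *m q.1 (a *m x) (a *m y) - p.1 x y.
      by rewrite -(actV1 (invmx a) a (lexp (b v)) q x y); exact: VpB1.
    rewrite E1 E2 orbit_eq1.
    have -> : (p.1 + ((A, v), q - p).2.1) = q.1 by rewrite /= addrC subrK.
    rewrite -/a mulmxBr.
    have -> : A = a - 1%:M by rewrite /a addrC addKr.
    rewrite !mulmxBl !mul1mx (mulKVmx au).
    move: (invmx a *m _) => w1; move: (a *m p.1 x y) => w2.
    move: (q.1 _ _) (p.1 x y) => w3 w4.
    by vring.
  have E1 : (q' + T A q').2 x = q'.2 x by rewrite -[RHS]addr0 -(T2 x); exact: VpD2.
  have E2 : q'.2 x = lexp (b v) (q.2 (a *m x)) - p.2 x by rewrite -(actV2 (invmx a) a (lexp (b v)) q x); exact: VpB2.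
  rewrite E1 E2 orbit_eq2.
  have -> : (p.2 + ((A, v), q - p).2.2) = q.2 by rewrite /= addrC subrK.
  by [].
have qn : vn q' <= 2 * vn (orbit_eq b p ((A, v), q - p) : VpT).
  have h1 : vn (T A q') <= 2^-1 * vn q'.
    apply: le_trans (KP A q') _; apply: ler_wpM2r; first exact: vn_ge0.
    apply: (@le_trans _ _ ((K + 1) * vn A)).
      by rewrite ler_wpM2r ?vn_ge0 // lerDl.
    by rewrite mulrC -ler_pdivlMr // -invfM.
  have h2 : vn q' <= vn (q' + T A q') + vn (T A q').
    by have := vnB (q' + T A q') (T A q'); rewrite addrK.
  rewrite zE; move: h1 h2; exact: half_absorb.
have qr : vn q' <= rho.
  apply: le_trans qn _.
  have : vn (orbit_eq b p ((A, v), q - p) - orbit_eq b p 0 : VpT) <= rho / 2.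
    apply: small; rewrite subr0; apply: le_trans (DP _ _) _.
    apply: (@le_trans _ _ ((D + 1) * (vn ((A, v) : ET) + vn (q - p : VpT)))).
      by rewrite ler_wpM2r ?addr_ge0 ?vn_ge0 // lerDl.
    rewrite mulrDr; move: X2 q_r2; rewrite !ler_pdivlMr ?mulr_gt0 //.
    exact: half_add.
  by rewrite orbit_eq0 subr0 ler_pdivlMr // mulrC.
have qk : vn (rproj d q') <= kappa * vn q'.
  have -> : rproj d q' = - rproj d (T A q').
    by apply/eqP; rewrite -addr_eq0 -lfD -zE Pz.
  rewrite vnN; apply: le_trans (CP _) _.
  apply: (@le_trans _ _ (C * ((K + 1) * vn A * vn q'))).
    apply: ler_wpM2l; first exact: ltW.
    apply: le_trans (KP A q') _; apply: ler_wpM2r; first exact: vn_ge0.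
    by rewrite ler_wpM2r ?vn_ge0 // lerDl.
  rewrite mulrA; apply: ler_wpM2r; first exact: vn_ge0.
  by move: A3; rewrite ler_pdivlMr ?mulr_gt0 // mulrC -mulrA.
have q0 : q' = 0.
  apply: rig => //.
  have -> : p + q' = p' by rewrite /q' addrC subrK.
  by have [_] := (Blie p').1 p'L.
by apply/esym/eqP; rewrite -subr_eq0 -/p' -/q' q0.
Qed.

End LocalOrbit.

(** * First variation along one-parameter families *)

Section FirstVariation.
Variable R : realType.

Lemma vn_scalar (x : R) : vn (x : R^o) = `|x| * vn (1 : R^o).
Proof. by rewrite -vnZ; congr vn; rewrite -[RHS]/(x * 1) mulr1. Qed.

Lemma vn_scalar1 : 0 < vn (1 : R^o).
Proof.
rewrite lt_def vn_ge0 andbT; apply/eqP => /vn_eq0 /eqP.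
by rewrite (oner_eq0 R).
Qed.

Lemma sd_scalar (Z : vectType R) z0 (f d : Z -> R^o) : sd z0 f d ->
  forall eps, 0 < eps -> exists2 r, 0 < r & forall z, vn (z - z0) <= r ->
    `|f z - f z0 - d (z - z0)| <= eps * vn (z - z0).
Proof.
move=> [_ H] eps eps0; have [r r0 hr] := H _ (mulr_gt0 eps0 vn_scalar1).
exists r => // z zr; have := hr z z0 zr.
rewrite subrr vn0 (ltW r0) => /(_ isT).
by rewrite (vn_scalar (f z - f z0 - d (z - z0))) mulrAC ler_pM2r ?vn_scalar1.
Qed.

(** A nonzero slope d 1 makes f smaller at a small negative multiple of d 1. *)
Lemma minimum_critical (f d : R^o -> R^o) : sd 0 f d -> (forall t, f 0 <= f t) ->
  d 1 = 0.
Proof.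
move=> fd fmin; have [dl _] := fd; apply/eqP/negPn/negP => s0.
have e0 : 0 < `|d 1| / 2 / vn (1 : R^o) by rewrite !divr_gt0 ?normr_gt0 // vn_scalar1.
have [r r0 hr] := sd_scalar fd e0.
pose k := vn (1 : R^o) * `|d 1| + 1.
have k0 : 0 < k by rewrite ltr_wpDl // mulr_ge0 ?vn_ge0.
pose c := r / k; have c0 : 0 < c by rewrite divr_gt0.
pose t : R^o := - (c * d 1).
have tn : `|t| = c * `|d 1| by rewrite normrN normrM gtr0_norm.
have dt : d t = t * d 1.
  have [F FE] := lfun_of_linear dl.
  by rewrite -!FE -[RHS]/(t *: F 1) -lfZ; congr (F _); rewrite -[RHS]/(t * 1) mulr1.
have v1 := vn_scalar1.
have h : `|f t - f 0 - t * d 1| <= c * `|d 1| ^+ 2 / 2.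
  have tr : vn (t - 0) <= r.
    rewrite subr0 vn_scalar tn -mulrA (mulrC `|d 1|) (_ : r = c * k).
      by rewrite ler_wpM2l ?(ltW c0) // lerDl.
    by rewrite divfK // gt_eqF.
  have := hr t tr; rewrite subr0 dt (vn_scalar t) tn; congr (_ <= _).
  by field; rewrite gt_eqF.
have := fmin t; move: h; rewrite ler_norml => /andP[_].
have -> : `|d 1| ^+ 2 = (d 1) ^+ 2 by rewrite -normrX ger0_norm // sqr_ge0.
have : 0 < c * (d 1) ^+ 2 by rewrite mulr_gt0 // exprn_even_gt0.
have -> : t * d 1 = - (c * d 1 ^+ 2) by rewrite /t mulNr expr2 mulrA.
by move: (f t) (f 0) (c * _) => x y z; lra.
Qed.

End FirstVariation.

Section ActionCurve.
Variables (R : realType) (n : nat) (g : vectType R) (b : 'Hom(g, 'End(g))).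
Local Notation U := 'cV[R]_n.
Local Notation Vp := ('Hom(U, 'End(U)) * 'Hom(U, g))%type.
Local Notation VpT := (Vp : vectType R).

(** The inverse of 1 + t N is replaced by 1 - t N, which is exact when N squares to
    zero and is correct to first order always. *)
Lemma action_curve_sd (X : 'M[R]_n * g) (p : VpT) : @sd R R^o VpT 0
  (fun t => actV (1%:M + t *: X.1) (1%:M - t *: X.1) (lexp (b (t *: X.2))) p)
  (fun t => t *: laV b X p).
Proof.
have lA (N : 'M[R]_n) : linear (fun t : R^o => mlf (t *: N)).
  by move=> c x y; rewrite scalerDl !linearD -scalerA linearZ.
have sA (N : 'M[R]_n) : sd (0 : R^o) (fun t : R^o => mlf (1%:M + t *: N))
    (fun t : R^o => mlf (t *: N)).
  apply: (sd_ext _ _ (sdD (sd_const 0 (mlf 1%:M)) (sd_lin 0 (lA N)))) => z.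
    by rewrite lfD.
  by rewrite add0r.
have sB : sd (0 : R^o) (fun t : R^o => mlf (1%:M - t *: X.1))
    (fun t : R^o => mlf (t *: - X.1)).
  by apply: (sd_ext _ _ (sA (- X.1))) => t //; rewrite scalerN.
have lv : linear (fun t : R^o => b (t *: X.2)).
  by move=> c x y; rewrite scalerDl !linearD -scalerA linearZ.
have sv : sd (0 : R^o) (fun t : R^o => lexp (b (t *: X.2))) (fun t : R^o => b (t *: X.2)).
  apply: (sd_precomp (f := @lexp R g) (d := fun D => D) lv).
  by rewrite /= scale0r lf0; exact: sd_lexp.
have t1 := sd_bil (@comp_bilinear R _ _ _) (sd_const 0 p.1) sB.
have t2 := sd_bil (@comp_bilinear R _ _ _) (sd_postcomp pre sB) t1.
have t3 := sd_bil (@comp_bilinear R _ _ _) (sd_postcomp (post (V1 := U)) (sA X.1)) t2.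
have u1 := sd_bil (@comp_bilinear R _ _ _) (sd_const 0 p.2) sB.
have u2 := sd_bil (@comp_bilinear R _ _ _) sv u1.
apply: (sd_ext _ _ (sd_pair t3 u2)) => [z|t] //.
apply: Vp_eq => [x y|x].
  rewrite VpZ1 laV1 /= !scale0r !subr0 !addr0.
  rewrite !(add_lfunE, opp_lfunE, comp_lfunE, preE, postE, mlfE, zero_lfunE).
  rewrite !mul1mx add0r -!scalemxAl !mulNmx !scalerN !(lfN, lfZ).
  rewrite !(opp_lfunE, scale_lfunE).
  move: (p.1 (X.1 *m x) y) (p.1 x (X.1 *m y)) (X.1 *m p.1 x y).
  by move=> *; vring.
rewrite VpZ2 laV2 /= !scale0r !subr0 !lf0 lexp0.
rewrite !(add_lfunE, opp_lfunE, comp_lfunE, mlfE, zero_lfunE) !id_lfunE.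
rewrite !mul1mx add0r -scalemxAl !mulNmx scalerN !(lfN, lfZ) !scale_lfunE.
move: (b X.2 (p.2 x)) (p.2 (X.1 *m x)) => *.
by vring.
Qed.

End ActionCurve.

(** * Orbits and the determinant of the Killing form *)

Section InnerAutomorphisms.
Variables (R : realType) (g : vectType R) (b : 'Hom(g, 'End(g))).
Local Notation br := (fun x y => b x y).

Definition inner (u : 'End(g)) := inner_aut br (fun x => u x).

Lemma inner1 : inner \1%VF.
Proof.
rewrite /inner; have -> : (fun x => \1%VF x) = @id g by apply/funext => x; rewrite id_lfunE.
exact: inner_aut_id.
Qed.

Lemma inner_lexp v u : inner u -> inner (lexp (b v) \o u)%VF.
Proof.
move=> hu; rewrite /inner.
have -> : (fun x => (lexp (b v) \o u)%VF x) = lin_exp (b v) \o (fun x => u x).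
  by apply/funext => x; rewrite comp_lfunE lexpE.
exact: inner_aut_exp.
Qed.

Lemma inner_ind (P : 'End(g) -> Prop) : P \1%VF ->
  (forall v u, inner u -> P u -> P (lexp (b v) \o u)%VF) -> forall u, inner u -> P u.
Proof.
move=> P1 Pexp u hu.
suff [w [wu _ Pw]] : exists w : 'End(g), [/\ (fun x => w x) = (fun x => u x), inner w & P w].
  by have -> : u = w by apply/lfunP => x; have := congr1 (@^~ x) wu.
move: hu; rewrite /inner; move: (fun x => u x) => h; elim=> [|v k hk [w [<- iw Pw]]].
  exists \1%VF; split=> //; last exact: inner1.
  by apply/funext => x; rewrite id_lfunE.
exists (lexp (b v) \o w)%VF; split; [|exact: inner_lexp|exact: Pexp].
by apply/funext => x; rewrite comp_lfunE lexpE.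
Qed.

Lemma innerM u w : inner u -> inner w -> inner (u \o w)%VF.
Proof.
move=> iu iw; move: u iu; apply: inner_ind => [|v u _ IH]; first by rewrite comp_lfun1l.
by rewrite -comp_lfunA; exact: inner_lexp.
Qed.

Lemma inner_automorphism u x y : lie_lfun b -> inner u -> u (b x y) = b (u x) (u y).
Proof.
move=> bL iu; move: u iu x y; apply: inner_ind => [x y|v u _ IH x y].
  by rewrite !id_lfunE.
by rewrite !comp_lfunE IH lexp_automorphism.
Qed.

End InnerAutomorphisms.

Section Orbits.
Variables (R : realType) (n : nat) (g : vectType R) (b : 'Hom(g, 'End(g))).
Local Notation U := 'cV[R]_n.
Local Notation Vp := ('Hom(U, 'End(U)) * 'Hom(U, g))%type.
Local Notation VpT := (Vp : vectType R).

Lemma actV_comp (A B A' B' : 'M[R]_n) (u u' : 'End(g)) (q : Vp) :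
  actV A B u (actV A' B' u' q) = actV (A *m A') (B' *m B) (u \o u')%VF q.
Proof.
by apply: Vp_eq => [x y|x]; rewrite ?actV1 ?actV2 ?comp_lfunE !mulmxA.
Qed.

Lemma actV_id (q : Vp) : actV 1%:M 1%:M \1%VF q = q.
Proof. by apply: Vp_eq => [x y|x]; rewrite ?actV1 ?actV2 ?id_lfunE !mul1mx. Qed.

Lemma actV_linear (A B : 'M[R]_n) (u : 'End(g)) : linear (actV A B u : VpT -> VpT).
Proof.
move=> c p q; apply: Vp_eq => [x y|x].
  rewrite VpD1 VpZ1 !actV1.
  have -> : (c *: p + q).1 = c *: p.1 + q.1 by [].
  by rewrite !(add_lfunE, scale_lfunE) mulmxDr scalemxAr.
rewrite VpD2 VpZ2 !actV2.
have -> : (c *: p + q).2 = c *: p.2 + q.2 by [].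
by rewrite !(add_lfunE, scale_lfunE) lfD lfZ.
Qed.

Definition orbit (p q : Vp) := exists a u,
  [/\ a \in unitmx, inner b u & q = actV a (invmx a) u p].

Lemma orbit_refl p : orbit p p.
Proof.
exists 1%:M, \1%VF; split; [exact: unitmx1|exact: inner1|].
by rewrite invmx1 actV_id.
Qed.

Lemma orbit_act p q a u : a \in unitmx -> inner b u -> orbit p q ->
  orbit p (actV a (invmx a) u q).
Proof.
move=> au iu [a' [u' [au' iu' ->]]]; exists (a *m a'), (u \o u')%VF.
split; [by rewrite unitmx_mul au|exact: innerM|].
rewrite actV_comp; congr actV; apply: (can_inj (mulmxK (_ : a *m a' \in unitmx))).
  by rewrite unitmx_mul au.
by rewrite mulVmx ?unitmx_mul ?au // -mulmxA mulKmx // mulVmx.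
Qed.

(** Rescaling a pair is acting on it by a homothety of R^n. *)
Lemma orbit_scale p q c : c != 0 -> orbit p q -> orbit p (c *: (q : VpT)).
Proof.
move=> c0 pq; have au : (c^-1)%:M \in @unitmx R n.
  by rewrite unitmxE det_scalar unitfE expf_neq0 ?invr_eq0.
have -> : c *: (q : VpT) = actV (c^-1)%:M (invmx (c^-1)%:M) \1%VF q.
  have iE : invmx (c^-1)%:M = c%:M :> 'M[R]_n.
    by apply: (can_inj (mulmxK au)); rewrite mulVmx // -scalar_mxM mulfV.
  rewrite iE; apply: Vp_eq => [x y|x].
    rewrite VpZ1 actV1 !mul_scalar_mx !(lfZ, scale_lfunE) !scalerA.
    by rewrite mulVf // mul1r.
  by rewrite VpZ2 actV2 id_lfunE mul_scalar_mx lfZ.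
by apply: orbit_act => //; exact: inner1.
Qed.

Lemma orbit_lieV p q : lie_lfun b -> lieV b p -> orbit p q -> lieV b q.
Proof.
move=> bL pL [a [u [au iu ->]]]; apply: lieV_act => // x y.
exact: inner_automorphism.
Qed.

(** The Gram matrix of the Killing form of the first component. *)
Definition kgram (q : Vp) : 'M[R]_n :=
  \matrix_(i, j) kil q.1 (delta_mx i 0) (delta_mx j 0).

Lemma kil_kgram (q : Vp) x y : kil q.1 x y = (x^T *m kgram q *m y) 0 0.
Proof.
have [K KE] := kil_bil q.1.
have colE (z : U) : z = \sum_i z i 0 *: delta_mx i 0.
  by rewrite [LHS]matrix_sum_delta; apply: eq_bigr => i _; rewrite big_ord1.
rewrite mxE -KE {1}(colE y) lf_sum; apply: eq_bigr => j _.
rewrite lfZ mulrC mxE {1}(colE x) lf_sum sum_lfunE; congr (_ * _).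
by apply: eq_bigr => i _; rewrite lfZ lfE KE !mxE.
Qed.

Lemma kgram_nondeg (q : Vp) : nondeg q.1 <-> \det (kgram q) != 0.
Proof.
have unitE : (\det (kgram q) != 0) = row_free (kgram q).
  by rewrite row_free_unit unitmxE unitfE.
rewrite unitE; split=> [qN|qN x x0].
  apply/inj_row_free => v vG; apply: trmx_inj; rewrite trmx0.
  by apply: qN => y; rewrite kil_kgram trmxK vG mul0mx mxE.
apply: trmx_inj; apply: (row_free_inj qN); rewrite trmx0 mul0mx.
apply/rowP => j; rewrite [RHS]mxE.
by have := x0 (delta_mx j 0); rewrite kil_kgram -colE [col _ _ _ _]mxE.
Qed.

(** Acting by a transports the Killing form of the bracket by a, as conjugation
    does not change traces. *)
Lemma kgram_act a u (q : Vp) : a \in unitmx ->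
  kgram (actV a (invmx a) u q) = (invmx a)^T *m kgram q *m invmx a.
Proof.
move=> au; apply/matrixP => i j; rewrite mxE.
have -> x y : kil (actV a (invmx a) u q).1 x y = kil q.1 (invmx a *m x) (invmx a *m y).
  have E z : (actV a (invmx a) u q).1 z =
      (mlf a \o (q.1 (invmx a *m z) \o mlf (invmx a)))%VF.
    by apply/lfunP => w; rewrite actV1 !comp_lfunE !mlfE.
  have aK : (mlf (invmx a) \o mlf a)%VF = \1%VF.
    by apply/lfunP => w; rewrite comp_lfunE !mlfE id_lfunE mulKmx.
  rewrite /kil !E -!comp_lfunA (comp_lfunA (mlf (invmx a)) (mlf a)) aK comp_lfun1l.
  by rewrite ltrC -!comp_lfunA aK comp_lfun1r.
rewrite kil_kgram trmx_mul !mulmxA.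
have E (M : 'M[R]_n) : M i j = ((delta_mx i 0 : 'cV[R]_n)^T *m M *m delta_mx j 0 : 'M_1) 0 0.
  by rewrite trmx_delta -rowE -colE !mxE.
by rewrite [RHS]E !mulmxA.
Qed.

Lemma det_kgram_act a u (q : Vp) : a \in unitmx ->
  \det (kgram (actV a (invmx a) u q)) = (\det a) ^- 2 * \det (kgram q).
Proof.
move=> au; rewrite kgram_act // !det_mulmx det_tr det_inv mulrAC -expr2.
by rewrite exprVn.
Qed.

End Orbits.

(** * Maxima of continuous functions on bounded sets *)

Section ExtremePoints.
Variables (R : realType) (V : vectType R).

Definition cts_at (l : V) (f : V -> R) := forall eps, 0 < eps ->
  exists2 r, 0 < r & forall q, vn (q - l) <= r -> `|f q - f l| <= eps.

Definition adherent (S : V -> Prop) (l : V) := forall eps, 0 < eps ->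
  exists2 q, S q & vn (q - l) <= eps.

Lemma sd_cts_at (l : V) (f : V -> R^o) d : sd l f d -> cts_at l f.
Proof.
move=> fd eps eps0.
have [r r0 hr] := sd_cts fd (mulr_gt0 eps0 (vn_scalar1 R)).
exists r => // q /hr; rewrite (vn_scalar (f q - f l)).
by rewrite ler_pM2r ?vn_scalar1.
Qed.

Lemma vn_cts_at (l : V) : cts_at l (@vn R V).
Proof.
move=> eps eps0; exists eps => // q; apply: le_trans.
have h1 := vnD (q - l) l; rewrite subrK in h1.
have h2 := vnB q (q - l); rewrite opprB addrC subrK in h2.
by rewrite ler_norml; move: (vn _) (vn q) (vn l) h1 h2 => x y z; lra.
Qed.

Lemma adherent_ge0 S (l : V) f : adherent S l -> cts_at l f ->
  (forall q, S q -> 0 <= f q) -> 0 <= f l.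
Proof.
move=> Sl fl f0; apply/ler_addgt0Pl => eps eps0.
have [r r0 hr] := fl _ eps0; have [q Sq /hr] := Sl _ r0.
by have := f0 q Sq; rewrite ler_norml => h /andP[_]; lra.
Qed.

Lemma adherent_eq0 S (l : V) (W : vectType R) (F d : V -> W) : adherent S l ->
  sd l F d -> (forall q, S q -> F q = 0) -> F l = 0.
Proof.
move=> Sl Fd F0; apply: vn_eq0; apply/le_anti; rewrite vn_ge0 andbT.
apply: le0_of_small => eps eps0.
have [r r0 hr] := sd_cts Fd eps0; have [q Sq /hr] := Sl _ r0.
by rewrite (F0 q Sq) sub0r vnN.
Qed.

(** Points where f exceeds every bound would cluster somewhere, and f is bounded
    near the cluster point. *)
Lemma bounded_above S K f : (forall q, S q -> vn q <= K) ->
  (forall l, adherent S l -> cts_at l f) -> exists M, forall q, S q -> f q <= M.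
Proof.
move=> SK fc; apply: contrapT => nb.
have /choice[u uE] : forall k : nat, exists q, S q /\ k%:R < f q.
  move=> k; apply: contrapT => h; apply: nb; exists k%:R => q Sq.
  by rewrite leNgt; apply/negP => kq; apply: h; exists q.
have [l lE] := bounded_cluster (fun k => SK (u k) (uE k).1).
have Sl : adherent S l.
  by move=> eps eps0; have [k _ h] := lE eps eps0 0%N; exists (u k) => //; have [] := uE k.
have [r r0 hr] := fc l Sl 1 ltr01.
have [N NE] : exists N : nat, f l + 1 <= N%:R.
  exists (Num.truncn `|f l + 1|).+1; apply: le_trans (ler_norm _) _.
  by apply: ltW; have /andP[] := truncn_itv (normr_ge0 (f l + 1)).
have [k Nk /hr] := lE r r0 N; have [_ ku] := uE k.
have : (N%:R : R) <= k%:R by rewrite ler_nat.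
by rewrite ler_norml => h1 /andP[_]; move: ku NE h1; lra.
Qed.

(** S need not be closed: the supremum is attained in its closure, at a cluster point
    of a maximising sequence. *)
Lemma extreme_point S K f : (forall q, S q -> vn q <= K) -> (exists q, S q) ->
  (forall l, adherent S l -> cts_at l f) ->
  exists2 l, adherent S l & forall q, S q -> f q <= f l.
Proof.
move=> SK [q0 Sq0] fc; have [M ME] := bounded_above SK fc.
pose A : set R := ([set f q | q in S])%classic.
have As : has_sup A by split; [exists (f q0), q0|exists M => _ [q Sq <-]; exact: ME].
have /choice[u uE] : forall k : nat, exists q, S q /\ sup A - k.+1%:R^-1 < f q.
  move=> k; have k0 : 0 < k.+1%:R^-1 :> R by rewrite invr_gt0.
  have [_ [q Sq <-] h] := sup_adherent k0 As.
  by exists q.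
have [l lE] := bounded_cluster (fun k => SK (u k) (uE k).1).
have Sl : adherent S l.
  by move=> eps eps0; have [k _ h] := lE eps eps0 0%N; exists (u k) => //; have [] := uE k.
exists l => // q Sq; apply/ler_addgt0Pl => eps eps0.
have e2 : 0 < eps / 2 by rewrite divr_gt0.
have [r r0 hr] := fc l Sl _ e2.
have [N NE] := ltr_add_invr e2.
have [k Nk /hr] := lE r r0 N; have [_ ku] := uE k.
have qs : f q <= sup A by apply: ub_le_sup; [exact: As.2|exists q].
have : (k.+1%:R^-1 : R) <= N.+1%:R^-1 by rewrite lef_pV2 ?posrE ?ltr0n // ler_nat.
move: NE; rewrite add0r ler_norml => h1 h2 /andP[_].
by move: ku qs h1 h2; move: (k.+1%:R^-1) (N.+1%:R^-1) => *; lra.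
Qed.

End ExtremePoints.

(** * Minimising the norm along an orbit *)

Section Differentiable.
Variables (R : realType) (V : vectType R) (l : V).

(** The value of the differential does not matter: this is a form of continuity that
    is stable under sums and products. *)
Definition sd_at (f : V -> R^o) := exists d, sd l f d.

Lemma sd_at_const (c : R) : sd_at (fun=> c).
Proof. by exists (fun=> 0); exact: (sd_const l (c : R^o)). Qed.

Lemma sd_at_add f h : sd_at f -> sd_at h -> sd_at (fun q => f q + h q).
Proof. by move=> [d fd] [d' hd]; eexists; exact: sdD fd hd. Qed.

Lemma sd_at_mul f h : sd_at f -> sd_at h -> sd_at (fun q => f q * h q).
Proof.
move=> [d fd] [d' hd]; eexists.
have mb : bilinear_for *:%R *:%R (fun x y : R^o => x * y : R^o).
  split=> [y c x x'|x c y y'] /=; first by rewrite mulrDl scalerAl.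
  by rewrite mulrDr scalerAr.
exact: sd_bil mb fd hd.
Qed.

Lemma sd_at_sum I (r : seq I) (F : I -> V -> R^o) :
  (forall i, sd_at (F i)) -> sd_at (fun q => \sum_(i <- r) F i q).
Proof.
move=> Fd; elim: r => [|i r IH].
  have -> : (fun q => \sum_(i <- [::]) F i q) = fun=> 0 :> R.
    by apply/funext => q; rewrite big_nil.
  exact: sd_at_const.
have -> : (fun q => \sum_(i <- i :: r) F i q) = fun q => F i q + \sum_(i <- r) F i q.
  by apply/funext => q; rewrite big_cons.
exact: sd_at_add.
Qed.

Lemma sd_at_prod I (r : seq I) (F : I -> V -> R^o) :
  (forall i, sd_at (F i)) -> sd_at (fun q => \prod_(i <- r) (F i q : R)).
Proof.
move=> Fd; elim: r => [|i r IH].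
  have -> : (fun q => \prod_(i <- [::]) (F i q : R)) = fun=> 1 :> R.
    by apply/funext => q; rewrite big_nil.
  exact: sd_at_const.
have -> : (fun q => \prod_(i <- i :: r) (F i q : R)) =
    fun q => F i q * \prod_(i <- r) (F i q : R).
  by apply/funext => q; rewrite big_cons.
exact: sd_at_mul.
Qed.

Lemma sd_at_exp f k : sd_at f -> sd_at (fun q => (f q : R) ^+ k).
Proof.
move=> fd; have := sd_at_prod (nseq k tt) (fun=> fd).
congr sd_at; apply/funext => q; rewrite big_const_seq count_predT size_nseq.
exact: iter_mulr_1.
Qed.

Lemma sd_at_quad (W : vectType R) (Q : 'Hom(W, 'Hom(W, R^o))) (F : V -> W) :
  linear F -> sd_at (fun q => Q (F q) (F q)).
Proof.
move=> Fl; eexists.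
have Qb : bilinear_for *:%R *:%R (fun x y => Q x y).
  by split=> [y c x x'|x c y y']; rewrite /= !(lflin, lfE).
exact: sd_bil Qb (sd_lin l Fl) (sd_lin l Fl).
Qed.

End Differentiable.

Section MinimalPair.
Variables (R : realType) (n : nat) (g : vectType R) (b : 'Hom(g, 'End(g))).
Local Notation U := 'cV[R]_n.
Local Notation Vp := ('Hom(U, 'End(U)) * 'Hom(U, g))%type.
Local Notation VpT := (Vp : vectType R).
Local Notation br := (fun x y => b x y).
Variables (th : 'End(g)) (ip : U -> U -> R) (e : 'I_n -> U).
Hypothesis bL : lie_lfun b.
Hypothesis hth : cartan_involution br (fun x => th x).
Hypothesis hip : inner_product ip.
Hypothesis he : orthonormal_basis ip e.
Local Notation N := (nrm b th ip e).

Lemma linear_id (V : vectType R) : linear (fun x : V => x). Proof. by []. Qed.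

Lemma alt_adherent S (l : VpT) : adherent S l -> (forall q, S q -> alt q) -> alt l.
Proof.
move=> Sl SA x.
have Fl : linear (fun q : VpT => q.1 x x).
  move=> c p q; have -> : (c *: p + q).1 = c *: p.1 + q.1 by [].
  by rewrite !lfE.
by apply: (adherent_eq0 Sl (sd_lin l Fl)) => q /SA.
Qed.

Lemma lieV_adherent S (l : VpT) : adherent S l -> (forall q, S q -> lieV b q) -> lieV b l.
Proof.
move=> Sl SL; have [W [B [Bb Blie _]]] := lie_equations n b.
apply/Blie; split; first by apply: (alt_adherent Sl) => q /SL; exact: lieV_alt.
have idl := linear_id (V := VpT).
by apply: (adherent_eq0 Sl (sd_bil Bb (sd_lin l idl) (sd_lin l idl))) => q /SL/Blie[].
Qed.

Lemma nrm_ge0 (q : Vp) : alt q -> 0 <= N q q.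
Proof.
move=> aq; rewrite nrmE // addr_ge0 ?mulr_ge0 ?invr_ge0 //.
  by apply: sumr_ge0 => i _; apply: sumr_ge0 => j _; exact: (ip_ge0 hip).
by apply: sumr_ge0 => i _; exact: (gip_ge0 bL hth).
Qed.

Lemma nrm_gt0 (q : Vp) : alt q -> q <> 0 -> 0 < N q q.
Proof.
move=> aq q0; rewrite lt_def nrm_ge0 // andbT; apply/eqP => h; apply: q0.
exact: (nrm_eq0 bL hth hip he aq h).
Qed.

Lemma nrmZ c (q : VpT) : N (c *: q) (c *: q) = c ^+ 2 * N q q.
Proof.
have [K KE] := nrm_bil e bL hth hip.
by rewrite -!KE !lfZ scale_lfunE -[LHS]/(c * (c * K q q)) mulrA expr2.
Qed.

Lemma nrm_sd_at l (F : VpT -> VpT) : linear F -> sd_at l (fun q : VpT => N (F q) (F q)).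
Proof.
move=> Fl; have [K KE] := nrm_bil e bL hth hip.
have := sd_at_quad l K Fl; congr sd_at; apply/funext => q; exact: KE.
Qed.

Lemma altZ c (q : VpT) : alt q -> alt (c *: q).
Proof. by move=> aq x; rewrite VpZ1 aq scaler0. Qed.

(** The inner product restricted to alternating pairs is definite, so it is bounded
    below on the compact unit sphere of [vn]. *)
Lemma unit_sphere_bounded : exists K, forall q : VpT, alt q -> N q q = 1 -> vn q <= K.
Proof.
have normalise (q : VpT) : alt q -> 0 < vn q ->
    alt ((vn q)^-1 *: q) /\ vn ((vn q)^-1 *: q) = 1.
  move=> aq q0; split; first exact: altZ.
  by rewrite vnZ ger0_norm ?invr_ge0 ?(ltW q0) // mulVf ?gt_eqF.
have [ex|nex] := pselect (exists q : VpT, alt q /\ vn q = 1); last first.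
  exists 0 => q aq _; rewrite leNgt; apply/negP => q0.
  by apply: nex; exists ((vn q)^-1 *: q); exact: normalise.
have [|||l Sl lmax] := @extreme_point R VpT (fun q => alt q /\ vn q = 1) 1 (fun q => - N q q).
- by move=> q [_ ->].
- exact: ex.
- move=> l _; have [d hd] := sd_at_mul (sd_at_const l (-1)) (nrm_sd_at l (linear_id (V := VpT))).
  have := sd_cts_at hd; congr cts_at; apply/funext => q; exact: mulN1r.
have al : alt l by apply: (alt_adherent Sl) => q [].
have vl : vn l = 1.
  apply/eqP; rewrite -subr_eq0 -normr_le0; apply: le0_of_small => eps eps0.
  have [r r0 hr] := vn_cts_at l eps0; have [q [_ vq] /hr] := Sl r r0.
  by rewrite vq distrC.
have l0 : 0 < N l l.
  apply: nrm_gt0 => // h; move: vl; rewrite h vn0 => /eqP.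
  by rewrite eq_sym oner_eq0.
exists ((N l l)^-1 + 1) => q aq q1; have [q0|q0] := leP (vn q) 1.
  by apply: le_trans q0 _; rewrite lerDr invr_ge0 ltW.
have vq0 : 0 < vn q by exact: lt_trans q0.
have := lmax _ (normalise q aq vq0); rewrite lerN2 nrmZ q1 mulr1 exprVn => h.
have : vn q ^+ 2 <= (N l l)^-1 by rewrite -[leLHS]invrK lef_pV2 ?posrE ?invr_gt0 ?exprn_gt0.
have : vn q <= vn q ^+ 2 by rewrite expr2 ler_peMr ?ltW.
by move: (vn q) ((N l l)^-1) => x y; lra.
Qed.

Lemma det_kgram_sd_at (l : VpT) : sd_at l (fun q : VpT => \det (kgram q)).
Proof.
have entry i j : sd_at l (fun q : VpT => kgram q i j).
  set x : U := delta_mx i 0; set y : U := delta_mx j 0.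
  have kb : bilinear_for *:%R *:%R (fun p q : VpT => ltr (p.1 x \o q.1 y)%VF : R^o).
    split=> [q c p p'|p c q q'].
      have -> : (c *: p + p').1 = c *: p.1 + p'.1 by [].
      by rewrite add_lfunE scale_lfunE comp_lfunDl -comp_lfunZl linearP.
    have -> : (c *: q + q').1 = c *: q.1 + q'.1 by [].
    by rewrite add_lfunE scale_lfunE comp_lfunDr -comp_lfunZr linearP.
  have [K KE] := lfun2_of_bilinear kb.
  have := sd_at_quad l K (linear_id (V := VpT)); congr sd_at.
  by apply/funext => q; rewrite KE !mxE.
apply: sd_at_sum => s; apply: sd_at_mul; first exact: sd_at_const.
by apply: sd_at_prod => i; exact: entry.
Qed.

Lemma det_kgramZ c (q : VpT) : \det (kgram (c *: q)) = c ^+ (2 * n) * \det (kgram q).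
Proof.
rewrite exprM -detZ; congr determinant; apply/matrixP => i j; rewrite !mxE.
have E x : (c *: q).1 x = c *: q.1 x by rewrite -scale_lfunE.
by rewrite /kil !E -comp_lfunZl -comp_lfunZr !linearZ /= mulrA expr2.
Qed.

Variable p0 : Vp.
Hypothesis p0L : lieV b p0.
Hypothesis p0N : nondeg p0.1.
Hypothesis n0 : (0 < n)%N.

Lemma orbit_det q : orbit b p0 q -> \det (kgram q) != 0.
Proof.
move=> [a [u [au _ ->]]]; rewrite det_kgram_act // mulf_neq0 //.
  by rewrite invr_eq0 expf_neq0 // -unitfE -unitmxE.
exact/kgram_nondeg.
Qed.

(** Homotheties of R^n rescale pairs, so every point of the orbit can be brought to the
    unit sphere without leaving the orbit. *)
Lemma orbit_normalise q : orbit b p0 q -> exists c : R,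
  [/\ orbit b p0 (c *: (q : VpT)), N (c *: (q : VpT)) (c *: (q : VpT)) = 1 &
      c ^+ 2 = (N q q)^-1].
Proof.
move=> oq; have qd := orbit_det oq.
have aq := lieV_alt (orbit_lieV bL p0L oq).
have t0 : 0 < N q q.
  apply: nrm_gt0 => // q0; move: qd; rewrite q0.
  have -> : kgram (0 : Vp) = 0.
    apply/matrixP => i j; rewrite !mxE /kil.
    have -> : (0 : Vp).1 = 0 by [].
    by rewrite zero_lfunE comp_lfun0l linear0.
  by case: (n) n0 => // m _; rewrite det0 eqxx.
exists (Num.sqrt (N q q))^-1.
have cE : (Num.sqrt (N q q))^-1 ^+ 2 = (N q q)^-1 by rewrite exprVn sqr_sqrtr // ltW.
split=> //; last by rewrite nrmZ cE mulVf ?gt_eqF.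
by apply: orbit_scale => //; rewrite invr_eq0 gt_eqF // sqrtr_gt0.
Qed.

(** Along the orbit the determinant of the Killing form only changes by det(a)^-2, and
    it scales like the power 2n of the norm. Maximising its square on the unit sphere
    of the orbit therefore minimises the norm under SL_n and inner automorphisms. The
    maximum may only be attained at an adherent point l, but it is positive, so the
    bracket of l still has a nondegenerate Killing form. *)
Lemma minimal_pair : exists l : VpT,
  [/\ lieV b l, nondeg l.1, N l l = 1, adherent (orbit b p0) l &
      forall a u, a \in unitmx -> \det a = 1 -> inner b u ->
        1 <= N (actV a (invmx a) u l) (actV a (invmx a) u l)].
Proof.
pose S (q : VpT) := orbit b p0 q /\ N q q = 1.
pose f (q : VpT) := (\det (kgram q)) ^+ 2.
have [K KE] := unit_sphere_bounded.
have SL q : S q -> lieV b q by move=> [oq _]; exact: orbit_lieV oq.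
have fd l : sd_at l f by exact: sd_at_exp (det_kgram_sd_at l).
have [|||l Sl lmax] := @extreme_point R VpT S K f.
- by move=> q Sq; apply: KE Sq.2; exact: lieV_alt (SL q Sq).
- by have [c [h1 h2 _]] := orbit_normalise (orbit_refl b p0); exists (c *: (p0 : VpT)).
- by move=> l _; have [d hd] := fd l; exact: sd_cts_at hd.
have f0 : 0 < f l.
  have [q Sq _] := Sl 1 ltr01; apply: lt_le_trans (lmax q Sq).
  by rewrite /f exprn_even_gt0 //= orbit_det //; exact: Sq.1.
exists l; split.
- exact: lieV_adherent Sl SL.
- by apply/kgram_nondeg; move: f0; rewrite /f exprn_even_gt0.
- apply/eqP; rewrite -subr_eq0; apply/eqP.
  have [d hd] := sd_at_add (nrm_sd_at l (linear_id (V := VpT))) (sd_at_const l (-1)).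
  by apply: (adherent_eq0 (W := R^o) Sl hd) => q [_ ->]; rewrite subrr.
- by move=> eps /Sl[q [oq _] h]; exists q.
move=> a u au a1 iu; set F := actV a (invmx a) u.
have Fl : linear (F : VpT -> VpT) by exact: actV_linear.
(* Apply maximality to F q, rescaled to the unit sphere, and let q tend to l. *)
have key (q : VpT) : S q -> 0 <= N (F q) (F q) ^+ (2 * n) * f l - f q.
  move=> [oq _]; have oF : orbit b p0 (F q) by exact: orbit_act.
  have [c [oc Nc cE]] := orbit_normalise oF.
  have := lmax _ (conj oc Nc); rewrite /f det_kgramZ det_kgram_act // a1 expr1n invr1 mul1r.
  rewrite exprMn -exprM -mulnA exprM cE (mulnC n) exprVn => h.
  have t0 : 0 < N (F q) (F q).
    rewrite -invr_gt0 -cE exprn_even_gt0 //=; apply/eqP => c0.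
    by move: Nc; rewrite c0 nrmZ expr2 !mul0r => /eqP; rewrite eq_sym oner_eq0.
  rewrite subr_ge0 mulrC -ler_pdivrMr ?exprn_gt0 // mulrC; exact: h.
have [d hd] := sd_at_add (sd_at_mul (sd_at_exp (2 * n) (nrm_sd_at l Fl)) (sd_at_const l (f l)))
  (sd_at_mul (sd_at_const l (-1)) (fd l)).
have := adherent_ge0 Sl (sd_cts_at hd).
have hk q : S q -> 0 <= N (F q) (F q) ^+ (2 * n) * f l + -1 * f q.
  by move=> /key; rewrite mulN1r.
move=> /(_ hk); rewrite mulN1r subr_ge0 -[leLHS]mul1r ler_pM2r // => h.
have aF : alt (F l).
  apply: lieV_alt; apply: (lieV_act au _ (lieV_adherent Sl SL)) => x y.
  exact: inner_automorphism.
rewrite leNgt; apply/negP => lt1; move: h; apply/negP; rewrite -ltNge.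
by rewrite exprn_ilt1 ?nrm_ge0 // muln_eq0 -lt0n.
Qed.

End MinimalPair.

(** * The moment map at the minimum *)

Section RankOne.
Variables (R : realType) (n : nat).

(** The block matrix [[1, -v], [u, 1]] has two triangular factorisations, according to
    which diagonal block is used as pivot. *)
Lemma det_rank_one (u : 'cV[R]_n) (v : 'rV[R]_n) : v *m u = 0 ->
  \det (1%:M + u *m v) = 1.
Proof.
move=> vu; pose M := block_mx (1%:M : 'M[R]_1) (- v) u (1%:M : 'M[R]_n).
have E1 : M = block_mx 1%:M 0 u 1%:M *m block_mx 1%:M (- v) 0 (1%:M + u *m v).
  rewrite mulmx_block !mul1mx !mulmx1 ?mul0mx ?mulmx0 !addr0 mulmxN.
  by rewrite addrCA addNr addr0.
have E2 : M = block_mx 1%:M (- v) 0 1%:M *m block_mx 1%:M 0 u 1%:M.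
  by rewrite mulmx_block !mul1mx !mulmx1 ?mul0mx ?mulmx0 !add0r mulNmx vu oppr0 addr0.
have := congr1 determinant E1; rewrite E2 !det_mulmx !det_lblock !det_ublock.
by rewrite !det1 !mul1r.
Qed.

(** The nilpotent matrices of rank one span the traceless matrices. *)
Lemma trace_functional (F : 'Hom('M[R]_n, R^o)) (k : 'I_n) :
  (forall (u : 'cV[R]_n) (v : 'rV[R]_n), v *m u = 0 -> F (u *m v) = 0) ->
  forall A, F A = F (delta_mx k k) * \tr A.
Proof.
move=> F0.
have dd (i j : 'I_n) : (delta_mx i 0 : 'cV[R]_n) *m (delta_mx 0 j : 'rV[R]_n) = delta_mx i j.
  by rewrite mul_delta_mx.
have dd0 (i j : 'I_n) : (delta_mx 0 i : 'rV[R]_n) *m (delta_mx j 0 : 'cV[R]_n) = (i == j)%:R%:M.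
  have [->|ij] := eqVneq i j; last by rewrite mul_delta_mx_0 // raddf0.
  by rewrite mul_delta_mx; apply/matrixP => a c; rewrite !ord1 !mxE !eqxx.
have off i j : i != j -> F (delta_mx i j) = 0.
  by move=> ij; rewrite -dd F0 // dd0 eq_sym (negPf ij) raddf0.
have diag i : F (delta_mx i i) = F (delta_mx k k).
  have [->//|ik] := eqVneq i k.
  have := F0 (delta_mx i 0 + delta_mx k 0) (delta_mx 0 i - delta_mx 0 k).
  have ki : k != i by rewrite eq_sym.
  rewrite !(mulmxDl, mulmxBr, mulmxDr) !mulNmx !dd !dd0 !eqxx (negPf ik) (negPf ki).
  rewrite raddf0 oppr0 addr0 add0r subrr => /(_ erefl).
  rewrite !lfD !lfN (off i k) // (off k i) // oppr0 addr0 add0r => /eqP.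
  by rewrite subr_eq0 => /eqP.
move=> A; rewrite {1}(matrix_sum_delta A) lf_sum mulr_sumr; apply: eq_bigr => i _.
rewrite lf_sum (bigD1 i) //= big1 ?addr0 => [|j ji].
  by rewrite lfZ diag -[LHS]/(A i i * _) mulrC.
by rewrite lfZ off 1?eq_sym // scaler0.
Qed.

End RankOne.

Section Criticality.
Variables (R : realType) (n : nat) (g : vectType R) (b : 'Hom(g, 'End(g))).
Local Notation U := 'cV[R]_n.
Local Notation Vp := ('Hom(U, 'End(U)) * 'Hom(U, g))%type.
Local Notation VpT := (Vp : vectType R).
Local Notation ET := ((('M[R]_n * g)%type) : vectType R).
Local Notation br := (fun x y => b x y).
Variables (th : 'End(g)) (ip : U -> U -> R) (e : 'I_n -> U).
Hypothesis bL : lie_lfun b.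
Hypothesis hth : cartan_involution br (fun x => th x).
Hypothesis hip : inner_product ip.
Hypothesis he : orthonormal_basis ip e.
Local Notation N := (nrm b th ip e).
Variable l : VpT.
Hypothesis l1 : N l l = 1.
Hypothesis lmin : forall a u, a \in unitmx -> \det a = 1 -> inner b u ->
  1 <= N (actV a (invmx a) u l) (actV a (invmx a) u l).
Hypothesis n0 : (0 < n)%N.

Lemma nrm_sym p q : N p q = N q p.
Proof.
congr (_ + _); first by apply: eq_bigr => i _; apply: eq_bigr => j _; exact: (ip_sym hip).
by apply: eq_bigr => i _; exact: (gip_sym hth).
Qed.

(** For N = u v with v u = 0 the matrices 1 + t N have determinant 1 and inverse
    1 - t N, so the squared norm along the corresponding curve has a minimum at 0. *)
Lemma nilpotent_critical (u : 'cV[R]_n) (v : 'rV[R]_n) (w : g) : v *m u = 0 ->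
  N (laV b (u *m v, w) l) l = 0.
Proof.
move=> vu; pose X : 'M[R]_n * g := (u *m v, w).
have [K KE] := nrm_bil e bL hth hip.
have Kb : bilinear_for *:%R *:%R (fun x y => K x y).
  by split=> [y c x x'|x c y y']; rewrite /= !(lflin, lfE).
have cs := action_curve_sd b X l.
have := minimum_critical (sd_bil Kb cs cs); rewrite /= !scale0r addr0 subr0 lf0 lexp0 actV_id.
rewrite scale1r !KE (nrm_sym l) => h.
suff : N (laV b X l) l + N (laV b X l) l = 0.
  by move: (N _ _) => x; lra.
apply: h => t; rewrite KE l1.
have sq : u *m v *m (u *m v) = 0 by rewrite mulmxA -(mulmxA u) vu mulmx0 mul0mx.
have detE s : \det (1%:M + s *: (u *m v)) = 1.
  by rewrite scalemxAl det_rank_one // -scalemxAr vu scaler0.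
have au : 1%:M + t *: (u *m v) \in unitmx by rewrite unitmxE detE unitr1.
have -> : 1%:M - t *: (u *m v) = invmx (1%:M + t *: (u *m v)).
  apply: (can_inj (mulKmx au)); rewrite mulmxV // mulmxDl mul1mx mulmxBr mulmx1.
  by rewrite -scalemxAl -scalemxAr sq !scaler0 subr0 subrK.
apply: lmin => //.
by have := inner_lexp (t *: w) (inner1 b); rewrite comp_lfun1r.
Qed.

(** The first variation is linear in X and vanishes on [g] and on nilpotent matrices of
    rank one, so it only depends on the trace. *)
Lemma critical : exists c, forall X, N (laV b X l) l = c * \tr X.1.
Proof.
have [K KE] := nrm_bil e bL hth hip.
have [F FE] : exists F : 'Hom('M[R]_n, R^o), forall A, F A = N (laV b (A, 0) l) l.
  apply: lfun_of_linear => c A B.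
  have -> : (c *: A + B, 0) = c *: ((A, 0) : ET) + (B, 0).
    by congr (_, _); rewrite /= scaler0 addr0.
  by rewrite laV_linear -!KE lfD lfZ add_lfunE scale_lfunE.
pose k := Ordinal n0; exists (F (delta_mx k k)) => -[A w] /=.
have tF := @trace_functional R n F k.
rewrite -tF => [|u v vu]; last by rewrite FE nilpotent_critical.
rewrite FE; have -> : (A, w) = 1 *: ((A, 0) : ET) + (0, w).
  by congr (_, _); rewrite /= ?scale1r ?addr0 ?add0r // scale1r add0r.
rewrite laV_linear -!KE lfD lfZ add_lfunE scale_lfunE scale1r !KE.
have := nilpotent_critical (u := 0) (v := 0) w (mulmx0 _ _).
by rewrite mulmx0 => ->; rewrite addr0.
Qed.

Lemma laV_identity (q : VpT) : laV b (1%:M, 0) q = - q.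
Proof.
apply: Vp_eq => [x y|x].
  have -> : (- q).1 x y = - q.1 x y by rewrite -opp_lfunE -opp_lfunE.
  by rewrite laV1 /= !mul1mx subrr sub0r.
have -> : (- q).2 x = - q.2 x by rewrite -opp_lfunE.
by rewrite laV2 /= mul1mx lf0 lfE sub0r.
Qed.

(** The constant is found at X = (I, 0), which acts by -1. *)
Lemma critical_value : forall X, N (laV b X l) l = - n%:R^-1 * \tr X.1.
Proof.
have [c cE] := critical => X; rewrite cE; congr (_ * _).
have [K KE] := nrm_bil e bL hth hip.
have := cE (1%:M, 0); rewrite mxtrace1.
rewrite laV_identity -KE lfN lfE KE l1 => h; apply: (mulIf (_ : n%:R != 0)).
  by rewrite pnatr_eq0 -lt0n.
by rewrite -h mulNr mulVf // pnatr_eq0 -lt0n.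
Qed.

End Criticality.

(** * The minimum of the energy *)

Section OrbitOfMinimum.
Variables (R : realType) (n : nat) (g : vectType R) (b : 'Hom(g, 'End(g))).
Local Notation U := 'cV[R]_n.
Local Notation Vp := ('Hom(U, 'End(U)) * 'Hom(U, g))%type.
Local Notation VpT := (Vp : vectType R).
Local Notation br := (fun x y => b x y).
Variables (th : 'End(g)) (ip : U -> U -> R) (e : 'I_n -> U).
Hypothesis bL : lie_lfun b.
Hypothesis hth : cartan_involution br (fun x => th x).
Hypothesis hip : inner_product ip.
Hypothesis he : orthonormal_basis ip e.
Hypothesis n0 : (0 < n)%N.
Local Notation N := (nrm b th ip e).
Local Notation gc := (gc_ip br (fun x => th x) ip).
Local Notation E := (energy br (fun x => th x) ip e).

(** The minimal pair is critical, hence locally rigid; being adherent to the orbit of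
    p, it lies in that orbit. *)
Lemma critical_point_in_orbit (p : Vp) : lieV b p -> nondeg p.1 ->
  exists l : VpT, [/\ orbit b p l, N l l = 1 &
    forall X, N (laV b X l) l = - n%:R^-1 * \tr X.1].
Proof.
move=> pL pN; have [l [lL lN l1 Sl lmin]] := minimal_pair bL hth hip he pL pN n0.
have crit := critical_value bL hth hip l1 lmin n0.
exists l; split=> //.
have rig := infinitesimal_rigidity bL hth hip he lL lN crit.
have [eta eta0 near_l] := local_rigidity bL lL rig.
have [q oq /near_l] := Sl eta eta0.
move=> /(_ (orbit_lieV bL pL oq))[a [v [au ->]]].
rewrite -{2}[a]invmxK; apply: orbit_act => //; first by rewrite unitmx_inv.
by have := inner_lexp v (inner1 b); rewrite comp_lfun1r.
Qed.

Lemma adjoint1 : adjoint_mx ip 1%:M = 1%:M.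
Proof. by rewrite /adjoint_mx trmx1 mulmx1 mulVmx // gram_unit. Qed.

Lemma tr_adjoint (A : 'M[R]_n) : \tr (adjoint_mx ip A) = \tr A.
Proof.
by rewrite /adjoint_mx mxtrace_mulC mulmxA mulmxV ?gram_unit // mul1mx mxtrace_tr.
Qed.

Lemma gc_scalarl (c : R) X : gc (c%:M, 0) X = c * \tr X.1.
Proof.
have [G GE] := gip_bil bL hth.
have -> : gc (c%:M, 0) X = \tr (c%:M *m adjoint_mx ip X.1) + gip b th 0 X.2 by [].
by rewrite -GE lf0 lfE addr0 mul_scalar_mx mxtraceZ tr_adjoint.
Qed.

Lemma gc_scalarr (c : R) X : gc X (c%:M, 0) = c * \tr X.1.
Proof.
have [G GE] := gip_bil bL hth.
have -> : gc X (c%:M, 0) = \tr (X.1 *m adjoint_mx ip c%:M) + gip b th X.2 0 by [].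
rewrite -GE lf0 addr0 -scalemx1 /adjoint_mx linearZ /= -scalemxAr -scalemxAl.
by rewrite -/(adjoint_mx ip 1%:M) adjoint1 -scalemxAr mulmx1 mxtraceZ.
Qed.

Lemma unp_neq0 (q : VpT) : unp q <> 0 -> q <> 0.
Proof.
move=> q0 q00; apply: q0; rewrite q00.
by have := unpZ 0 (0 : VpT); rewrite !scale0r.
Qed.

(** Pairing the moment map with the homothety (I, 0), which acts by -1, gives
    -1, and (I, 0) has squared length n: Cauchy-Schwarz. *)
Lemma energy_ge (P : set (pairs n g)) : proj_L br P -> n%:R^-1 <= E P.
Proof.
move=> PL; have [p [pL p0] PE] := PL.
have [q qE] := unp_surj pL; have qL : lieV b q by rewrite /lieV qE.
have mP := moment_mapP bL hth hip he PL.
rewrite /energy; set M := moment_map _ _ _ _ _ in mP *.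
have gcM : \tr M.1 = -1.
  have Pp : P p by rewrite -PE; exists 1; rewrite /= ?oner_neq0 ?scale1r.
  have := mP p Pp (1%:M, 0); rewrite gc_scalarr mul1r => ->.
  rewrite -qE unp_la laV_identity.
  have N0 : 0 < N q q.
    apply: nrm_gt0 => //; first exact: lieV_alt qL.
    by apply: unp_neq0; rewrite qE.
  have [K KE] := nrm_bil e bL hth hip.
  rewrite -[pair_ip _ _ _ _ (unp (- q)) _]/(N (- q) q) -/(N q q).
  by rewrite -KE lfN lfE KE mulNr divff // gt_eqF.
pose Y : ('M[R]_n * g)%type := ((n%:R^-1)%:M, 0) + M.
have : 0 <= gc Y Y.
  have [->|/(gc_ip_pos bL hth hip he)/ltW //] := eqVneq Y 0.
  have -> : (0 : 'M[R]_n * g) = (0%:M, 0) by congr (_, _); rewrite raddf0.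
  by rewrite gc_scalarl mul0r.
have [gl gr] := gc_ip_bilinear ip bL hth.
have YE : Y = 1 *: ((n%:R^-1)%:M, 0) + M by rewrite scale1r.
have -> : gc Y Y = gc M M - n%:R^-1.
  rewrite {1}YE; have /= -> := gl Y 1 ((n%:R^-1)%:M, 0) M.
  rewrite gc_scalarl YE; have /= -> := gr M 1 ((n%:R^-1)%:M, 0) M.
  rewrite gc_scalarr scale1r mxtraceD mxtrace_scalar gcM -[_^-1 *+ n]mulr_natr mulVf; last first.
    by rewrite pnatr_eq0 -lt0n.
  by rewrite subrr; ring.
by rewrite subr_ge0.
Qed.

(** The hypothesis says that the moment map is (- I / n, 0). *)
Lemma energy_critical (l : VpT) : lieV b l -> N l l = 1 ->
  (forall X, N (laV b X l) l = - n%:R^-1 * \tr X.1) ->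
  proj_L br (proj_class (unp l)) /\ E (proj_class (unp l)) = n%:R^-1.
Proof.
move=> lL l1 crit.
have PL : proj_L br (proj_class (unp l)).
  exists (unp l) => //; split=> // l0.
  have := pair_ip_scale e bL hth hip 0 (unp l) (unp l).
  rewrite scale0r -l0 expr2 !mul0r -[pair_ip _ _ _ _ _ _]/(N l l) l1 => /eqP.
  by rewrite oner_eq0.
split=> //; have mE : ((- n%:R^-1)%:M, 0) = moment_map br (fun x => th x) ip e (proj_class (unp l)).
  apply: (moment_map_uniq bL hth hip he PL) => _ [c /= c0 <-] X.
  rewrite (lie_gc_action_scale bL) !(pair_ip_scale e bL hth hip) unp_la.
  rewrite -[pair_ip _ _ _ _ (unp (laV _ _ _)) _]/(N (laV b X l) l).
  rewrite -[pair_ip _ _ _ _ _ _]/(N l l) l1 crit mulr1 gc_scalarl mulrAC divff ?mul1r //.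
  by rewrite expf_neq0.
rewrite /energy -mE gc_scalarl mxtrace_scalar -[- _ *+ n]mulr_natr mulrA mulrNN -mulrA mulVf ?mulr1 //.
by rewrite pnatr_eq0 -lt0n.
Qed.

End OrbitOfMinimum.

Theorem theorem1p1 (R : realType) (g : vectType R) (br : g -> g -> g)
    (hbr : semisimple_lie br)
    (theta : g -> g) (htheta : cartan_involution br theta)
    (n : nat) (hn : (1 <= n)%N)
    (ip : 'cV[R]_n -> 'cV[R]_n -> R) (hip : inner_product ip)
    (e : 'I_n -> 'cV[R]_n) (he : orthonormal_basis ip e)
    (mu : 'cV[R]_n -> 'cV[R]_n -> 'cV[R]_n) (phi : 'cV[R]_n -> g)
    (hpair : lie_pair br (mu, phi)) (hnz : (mu, phi) <> 0)
    (hss : semisimple_lie mu) :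
  exists Q : set (pairs n g),
    [/\ gc_orbit br (proj_class (mu, phi)) Q,
        proj_L br Q
      & forall P : set (pairs n g), proj_L br P ->
          energy br theta ip e Q <= energy br theta ip e P].
Proof.
have [b bE] : exists b : 'Hom(g, 'End(g)), (fun x y => b x y) = br.
  have [[brb _ _] _] := hbr; have [b bE] := lfun2_of_bilinear brb.
  by exists b; apply/funext => x; apply/funext => y.
have [th thE] : exists th : 'End(g), (fun x => th x) = theta.
  have [thl _ _ _] := htheta; have [th thE] := lfun_of_linear thl.
  by exists th; apply/funext.
subst br theta; have bL : lie_lfun b := hbr.1.
have [p pE] := unp_surj hpair; have pL : lieV b p by rewrite /lieV pE.
have pN : nondeg p.1.
  have muE : mu = (fun x y => p.1 x y) by case: pE.
  by rewrite muE in hss; exact: (cartan_criterion hss.1 hss).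
have [l [[a [u [au iu lE]]] l1 crit]] := critical_point_in_orbit bL htheta hip he hn pL pN.
have lL : lieV b l.
  by rewrite lE; apply: lieV_act => // x y; exact: inner_automorphism.
have [QL QE] := energy_critical bL htheta hip he hn lL l1 crit.
exists (proj_class (unp l)); split=> // [|P PL]; last first.
  by rewrite QE; exact: energy_ge.
exists a, (fun x => u x); split=> //.
have actE c : gc_action a (fun x => u x) (c *: unp p) = c *: unp l.
  rewrite -!unpZ unp_act; congr unp.
  have [F FE] := lfun_of_linear (actV_linear a (invmx a) u).
  by rewrite lE -!FE lfZ.
rewrite -pE; apply/seteqP; split=> [_ [c c0 <-]|_ [_ [c c0 <-] <-]].
  by exists (c *: unp p); [exists c|exact: actE].
by exists c; rewrite ?actE.
Qed.
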